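(* Let $G$ be a connected real Lie group and let $R\ge0$ and $R'\ge1$. Then the Weyl star product extends to a continuous multiplication $$\star_{\mathrm{Weyl}}\colon\widehat{\mathrm{Pol}}_{R,R'}(T^*G)\times\widehat{\mathrm{Pol}}_{R,R'}(T^*G)\longrightarrow\widehat{\mathrm{Pol}}_{R,R'}(T^*G)$$ with entire dependence on $\hbar$, i.e. for all $P,Q\in\widehat{\mathrm{Pol}}_{R,R'}(T^*G)$ the map $\mathbb C\ni\hbar\mapsto P\star_{\mathrm{Weyl}}Q\in\widehat{\mathrm{Pol}}_{R,R'}(T^*G)$ is entire.
   Context: All functions are complex-valued. $G$ is a connected real Lie group of dimension $n$ with Lie algebra $\mathfrak g$, unit $\mathrm e$ and fixed basis $(e_1,\dots,e_n)$ of $\mathfrak g$; for $\xi\in\mathfrak g$, $X_\xi$ is the left-invariant vector field with $X_\xi(\mathrm e)=\xi$, and $X_i=X_{e_i}$. For $\alpha\in\{1,\dots,n\}^k$ put $\mathcal L_{X_\alpha}=\mathcal L_{X_{\alpha_1}}\cdots\mathcal L_{X_{\alpha_k}}$. Set $$q_{R,c}(\phi)=\sum_{k\ge0}k!^{R-1}c^k\sum_{\alpha\in\{1,\dots,n\}^k}|(\mathcal L_{X_\alpha}\phi)(\mathrm e)|,$$ and $\mathscr E_R(G)=\{\phi\in C^\omega(G):q_{R,c}(\phi)<\infty\ \forall c\ge0\}$ ($C^\omega$ = real-analytic), topologized by all $q_{R,c}$. $\mathrm{Sym}_{R'}(\mathfrak g)$ is the (complexified) symmetric algebra, with product $\vee$,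 topologized by $p_{R',c}(v)=\sum_{k}k!^{R'}c^k\,p^k(v_k)$, $c\ge0$, where $v=\sum_kv_k$ with $v_k\in\mathrm{Sym}^k(\mathfrak g)$, $p$ is the $\ell^1$-norm on $\mathfrak g$ for the chosen basis and $p^k$ its $k$-fold projective tensor power on $\mathrm{Sym}^k(\mathfrak g)\subseteq\mathfrak g^{\otimes k}$. $\mathrm{Pol}_{R,R'}(T^*G)=\mathscr E_R(G)\otimes\mathrm{Sym}_{R'}(\mathfrak g)$ carries the projective tensor product topology, and $\widehat{\mathrm{Pol}}_{R,R'}(T^*G)$ is its completion. Let $\Delta(\phi\otimes\xi_1\vee\dots\vee\xi_k)=\sum_{\ell=1}^k\mathcal L_{X_{\xi_\ell}}\phi\otimes\xi_1\vee\dots\widehat{\xi_\ell}\dots\vee\xi_k$ (omit $\xi_\ell$) and $N=\exp(-\tfrac{\mathrm i\hbar}{2}\Delta)$, $N^{-1}=\exp(\tfrac{\mathrm i\hbar}{2}\Delta)$ on $C^\infty(G)\otimes\mathrm{Sym}^\bullet(\mathfrak g)$. Star products, for $\hbar\in\mathbb C$ and $z=\hbar/\mathrm i$: the Gutt star product $\star_{\mathfrak g}$ on $\mathrm{Sym}^\bullet(\mathfrak g)$ is, for $z\neq0$, $\xi\star_{\mathfrak g}\eta=\mathfrak q_z^{-1}(\mathfrak q_z(\xi)\mathfrak q_z(\eta))$, where $\mathfrak q_z\colon\mathrm{Sym}^\bullet(\mathfrak g)\to\mathrm U_{\mathbb C}(\mathfrak g)$ is the linear isomorphism onto the complexified universal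 enveloping algebra with $\mathfrak q_z(\xi_1\vee\dots\vee\xi_k)=\frac{z^k}{k!}\sum_{\sigma\in S_k}\xi_{\sigma(1)}\cdots\xi_{\sigma(k)}$; the result is polynomial in $z$ and equals $\xi\vee\eta$ at $z=0$. The standard-ordered star product is $$(\phi\otimes\xi_1\vee\dots\vee\xi_k)\star_{\mathrm{std}}(\psi\otimes\eta)=\sum_{p=0}^k\Bigl(\frac{\hbar}{\mathrm i}\Bigr)^p\frac1{p!\,(k-p)!}\sum_{\sigma\in S_k}\bigl(\phi\cdot\mathcal L_{X_{\xi_{\sigma(1)}}}\cdots\mathcal L_{X_{\xi_{\sigma(p)}}}\psi\bigr)\otimes\bigl((\xi_{\sigma(p+1)}\vee\dots\vee\xi_{\sigma(k)})\star_{\mathfrak g}\eta\bigr),$$ and the Weyl star product is $P\star_{\mathrm{Weyl}}Q=N^{-1}\bigl((NP)\star_{\mathrm{std}}(NQ)\bigr)$. *)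

(* Defs.v *)
From HB Require Import structures.
From mathcomp Require Import all_boot all_order all_algebra all_fingroup.
From mathcomp Require Import boolp classical_sets functions reals ereal.
From mathcomp Require Import topology normedtype sequences derive exp.
From mathcomp Require Import complex.
(* The notations of monalg clash with those of the topology files. *)
From mathcomp.finmap Require Import -(notations) finmap.
From mathcomp.multinomials Require Import -(notations) monalg.

Set Implicit Arguments.
Unset Strict Implicit.
Unset Printing Implicit Defensive.

Import Order.TTheory GRing.Theory Num.Theory.
Import numFieldTopology.Exports numFieldNormedType.Exports.

Local Open Scope classical_set_scope.
Local Open Scope ring_scope.

Notation normc := ComplexField.Normc.normc.

(* f is near x the sum of an absolutely convergent power series, written as a
   series of homogeneous terms; words (not sorted) index the coefficients. *)
Definition analytic_at (R : realType) (n : nat) (f : 'rV[R]_n -> R)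
    (x : 'rV[R]_n) : Prop :=
  exists (a : seq 'I_n -> R) (r : R), [/\ 0 < r,
    (\sum_(0 <= k <oo)
        (r ^+ k * \sum_(w : k.-tuple 'I_n) `|a w|)%:E < +oo)%E &
    forall y : 'rV[R]_n, (forall i, `|y ord0 i - x ord0 i| < r) ->
      series (fun k => \sum_(w : k.-tuple 'I_n)
        a w * \prod_(i <- w) (y ord0 i - x ord0 i)) @ \oo --> f y].

Definition analytic_map_at (R : realType) (m n : nat)
    (f : 'rV[R]_m -> 'rV[R]_n) (x : 'rV[R]_m) : Prop :=
  forall i, analytic_at (fun y => f y ord0 i) x.

(* The atlas has one chart [chart g], defined on [chart_dom g], around every
   point g. A connected Lie group is automatically second countable. *)
HB.mixin Record isLieGroup (R : realType) (n : nat) G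
    & Topological G & monoid.Group G := {
  lie_hausdorff : hausdorff_space G;
  chart_dom : G -> set G;
  chart : G -> G -> 'rV[R]_n;
  chart_inv : G -> 'rV[R]_n -> G;
  chart_dom_center : forall g, chart_dom g g;
  chart_dom_open : forall g, open (chart_dom g);
  chart_image_open : forall g, open (chart g @` chart_dom g);
  chartK : forall g x, chart_dom g x -> chart_inv g (chart g x) = x;
  chart_continuous : forall g x, chart_dom g x ->
    {for x, continuous (chart g)};
  chart_inv_continuous : forall g x, chart_dom g x ->
    {for chart g x, continuous (chart_inv g)};
  chart_transition : forall g h x, chart_dom g x -> chart_dom h x ->
    analytic_map_at (chart h \o chart_inv g) (chart g x);
  lie_mul_continuous : continuous (fun gh : G * G => (gh.1 * gh.2)%g);
  lie_mul_analytic : forall g h : G,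
    analytic_map_at
      (fun u : 'rV[R]_(n + n) => chart (g * h)%g
         (chart_inv g (lsubmx u) * chart_inv h (rsubmx u))%g)
      (row_mx (chart g g) (chart h h));
  lie_inv_continuous : continuous (fun g : G => (g^-1)%g);
  lie_inv_analytic : forall g : G,
    analytic_map_at (fun u : 'rV[R]_n => chart (g^-1)%g ((chart_inv g u)^-1)%g)
      (chart g g)
}.

#[short(type="lieGroupType")]
HB.structure Definition LieGroup (R : realType) (n : nat) :=
  {G of isLieGroup R n G & Topological G & monoid.Group G}.

Section LieCalculus.
Context (R : realType) (n : nat) (G : lieGroupType R n).
Implicit Types (xi eta : 'rV[R]_n) (phi : G -> R[i]) (g : G).

Let crd : G -> G -> 'rV[R]_n := @chart R n G.
Let pnt : G -> 'rV[R]_n -> G := @chart_inv R n G.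

(* Tangent vectors at the unit are given by their components in [chart 1].
   (X_xi f)(g) is xi applied to f \o (left translation by g). Junk value when
   the derivative does not exist; only used where f is analytic. *)
Definition lieR xi (f : G -> R) : G -> R := fun g =>
  derive1 (fun t : R => f (g * pnt 1%g (crd 1%g 1%g + t *: xi))%g) 0.

Definition lieC xi phi : G -> R[i] := fun g =>
  Complex (lieR xi (fun x => complex.Re (phi x)) g)
          (lieR xi (fun x => complex.Im (phi x)) g).

(* The commutator of the left-invariant fields, evaluated at the unit on the
   coordinate functions. *)
Definition lie_bracket xi eta : 'rV[R]_n :=
  \row_k (lieR xi (lieR eta (fun x => crd 1%g x ord0 k)) 1%g -
          lieR eta (lieR xi (fun x => crd 1%g x ord0 k)) 1%g).

Definition real_analytic phi : Prop := forall g,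
  analytic_at (fun u => complex.Re (phi (pnt g u))) (crd g g) /\
  analytic_at (fun u => complex.Im (phi (pnt g u))) (crd g g).

(* Row i of the invertible matrix B is the basis vector e_i of the Lie
   algebra. *)
Context (B : 'M[R]_n).

Definition lie_word (w : seq 'I_n) phi : G -> R[i] :=
  foldr (fun i => lieC (row i B)) phi w.

Definition struct_const (i j k : 'I_n) : R :=
  (lie_bracket (row i B) (row j B) *m invmx B) ord0 k.

Definition qnorm (r c : R) phi : \bar R :=
  (\sum_(0 <= k <oo) ((k`!%:R `^ (r - 1)) * c ^+ k *
      \sum_(w : k.-tuple 'I_n) normc (lie_word w phi 1%g))%:E)%E.

Definition ER (r : R) : set (G -> R[i]) :=
  [set phi | real_analytic phi /\
             forall c, 0 <= c -> (qnorm r c phi < +oo)%E].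

End LieCalculus.

(* The basis e_0, ..., e_(n-1) identifies the complexified symmetric algebra
   with the commutative polynomials, and the complexified tensor algebra with
   the noncommutative ones. *)
Notation Sym R n := (malg (cmonom 'I_n) R[i]).
Notation Tens R n := (malg (fmonom 'I_n) R[i]).

(* The sorted word of the indices of m, with multiplicities. *)
Definition mword (n : nat) (m : cmonom 'I_n) : seq 'I_n :=
  flatten [seq nseq (m i) i | i <- enum 'I_n].

Definition permw (n : nat) (w : seq 'I_n) (s : 'S_(size w)) : seq 'I_n :=
  [seq tnth (in_tuple w) (s j) | j <- enum 'I_(size w)].

Section Symmetric.
Context (R : realType) (n : nat).

Definition sym_word (w : seq 'I_n) : Sym R n :=
  \prod_(i <- w) mkmalgU (ucm i) 1.

Definition tens_word (w : seq 'I_n) : Tens R n :=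
  \prod_(i <- w) mkmalgU (fmu i) 1.

(* k-fold tensors, by components in the basis. *)
Definition tensor (k : nat) := {ffun k.-tuple 'I_n -> R[i]}.

(* Sym^k sits in the k-fold tensors through
   xi_1 v ... v xi_k = 1/k! \sum_s xi_(s 1) (x) ... (x) xi_(s k). *)
Definition sym_tensor (k : nat) (v : Sym R n) : tensor k :=
  [ffun w : k.-tuple 'I_n =>
    \sum_(m <- msupp v | size (mword m) == k)
      mcoeff m v * (k`!%:R)^-1 *
        \sum_(s : 'S_(size (mword m))) (permw s == w :> seq 'I_n)%:R].

Definition l1norm (x : 'I_n -> R[i]) : R := \sum_i normc (x i).

(* Projective tensor power of the l1-norm; the scalars a matter for k = 0. *)
Definition proj_tensor_norm (k : nat) (t : tensor k) : R :=
  inf [set s | exists (N : nat) (a : 'I_N -> R[i])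
                      (x : 'I_N -> 'I_k -> 'I_n -> R[i]),
    (forall w : k.-tuple 'I_n,
       t w = \sum_j a j * \prod_(l < k) x j l (tnth w l)) /\
    s = \sum_j normc (a j) * \prod_(l < k) l1norm (x j l)].

Definition pnorm (r c : R) (v : Sym R n) : R :=
  \sum_(k < msize v) (k`!%:R `^ r) * c ^+ k *
    proj_tensor_norm (sym_tensor k v).

Context (cst : 'I_n -> 'I_n -> 'I_n -> R).

Definition env_relator (i j : 'I_n) : Tens R n :=
  tens_word [:: i; j] - tens_word [:: j; i] -
  \sum_k (real_complex R (cst i j k)) *: tens_word [:: k].

(* Equality in the enveloping algebra, the quotient of the tensor algebra by
   the two-sided ideal generated by the relators. *)
Definition env_eq (t u : Tens R n) : Prop :=
  exists (N : nat) (a b : 'I_N -> Tens R n) (i j : 'I_N -> 'I_n),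
    t - u = \sum_l a l * env_relator (i l) (j l) * b l.

(* A representative in the tensor algebra of the element q_z(v) of the
   enveloping algebra. *)
Definition gutt_quant (z : R[i]) (v : Sym R n) : Tens R n :=
  \sum_(m <- msupp v) let w := mword m in
    (mcoeff m v * z ^+ size w / (size w)`!%:R) *:
      \sum_(s : 'S_(size w)) tens_word (permw s).

(* For z != 0, q_z is a linear bijection onto the enveloping algebra, so that
   xget selects the unique u with q_z(u) = q_z(v) q_z(w). *)
Definition gutt_star (z : R[i]) (v w : Sym R n) : Sym R n :=
  if z == 0 then v * w
  else xget 0 [set u | env_eq (gutt_quant z u)
                              (gutt_quant z v * gutt_quant z w)].

End Symmetric.

Section Pol.
Context (R : realType) (n : nat) (G : lieGroupType R n) (B : 'M[R]_n).

(* All functions G -> R[i] tensored with Sym: finitely supported families of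
   functions indexed by monomials. *)
Definition FSym := malg (cmonom 'I_n) (G -> R[i]).
Implicit Types (P Q : FSym) (phi psi : G -> R[i]) (v : Sym R n).

Definition tprod phi v : FSym :=
  \sum_(m <- msupp v) mkmalgU m (fun g => phi g * mcoeff m v).

Definition fscale (a : R[i]) P : FSym :=
  \sum_(m <- msupp P) mkmalgU m (fun g => a * mcoeff m P g).

Definition inPol (r : R) : set FSym :=
  [set P | exists (N : nat) (phi : 'I_N -> G -> R[i]) (v : 'I_N -> Sym R n),
     (forall j, ER B r (phi j)) /\ P = \sum_j tprod (phi j) (v j)].

(* The seminorms q_(r,c) (x) p_(r',c'). As both families are nondecreasing in
   c, c', they define the projective tensor product topology. *)
Definition pol_norm (r r' c c' : R) P : \bar R :=
  ereal_inf [set s | exists (N : nat) (phi : 'I_N -> G -> R[i])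
                            (v : 'I_N -> Sym R n),
    [/\ forall j, ER B r (phi j), P = \sum_j tprod (phi j) (v j) &
        s = (\sum_j qnorm B r c (phi j) * (pnorm r' c' (v j))%:E)%E]].

Definition Delta P : FSym :=
  \sum_(m <- msupp P) let w := mword m in
    \sum_(l < size w)
      tprod (lieC (row (tnth (in_tuple w) l) B) (mcoeff m P))
            (sym_word R (take l w ++ drop l.+1 w)).

(* exp(a Delta); Delta lowers the degree, so the series stops. *)
Definition exp_Delta (a : R[i]) P : FSym :=
  \sum_(k < msize P) fscale (a ^+ k / k`!%:R) (iter k Delta P).

Definition Nop (hbar : R[i]) P : FSym :=
  exp_Delta (- ('i%C * hbar / 2%:R)) P.

Definition Nop_inv (hbar : R[i]) P : FSym :=
  exp_Delta ('i%C * hbar / 2%:R) P.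

(* Bilinear extension from tensors of functions with words in the basis. *)
Definition std_star (hbar : R[i]) P Q : FSym :=
  let z := hbar / 'i%C in
  \sum_(m <- msupp P) \sum_(m' <- msupp Q)
    let w := mword m in let k := size w in
    \sum_(p < k.+1) \sum_(s : 'S_k)
      fscale (z ^+ p / (p`!%:R * (k - p)`!%:R))
        (tprod (fun g => mcoeff m P g *
                         lie_word B (take p (permw s)) (mcoeff m' Q) g)
               (gutt_star (struct_const G B) z
                  (sym_word R (drop p (permw s)))
                  (sym_word R (mword m')))).

Definition weyl_star (hbar : R[i]) P Q : FSym :=
  Nop_inv hbar (std_star hbar (Nop hbar P) (Nop hbar Q)).

End Pol.

(* Completeness for the translation-invariant uniformity, which need not be
   the uniformity that comes with a tvsType. *)
Definition tvs_complete (K : numFieldType) (E : tvsType K) : Prop :=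
  forall F : set_system E, ProperFilter F ->
    (fun xy : E * E => xy.1 - xy.2) @ (F, F) --> (0 : E) ->
    exists l : E, F --> l.

(* iota restricted to Pol is a linear topological embedding with dense range
   into the complete Hausdorff locally convex space E; its values outside Pol
   are irrelevant. *)
Record is_completion (R : realType) (n : nat) (G : lieGroupType R n)
    (B : 'M[R]_n) (r r' : R) (E : tvsType R[i]) (iota : FSym G -> E) : Prop :=
  IsCompletion {
  completion_hausdorff : hausdorff_space E;
  completion_complete : tvs_complete E;
  completion_linear : forall (a : R[i]) (P Q : FSym G),
    inPol B r P -> inPol B r Q ->
    iota (fscale a P + Q) = a *: iota P + iota Q;
  completion_dense : closure (iota @` inPol B r) = setT;
  completion_continuous : forall U : set E, nbhs 0 U ->
    exists c c' e : R, [/\ 0 <= c, 0 <= c', 0 < e &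
      forall P, inPol B r P -> (pol_norm B r r' c c' P < e%:E)%E ->
        U (iota P)];
  completion_open : forall c c' e : R, 0 <= c -> 0 <= c' -> 0 < e ->
    exists2 U : set E, nbhs 0 U &
      forall P, inPol B r P -> U (iota P) ->
        (pol_norm B r r' c c' P < e%:E)%E
}.

(* Complex differentiability at every point. *)
Definition entire (R : realType) (E : tvsType R[i]) (f : R[i] -> E) : Prop :=
  forall h0 : R[i], exists l : E,
    (fun h : R[i]^o => h^-1 *: (f (h0 + h) - f h0)) @ (0 : R[i]^o)^' --> l.

(* Main.v *)
(* Everything reduces to explicit weighted l^1-norms. The projective tensor
   product of the seminorm q_(R,c) with the weighted l^1-norm p_(R',c') is the
   l^1-sum over the monomials m of q_(R,c)(P_m) |m|!^R' c'^|m|, so estimates for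
   an operation can be checked on tensors of a function and a monomial.

   Functions: by the Leibniz rule q_c(phi psi) <= q_(2^R c)(phi) q_(2^R c)(psi),
   and q_c(X_w phi) <= |w|! q_(2 max(c,1))(phi) for words w.

   Gutt star product: left multiplication by a basis vector b in the enveloping
   algebra corresponds to v |-> mu (sum_j beta_j z^j D^j (b (x) v)), where D is
   the coadjoint part of the commutator, mu the symmetric product and beta_j
   the Taylor coefficients of t / (exp t - 1), so |beta_j| <= 1. As R' >= 1, D
   is small for a weighted l^1-norm with large c', and the product of monomials
   of degrees k, l is bounded by M^(k+l) k!^R' l!^R' locally uniformly in z.
   That the product is determined by the enveloping algebra (the injectivity in
   the Poincare-Birkhoff-Witt theorem) follows by letting words act as
   left-invariant differential operators on products of coordinates at the unit.

   Hence the Weyl star product is bounded on polynomials locally uniformly in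
   hbar, on which it depends polynomially. Cauchy estimates for polynomials
   bound the differences of its difference quotients, and all of this passes to
   the completion along Cauchy filters. *)

From HB Require Import structures.
Require Import Defs.
From mathcomp Require Import all_boot all_order all_algebra all_fingroup.
From mathcomp Require Import boolp classical_sets functions reals ereal.
From mathcomp Require Import topology normedtype sequences derive exp.
From mathcomp Require Import complex.
From mathcomp Require Import cardinality fsbigop esum.
From mathcomp Require Import zify ring lra.
From mathcomp.finmap Require Import -(notations) finmap.
From mathcomp.multinomials Require Import -(notations) monalg.

Set Implicit Arguments.
Unset Strict Implicit.
Unset Printing Implicit Defensive.

Import Order.TTheory GRing.Theory Num.Theory.
Import numFieldTopology.Exports numFieldNormedType.Exports.

Local Open Scope classical_set_scope.
Local Open Scope ring_scope.

(* [Sym] is shadowed by the symmetric groups of [perm]. *)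
Local Notation Sym R n := (malg (cmonom 'I_n) R[i]).

(** * Unordered sums *)

(** [gutt_star] picks its value with [xget], so both an explicit candidate and uniqueness are
    needed. The candidate averages iterated left multiplications over permutations; uniqueness is
    tested on analytic germs. Since [lieR] is a derivative only where the function is known to be
    analytic, analyticity must first be shown stable under products, composition and these
    derivatives, by rearranging absolutely convergent sums.

    The factorials have to balance. When p vectors out of a factor of degree k are contracted, the p
    derivatives cost p!, which the 1/p! of the exponential and of the standard-ordered product
    cancels; the k!/(k-p)! choices of the contracted vectors are paid by the weights k!^R', as R' >=
    1. The remaining geometric factors only enlarge c and c'.

    On the completion degrees are unbounded and hbar no longer enters polynomially. Hence no bound
    may depend on the degrees of P and Q: a uniform bound on a disc becomes a Lipschitz bound for
    the difference quotients, and this survives the limit. *)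

Section UnorderedSums.
Context {R : realType}.

Definition nnsum (T : choiceType) (D : set T) (a : T -> R) (s : R) : Prop :=
  (forall i, D i -> 0 <= a i) /\ (\esum_(i in D) (a i)%:E)%E = s%:E.

(* Absolute summability is built in: f is a difference of summable
   nonnegative families. *)
Definition hassum (T : choiceType) (D : set T) (f : T -> R) (s : R) : Prop :=
  exists a b sa sb, [/\ nnsum D a sa, nnsum D b sb,
    forall i, D i -> f i = a i - b i & s = sa - sb].

Lemma nnsum_ge0 (T : choiceType) (D : set T) a s : @nnsum T D a s -> 0 <= s.
Proof.
move=> [a0 e]; rewrite -lee_fin -e; apply: esum_ge0 => i Di.
by rewrite lee_fin a0.
Qed.

Lemma nnsum_inj (T : choiceType) (D : set T) a s t :
  @nnsum T D a s -> @nnsum T D a t -> s = t.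
Proof. by move=> [_ e] [_]; rewrite e => -[]. Qed.

Lemma nnsumD (T : choiceType) (D : set T) a b s t :
  @nnsum T D a s -> nnsum D b t -> nnsum D (fun i => a i + b i) (s + t).
Proof.
move=> [a0 ea] [b0 eb]; split=> [i Di|]; first by rewrite addr_ge0 ?a0 ?b0.
by rewrite EFinD -ea -eb -esumD.
Qed.

Lemma nnsum_le (T : choiceType) (D : set T) a b t : @nnsum T D b t ->
  (forall i, D i -> 0 <= a i) -> (forall i, D i -> a i <= b i) ->
  exists2 s, nnsum D a s & s <= t.
Proof.
move=> [b0 eb] a0 ab.
have le : (\esum_(i in D) (a i)%:E <= t%:E)%E.
  by rewrite -eb; apply: le_esum => i /ab; rewrite lee_fin.
have ge : (0 <= \esum_(i in D) (a i)%:E)%E.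
  by apply: esum_ge0 => i /a0; rewrite lee_fin.
have fin : (\esum_(i in D) (a i)%:E)%E \is a fin_num.
  by rewrite ge0_fin_numE// (le_lt_trans le)// ltry.
exists (fine (\esum_(i in D) (a i)%:E)%E); first by split; rewrite ?fineK.
by rewrite -lee_fin fineK.
Qed.

Lemma nnsum_bounded (T : choiceType) (D : set T) a M :
  (forall i, D i -> 0 <= a i) -> (\esum_(i in D) (a i)%:E <= M%:E)%E ->
  exists2 s, @nnsum T D a s & s <= M.
Proof.
move=> a0 le.
have ge : (0 <= \esum_(i in D) (a i)%:E)%E.
  by apply: esum_ge0 => i /a0; rewrite lee_fin.
have fin : (\esum_(i in D) (a i)%:E)%E \is a fin_num.
  by rewrite ge0_fin_numE// (le_lt_trans le)// ltry.
exists (fine (\esum_(i in D) (a i)%:E)%E); first by split; rewrite ?fineK.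
by rewrite -lee_fin fineK.
Qed.

Lemma eq_nnsum (T : choiceType) (D : set T) a b s :
  (forall i, D i -> a i = b i) -> @nnsum T D a s -> nnsum D b s.
Proof.
move=> ab [a0 ea]; split=> [i Di|]; first by rewrite -ab ?a0.
by rewrite -ea; apply: eq_esum => i Di; rewrite ab.
Qed.

Lemma nnsum_sub (T : choiceType) (D D' : set T) a s : D' `<=` D ->
  @nnsum T D a s -> exists2 t, nnsum D' a t & t <= s.
Proof.
move=> sub [a0 ea].
apply: nnsum_bounded => [i /sub/a0//|]; rewrite -ea.
rewrite esum_mkcond [leRHS]esum_mkcond; apply: le_esum => i _.
case: ifPn => [/set_mem/sub/mem_set ->//|_].
by case: ifPn => // /set_mem/a0; rewrite lee_fin.
Qed.

Lemma nnsumZ (T : choiceType) (D : set T) a k s : 0 <= k ->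
  @nnsum T D a s -> nnsum D (fun i => k * a i) (k * s).
Proof.
move=> k0 [a0 ea]; split=> [i Di|]; first by rewrite mulr_ge0 ?a0.
(* Only this inequality needs the supremum; applied to [k^-1] and the scaled family it gives the
   converse. *)
have le (l : R) (b : T -> R) t : 0 <= l -> (\esum_(i in D) (b i)%:E)%E = t%:E ->
    ((\esum_(i in D) (l * b i)%:E) <= (l * t)%:E)%E.
  move=> l0 eb; apply: ge_ereal_sup => _ [X [finX XD] <-] /=.
  rewrite fsbig_finite//= sumEFin lee_fin -mulr_sumr ler_wpM2l//.
  rewrite -lee_fin -eb -sumEFin -fsbig_finite//.
  by apply: ereal_sup_ubound; exists X.
move: k0; rewrite le_eqVlt => /predU1P[<-|k0].
  by rewrite mul0r; apply: esum1 => i _; rewrite mul0r.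
apply/eqP; rewrite eq_le le ?(ltW k0)//=.
have [t [_ et] lt] : exists2 t, nnsum D (fun i => k * a i) t & t <= k * s.
  apply: nnsum_bounded => [i Di|]; first by rewrite mulr_ge0 ?a0 ?ltW.
  by rewrite le// ltW.
rewrite et lee_fin -ler_pdivlMl// -lee_fin -ea.
rewrite (eq_esum (b := fun i => (k^-1 * (k * a i))%:E)); last first.
  by move=> i _; rewrite mulKf ?gt_eqF.
by rewrite le ?invr_ge0 ?ltW.
Qed.

(** Tonelli: once the inner sums are finite, joint and iterated summability are equivalent. Both
    directions are used later. *)
Lemma nnsum_sigma (T U : choiceType) (D : set T) (J : T -> set U)
    (a : T -> U -> R) (g : T -> R) (s : R) :
  (forall i, D i -> nnsum (J i) (a i) (g i)) ->
  nnsum D g s <-> nnsum (D `*`` J) (fun k => a k.1 k.2) s.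
Proof.
move=> ag.
have e : (\esum_(i in D) (g i)%:E =
          \esum_(k in D `*`` J) (a k.1 k.2)%:E)%E.
  rewrite -(@esum_esum _ _ _ D J (fun i j => (a i j)%:E)).
    by apply: eq_esum => i /ag[_ ->].
  by move=> i j Di Jj; rewrite lee_fin; apply: (ag i Di).1.
split=> -[g0 eg]; split=> /=.
- by move=> [i j] [/= Di Jj]; apply: (ag i Di).1.
- by rewrite -e.
- by move=> i Di; apply: nnsum_ge0 (ag i Di).
- by rewrite e.
Qed.

Lemma nnsum_reindex (T U : choiceType) (P : set T) (Q : set U) (e : T -> U)
    (a : U -> R) (s : R) : set_bij P Q e ->
  nnsum Q a s <-> nnsum P (fun i => a (e i)) s.
Proof.
move=> eb; rewrite /nnsum (reindex_esum P Q e)//.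
have [fe _ se] := eb; split=> -[a0 ea]; split=> //.
  by move=> i Pi; apply/a0/fe.
by move=> j /se[i Pi <-]; apply: a0.
Qed.

Lemma nnsum_fibers (T U : choiceType) (p : T -> U) (a : T -> R) (g : U -> R)
    (s : R) :
  (forall u, nnsum (p @^-1` [set u]) a (g u)) ->
  nnsum setT g s <-> nnsum setT a s.
Proof.
move=> ag; rewrite (nnsum_sigma (J := fun u => p @^-1` [set u])
  (a := fun _ => a)); last by move=> u _; apply: ag.
rewrite (nnsum_reindex (P := setT) (e := fun t => (p t, t)))//; split => //=.
- by move=> t t' _ _ [].
- by move=> [u t] [/= _ <-]; exists t.
Qed.

Lemma hassum_inj (T : choiceType) (D : set T) f s t :
  @hassum T D f s -> hassum D f t -> s = t.
Proof.
move=> [a [b [sa [sb [A B f1 ->]]]]] [c [d [sc [sd [C E f2 ->]]]]].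
suff : sa + sd = sc + sb by lra.
apply: nnsum_inj (nnsumD A E) _.
apply: eq_nnsum (nnsumD C B) => i Di.
by have := f1 i Di; rewrite f2// => h; lra.
Qed.

Lemma eq_hassum (T : choiceType) (D : set T) f g s :
  (forall i, D i -> f i = g i) -> @hassum T D f s -> hassum D g s.
Proof.
move=> fg [a [b [sa [sb [A B f1 ->]]]]]; exists a, b, sa, sb; split=> // i Di.
by rewrite -fg ?f1.
Qed.

Lemma nnsum_hassum (T : choiceType) (D : set T) a s :
  @nnsum T D a s -> hassum D a s.
Proof.
move=> A; exists a, (fun=> 0), s, 0; split=> //; last by rewrite subr0.
- by split => //; rewrite esum1.
- by move=> i _; rewrite subr0.
Qed.

Lemma hassumD (T : choiceType) (D : set T) f g s t :
  @hassum T D f s -> hassum D g t -> hassum D (fun i => f i + g i) (s + t).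
Proof.
move=> [a [b [sa [sb [A B f1 ->]]]]] [c [d [sc [sd [C E f2 ->]]]]].
exists (fun i => a i + c i), (fun i => b i + d i), (sa + sc), (sb + sd).
split; [exact: nnsumD|exact: nnsumD| |lra].
by move=> i Di; rewrite f1// f2//; lra.
Qed.

Lemma hassumN (T : choiceType) (D : set T) f s :
  @hassum T D f s -> hassum D (fun i => - f i) (- s).
Proof.
move=> [a [b [sa [sb [A B f1 ->]]]]]; exists b, a, sb, sa; split=> //; last lra.
by move=> i Di; rewrite f1//; lra.
Qed.

Lemma hassumZ (T : choiceType) (D : set T) f s k :
  @hassum T D f s -> hassum D (fun i => k * f i) (k * s).
Proof.
wlog k0 : k / 0 <= k => [H F|[a [b [sa [sb [A B f1 ->]]]]]].
  have [/H/(_ F)//|/ltW k0] := lerP 0 k.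
  have := hassumN (H (- k) _ F); rewrite oppr_ge0 => /(_ k0).
  by rewrite mulNr opprK; apply: eq_hassum => i _; rewrite mulNr opprK.
exists (fun i => k * a i), (fun i => k * b i), (k * sa), (k * sb).
split; [exact: nnsumZ|exact: nnsumZ| |by rewrite mulrBr].
by move=> i Di; rewrite f1// mulrBr.
Qed.

Lemma hassum_dominated (T : choiceType) (D : set T) f b M : @nnsum T D b M ->
  (forall i, D i -> `|f i| <= b i) -> exists2 s, hassum D f s & `|s| <= M.
Proof.
move=> bM fb.
have [M' fM' MM] := nnsum_le bM (fun i _ => normr_ge0 (f i)) fb.
have [i _||sa A la] := @nnsum_le T D (fun i => Num.max (f i) 0) _ _ fM'.
- by rewrite le_max lexx orbT.
- by move=> i _; rewrite ge_max normr_ge0 ler_norm.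
have [i _||sb B lb] := @nnsum_le T D (fun i => Num.max (- f i) 0) _ _ fM'.
- by rewrite le_max lexx orbT.
- by move=> i _; rewrite ge_max normr_ge0 -normrN ler_norm.
exists (sa - sb).
  exists (fun i => Num.max (f i) 0), (fun i => Num.max (- f i) 0), sa, sb.
  split=> // i _; rewrite !maxEle; case: ifP; case: ifP; lra.
have sab : sa + sb = M'.
  apply: nnsum_inj (nnsumD A B) _; apply: eq_nnsum fM' => i _.
  case: (lerP 0 (f i)) => h.
    by rewrite ger0_norm// max_r ?oppr_le0// addr0.
  by rewrite ltr0_norm// max_l ?oppr_ge0 1?ltW// add0r.
have := nnsum_ge0 A; have := nnsum_ge0 B => b0 a0.
by rewrite ler_norml; apply/andP; split; lra.
Qed.

Lemma hassum_abs (T : choiceType) (D : set T) f s : @hassum T D f s ->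
  exists M, nnsum D (fun i => `|f i|) M.
Proof.
move=> [a [b [sa [sb [A B f1 _]]]]].
have [||M H _] := nnsum_le (a := fun i => `|f i|) (nnsumD A B).
- by move=> i _; rewrite normr_ge0.
- move=> i Di; rewrite f1//; apply: le_trans (ler_normB _ _) _.
  by rewrite !ger0_norm ?(A.1 _ Di) ?(B.1 _ Di).
by exists M.
Qed.

Lemma hassum_le (T : choiceType) (D : set T) f s b M : @hassum T D f s ->
  nnsum D b M -> (forall i, D i -> `|f i| <= b i) -> `|s| <= M.
Proof.
move=> fs bM fb; have [t ft tM] := hassum_dominated bM fb.
by rewrite (hassum_inj fs ft).
Qed.

Lemma hassum_reindex (T U : choiceType) (P : set T) (Q : set U) (e : T -> U)
    (f : U -> R) (s : R) : set_bij P Q e ->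
  hassum Q f s -> hassum P (fun i => f (e i)) s.
Proof.
move=> eb [a [b [sa [sb [A B f1 ->]]]]].
exists (a \o e), (b \o e), sa, sb; split=> //; try exact/(nnsum_reindex _ _ eb).
by move=> i Pi; apply/f1; case: eb => fe _ _; apply: fe.
Qed.

(** Fubini goes only from the joint sum to the iterated one: in the other direction, cancellation
    inside the fibres could hide divergence. *)
Lemma hassum_sigma (T U : choiceType) (D : set T) (J : T -> set U)
    (f : T -> U -> R) (g : T -> R) (s : R) :
  (forall i, D i -> hassum (J i) (f i) (g i)) ->
  hassum (D `*`` J) (fun k => f k.1 k.2) s -> hassum D g s.
Proof.
move=> fg [a [b [sa [sb [A B f1 ->]]]]].
(* Each fibre sits inside the joint index set, so the positive and the negative part are summable on
   it separately. *)
have sub c sc i : D i -> nnsum (D `*`` J) c sc ->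
    exists2 t, nnsum (J i) (fun j => c (i, j)) t & t <= sc.
  move=> Di C; have [|t H lt] := @nnsum_sub _ _ [set k | k.1 = i /\ J i k.2] _ _ _ C.
    by move=> [i' j] [/= -> Jj].
  exists t => //; apply: (iffLR (nnsum_reindex (P := J i) (e := pair i) c t _) H).
  by split=> /= [j Jj//|j j' _ _ []//|[i' j] [/= -> Jj]]; exists j.
have [ga Ha] : exists ga, forall i, D i -> nnsum (J i) (fun j => a (i, j)) (ga i).
  have /choice[ga Ha] : forall i, exists t, D i -> nnsum (J i) (fun j => a (i, j)) t.
    move=> i; have [Di|nDi] := pselect (D i); last by exists 0.
    by have [t H _] := sub _ _ _ Di A; exists t.
  by exists ga.
have [gb Hb] : exists ga, forall i, D i -> nnsum (J i) (fun j => b (i, j)) (ga i).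
  have /choice[gb Hb] : forall i, exists t, D i -> nnsum (J i) (fun j => b (i, j)) t.
    move=> i; have [Di|nDi] := pselect (D i); last by exists 0.
    by have [t H _] := sub _ _ _ Di B; exists t.
  by exists gb.
exists ga, gb, sa, sb; split=> //.
- apply/(nnsum_sigma (a := fun i j => a (i, j)) sa Ha).
  by apply: eq_nnsum A => -[].
- apply/(nnsum_sigma (a := fun i j => b (i, j)) sb Hb).
  by apply: eq_nnsum B => -[].
move=> i Di; apply: hassum_inj (fg i Di) _.
exists (fun j => a (i, j)), (fun j => b (i, j)), (ga i), (gb i).
by split; [exact: Ha|exact: Hb|move=> j Jj; apply: (f1 (i, j))|].
Qed.

Lemma hassum_fibers (T U : choiceType) (p : T -> U) (f : T -> R) (g : U -> R)
    (s : R) :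
  (forall u, hassum (p @^-1` [set u]) f (g u)) ->
  hassum setT f s -> hassum setT g s.
Proof.
move=> fg F; apply: (hassum_sigma (f := fun _ => f) (fun u _ => fg u)).
apply: (hassum_reindex (e := snd) _ F); split=> //=.
- by move=> [u t] [u' t'] /= /set_mem[_ /= <-] /set_mem[_ /= <-] /= ->.
- by move=> t _; exists (p t, t).
Qed.

Lemma nnsum_prod (T U : choiceType) (D : set T) (D' : set U) a b s t :
  @nnsum T D a s -> @nnsum U D' b t ->
  nnsum (D `*` D') (fun k => a k.1 * b k.2) (s * t).
Proof.
move=> A B; apply/(nnsum_sigma (J := fun=> D') (g := fun i => a i * t)
  (a := fun i j => a i * b j)); last first.
  by rewrite mulrC; apply: eq_nnsum (nnsumZ (nnsum_ge0 B) A) => i _; rewrite mulrC.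
by move=> i Di; apply: nnsumZ => //; apply: A.1.
Qed.

Lemma hassum_prod (T U : choiceType) (D : set T) (D' : set U) f g s t :
  @hassum T D f s -> @hassum U D' g t ->
  hassum (D `*` D') (fun k => f k.1 * g k.2) (s * t).
Proof.
move=> [a [b [sa [sb [A B f1 ->]]]]] [c [d [sc [sd [C E f2 ->]]]]].
exists (fun k => a k.1 * c k.2 + b k.1 * d k.2),
  (fun k => a k.1 * d k.2 + b k.1 * c k.2), (sa * sc + sb * sd), (sa * sd + sb * sc).
split; [by apply: nnsumD; apply: nnsum_prod|
  by apply: nnsumD; apply: nnsum_prod| |by ring].
by move=> [i j] [/= Di Dj]; rewrite f1// f2//; ring.
Qed.

Lemma hassum1 (T : choiceType) (t : T) f : hassum [set t] f (f t).
Proof.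
wlog f0 : f / 0 <= f t => [H|].
  have [/H//|/ltW h] := lerP 0 (f t).
  have := hassumN (H (fun i => - f i) _); rewrite oppr_ge0 opprK => /(_ h).
  by apply: eq_hassum => i _; rewrite opprK.
apply/nnsum_hassum; split=> [i -> //|]; by rewrite esum_set1.
Qed.

Lemma hassum_seq (T : choiceType) (r : seq T) f : uniq r ->
  hassum [set` r] f (\sum_(i <- r) f i).
Proof.
move=> ur; pose h g := (\sum_(i <- r) g i : R).
have nn g : (forall i, 0 <= g i) -> nnsum [set` r] g (h g).
  move=> g0; split=> [i _//|]; have fr : finite_set [set` r] by exact: finite_seq.
  rewrite esum_fset//; last by move=> *; rewrite lee_fin.
  by rewrite -fsbig_seq// sumEFin.
exists (fun i => Num.max (f i) 0), (fun i => Num.max (- f i) 0),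
  (h (fun i => Num.max (f i) 0)), (h (fun i => Num.max (- f i) 0)).
split; try by apply: nn => i; rewrite le_max lexx orbT.
  by move=> i _; rewrite !maxEle; case: ifP; case: ifP; lra.
rewrite /h -sumrB; apply: eq_bigr => i _.
by rewrite !maxEle; case: ifP; case: ifP; lra.
Qed.

Lemma nnsum_nat (a : nat -> R) s : nnsum setT a s ->
  series a @ \oo --> s.
Proof.
move=> [a0 ea]; have e : (\sum_(0 <= k <oo) (a k)%:E = s%:E)%E.
  by rewrite nneseries_esumT// => k; rewrite lee_fin a0.
have : (fun k => (series a k)%:E) @ \oo --> s%:E.
  rewrite -e; rewrite (_ : (fun k => _) = eseries (fun k => (a k)%:E)).
    by apply: is_cvg_nneseries => k _ _; rewrite lee_fin a0.
  by apply/funext => k; rewrite /series /eseries/= sumEFin.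
by move/fine_cvgP => -[].
Qed.

Lemma nat_nnsum (a : nat -> R) : (forall k, 0 <= a k) ->
  (\sum_(0 <= k <oo) (a k)%:E < +oo)%E -> exists s, nnsum setT a s.
Proof.
move=> a0; rewrite nneseries_esumT; last by move=> k; rewrite lee_fin.
move=> h.
have ge : (0 <= \esum_(i in setT) (a i)%:E)%E.
  by apply: esum_ge0 => i _; rewrite lee_fin.
exists (fine (\esum_(i in setT) (a i)%:E)%E); split=> //.
by rewrite fineK// ge0_fin_numE.
Qed.

Lemma hassum_nat (f : nat -> R) s : hassum setT f s ->
  series f @ \oo --> s.
Proof.
move=> [a [b [sa [sb [/nnsum_nat A /nnsum_nat B f1 ->]]]]].
have : (fun k => series a k - series b k) @ \oo --> sa - sb by exact: cvgB.
rewrite (_ : (fun k => _) = series f)//; apply/funext => k.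
by rewrite /series/= -sumrB; apply: eq_bigr => i _; rewrite f1.
Qed.

Lemma hassum_nnsum (T : choiceType) (D : set T) f s :
  (forall i, D i -> 0 <= f i) -> @hassum T D f s -> nnsum D f s.
Proof.
move=> f0 H; have [M N] := hassum_abs H.
have {}N : nnsum D f M by apply: eq_nnsum N => i Di; rewrite ger0_norm ?f0.
by rewrite (hassum_inj H (nnsum_hassum N)).
Qed.

Lemma hassum_summable (T : choiceType) (D : set T) f M :
  @nnsum T D (fun i => `|f i|) M -> exists s, hassum D f s.
Proof. by move=> /hassum_dominated-/(_ f (fun i _ => lexx _))[s H _]; exists s. Qed.

Lemma hassum_image (T U : choiceType) (P : set T) (Q : set U) (e : T -> U)
    (f : U -> R) (s : R) : set_bij P Q e ->
  hassum P (fun i => f (e i)) s -> hassum Q f s.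
Proof.
move=> eb H; have [M N] := hassum_abs H.
have [s' H'] := hassum_summable (iffRL (nnsum_reindex (fun j => `|f j|) M eb) N).
by rewrite (hassum_inj H (hassum_reindex eb H')).
Qed.

Lemma hassum_ext0 (T : choiceType) (D D' : set T) f s : D' `<=` D ->
  (forall i, D i -> ~ D' i -> f i = 0) -> @hassum T D' f s -> hassum D f s.
Proof.
move=> sub f0 [a [b [sa [sb [A B f1 ->]]]]].
have ext c sc : nnsum D' c sc ->
    nnsum D (fun i => if i \in D' then c i else 0) sc.
  move=> [c0 ec]; split=> [i _|]; first by case: ifPn => // /set_mem/c0.
  rewrite -ec [LHS]esum_mkcond [RHS]esum_mkcond; apply: eq_esum => i _.
  case: ifPn => [_|nD]; first by case: ifP.
  by case: ifPn => // /set_mem/sub/mem_set; rewrite (negPf nD).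
exists (fun i => if i \in D' then a i else 0),
  (fun i => if i \in D' then b i else 0), sa, sb; split=> //; try exact: ext.
move=> i Di; case: ifPn => [/set_mem/f1//|nD]; rewrite subr0.
by apply: f0 => // /mem_set; rewrite (negPf nD).
Qed.

Lemma hassum_single (T : choiceType) (t : T) f : (forall i, i != t -> f i = 0) ->
  hassum setT f (f t).
Proof.
move=> f0; apply: hassum_ext0 (hassum1 t f) => // i _ it.
by apply: f0; apply/eqP.
Qed.
End UnorderedSums.

(** * Analytic functions as absolutely convergent series over words *)

Section Analytic.
Context {R : realType}.

Definition pw (n : nat) (h : 'rV[R]_n) (w : seq 'I_n) : R :=
  \prod_(i <- w) h ord0 i.

Lemma pw_nil (n : nat) (h : 'rV[R]_n) : pw h [::] = 1.
Proof. by rewrite /pw big_nil. Qed.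

Lemma pw_cons (n : nat) (h : 'rV[R]_n) i w : pw h (i :: w) = h ord0 i * pw h w.
Proof. by rewrite /pw big_cons. Qed.

Lemma pw_cat (n : nat) (h : 'rV[R]_n) v w : pw h (v ++ w) = pw h v * pw h w.
Proof. by rewrite /pw big_cat. Qed.

Lemma pw0 (n : nat) (w : seq 'I_n) : w != [::] -> pw (0 : 'rV[R]_n) w = 0.
Proof. by case: w => // i w _; rewrite pw_cons mxE mul0r. Qed.

Lemma pw_le (n : nat) (h : 'rV[R]_n) r w : (forall i, `|h ord0 i| < r) ->
  `|pw h w| <= r ^+ size w.
Proof.
move=> hr; elim: w => [|i w IH]; first by rewrite pw_nil normr1.
by rewrite pw_cons normrM exprS ler_pM// ltW.
Qed.

(* f is the sum of the c t * (y - x)^(w t); the words w t may repeat. *)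
Definition power_family (n : nat) (f : 'rV[R]_n -> R) (x : 'rV[R]_n) (r : R)
    (T : choiceType) (c : T -> R) (w : T -> seq 'I_n) : Prop :=
  [/\ 0 < r, exists M, nnsum setT (fun t => `|c t| * r ^+ size (w t)) M &
  forall y : 'rV[R]_n, (forall i, `|y ord0 i - x ord0 i| < r) ->
    hassum setT (fun t => c t * pw (y - x) (w t)) (f y)].

Lemma box_sub (n : nat) (x y : 'rV[R]_n) r :
  (forall i, `|y ord0 i - x ord0 i| < r) -> forall i, `|(y - x) ord0 i| < r.
Proof. by move=> h i; rewrite !mxE. Qed.

Lemma hassum_size (n k : nat) (F : seq 'I_n -> R) :
  hassum (size @^-1` [set k]) F (\sum_(w : k.-tuple 'I_n) F w).
Proof.
pose r := [seq val w | w : k.-tuple 'I_n].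
have -> : \sum_(w : k.-tuple 'I_n) F w = \sum_(w <- r) F w.
  by rewrite /r big_map big_enum.
rewrite (_ : _ @^-1` _ = [set` r]); last first.
  apply/seteqP; split=> w /=.
    move=> /eqP sw; apply/mapP; exists (Tuple sw) => //.
    by rewrite mem_enum.
  by move=> /mapP[t _ ->]; rewrite size_tuple.
apply: hassum_seq; rewrite map_inj_uniq ?enum_uniq//; exact: val_inj.
Qed.

Lemma power_termsE (n : nat) (a : seq 'I_n -> R) (x y : 'rV[R]_n) :
  (fun k => \sum_(w : k.-tuple 'I_n) a w * pw (y - x) w) =
  (fun k => \sum_(w : k.-tuple 'I_n)
     a w * \prod_(i <- w) (y ord0 i - x ord0 i)).
Proof.
apply/funext => k; apply: eq_bigr => w _; congr (_ * _).
by apply: eq_bigr => i _; rewrite !mxE.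
Qed.

(** The definition gives a series of homogeneous terms. Absolute convergence at radius [r] makes the
    family of all words summable, and uniqueness of limits identifies its sum. *)
Lemma analytic_words (n : nat) (f : 'rV[R]_n -> R) x : analytic_at f x ->
  exists a r, power_family f x r a id.
Proof.
move=> [a [r [r0 fin cv]]]; exists a, r.
have [||M HM] := @nat_nnsum R (fun k => r ^+ k * \sum_(w : k.-tuple 'I_n) `|a w|).
- by move=> k; rewrite mulr_ge0 ?exprn_ge0 ?(ltW r0) ?sumr_ge0.
- exact: fin.
have HS : nnsum setT (fun w => `|a w| * r ^+ size w) M.
  apply: (iffLR (nnsum_fibers (p := size) _ _) HM) => k.
  rewrite mulr_sumr.
  under eq_bigr => w _ do rewrite mulrC -{2}(size_tuple w).
  apply: hassum_nnsum.
    by move=> w _; rewrite mulr_ge0// exprn_ge0// ltW.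
  exact: (hassum_size k (fun w => `|a w| * r ^+ size w)).
split=> //; first by exists M.
move=> y yr; have yr' := box_sub yr.
have [s Hs _] : exists2 s, hassum setT (fun w => a w * pw (y - x) w) s & `|s| <= M.
  apply: (hassum_dominated HS) => w _.
  by rewrite normrM ler_wpM2l// pw_le.
rewrite (_ : f y = s)//.
have /hassum_nat H := hassum_fibers (fun k => hassum_size k _) Hs.
have H' := cv y yr; rewrite -power_termsE in H'.
exact: (cvg_unique (@Rhausdorff R) H' H).
Qed.

(** Coefficients of equal words are added up over the fibres of [w]. Thanks to this, products and
    compositions may be indexed by pairs or lists of words. *)
Lemma analytic_family (n : nat) (f : 'rV[R]_n -> R) x r (T : choiceType) c w :
  @power_family n f x r T c w -> analytic_at f x.
Proof.
move=> [r0 [M HM] cv].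
have fib u : exists A, nnsum (w @^-1` [set u]) (fun t => `|c t|) A.
  have [|A HA _] := @nnsum_sub _ _ _ (w @^-1` [set u]) _ _ _ HM; first by [].
  exists ((r ^- size u) * A).
  have /nnsumZ : 0 <= r ^- size u by rewrite invr_ge0 exprn_ge0// ltW.
  move=> /(_ _ _ _ _ HA); apply: eq_nnsum => t /= ->.
  by rewrite mulrCA mulVf ?mulr1// expf_neq0// gt_eqF.
have [A HA] := choice fib.
have /choice[a Ha] u : exists s, hassum (w @^-1` [set u]) c s.
  exact: hassum_summable (HA u).
have aA u : `|a u| <= A u.
  by apply: hassum_le (Ha u) (HA u) _.
have HAM : nnsum setT (fun u => A u * r ^+ size u) M.
  apply: (iffRL (nnsum_fibers (p := w) _ _) HM) => u.
  have /nnsumZ : 0 <= r ^+ size u by rewrite exprn_ge0// ltW.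
  by move=> /(_ _ _ _ _ (HA u)); rewrite mulrC; apply: eq_nnsum => t /= ->; rewrite mulrC.
have [||M' HM' _] := nnsum_le (a := fun u => `|a u| * r ^+ size u) HAM.
- by move=> u _; rewrite mulr_ge0// exprn_ge0// ltW.
- by move=> u _; rewrite ler_wpM2r// exprn_ge0// ltW.
exists a, r; split=> //.
  have : nnsum setT (fun k => \sum_(w : k.-tuple 'I_n) (`|a w| * r ^+ size w)) M'.
    apply: (iffRL (nnsum_fibers (p := size) _ _) HM') => k.
    apply: hassum_nnsum; last exact: (hassum_size k (fun w => `|a w| * r ^+ size w)).
    by move=> u _; rewrite mulr_ge0// exprn_ge0// ltW.
  move=> [k0 ek]; rewrite nneseries_esumT; last first.
    by move=> k; rewrite lee_fin mulr_ge0 ?exprn_ge0 ?(ltW r0) ?sumr_ge0.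
  apply: le_lt_trans (ltry M'); rewrite -ek; apply: le_esum => k _.
  rewrite lee_fin mulr_sumr; apply: ler_sum => v _.
  by rewrite size_tuple mulrC.
move=> y yr.
have H : hassum setT (fun u => a u * pw (y - x) u) (f y).
  apply: (hassum_fibers (p := w) _ (cv y yr)) => u.
  rewrite mulrC; apply: eq_hassum (hassumZ (pw (y - x) u) (Ha u)) => t /= ->.
  by rewrite mulrC.
have /hassum_nat := hassum_fibers (fun k => hassum_size k _) H.
by rewrite power_termsE.
Qed.

Lemma ge_minL (x y : R) : Num.min x y <= x.
Proof. by rewrite ge_min lexx. Qed.

Lemma ge_minR (x y : R) : Num.min x y <= y.
Proof. by rewrite ge_min lexx orbT. Qed.

Lemma power_family_shrink (n : nat) (f : 'rV[R]_n -> R) x r r'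
    (T : choiceType) c w :
  0 < r' -> r' <= r -> @power_family n f x r T c w -> power_family f x r' c w.
Proof.
move=> r'0 rr [r0 [M HM] cv]; split=> //; last first.
  by move=> y yr; apply: cv => i; apply: lt_le_trans rr.
have [||M' HM' _] := nnsum_le (a := fun u => `|c u| * r' ^+ size (w u)) HM.
- by move=> u _; rewrite mulr_ge0// exprn_ge0// ltW.
- by move=> u _; rewrite ler_wpM2l// lerXn2r// nnegrE ltW.
by exists M'.
Qed.

Lemma analytic_ext (n : nat) (f g : 'rV[R]_n -> R) (x : 'rV[R]_n) (r : R) :
  0 < r -> (forall y : 'rV[R]_n, (forall i, `|y ord0 i - x ord0 i| < r) -> f y = g y) ->
  analytic_at f x -> analytic_at g x.
Proof.
move=> r0 fg /analytic_words[a [r1 H]].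
have m0 : 0 < Num.min r r1 by case: H => r10 _ _; rewrite lt_min r0.
have [_ HM cv] := power_family_shrink m0 (ge_minR _ _) H.
apply: (@analytic_family _ _ _ (Num.min r r1) _ a id); split=> // y yr.
rewrite -fg; first exact: cv.
by move=> i; apply: lt_le_trans (yr i) _; rewrite ge_min lexx.
Qed.

Lemma analytic_near (n : nat) (f g : 'rV[R]_n -> R) (x : 'rV[R]_n) :
  (\forall y \near x, f y = g y) -> analytic_at f x -> analytic_at g x.
Proof.
move=> /nbhs_ballP[e /= e0 fg]; apply: (analytic_ext e0) => y ye.
apply: fg; split=> // i j; rewrite (ord1 i) /ball/= distrC; exact: ye.
Qed.

Lemma analytic_cst (n : nat) (k : R) (x : 'rV[R]_n) : analytic_at (fun=> k) x.
Proof.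
apply: (@analytic_family _ _ _ 1 unit (fun=> k) (fun=> [::])); split=> //.
  exists (`|k| * 1); apply: nnsumZ => //.
  apply: hassum_nnsum => //; rewrite (_ : setT = [set tt]).
    exact: (hassum1 tt (fun=> 1)).
  by apply/seteqP; split=> -[].
move=> y _; rewrite -[X in hassum _ _ X]mulr1; apply: hassumZ.
rewrite (_ : setT = [set tt]); last by apply/seteqP; split=> -[].
by have := hassum1 tt (fun=> pw (y - x) [::]); rewrite pw_nil.
Qed.

Lemma analyticM (n : nat) (f g : 'rV[R]_n -> R) (x : 'rV[R]_n) :
  analytic_at f x -> analytic_at g x -> analytic_at (fun y => f y * g y) x.
Proof.
move=> /analytic_words[a [ra A]] /analytic_words[b [rb B]].
have m0 : 0 < Num.min ra rb by case: A B => r0 _ _ [r0' _ _]; rewrite lt_min r0.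
have [_ [Ma HA] cA] := power_family_shrink m0 (ge_minL _ _) A.
have [_ [Mb HB] cB] := power_family_shrink m0 (ge_minR _ _) B.
apply: (@analytic_family _ _ _ _ (seq 'I_n * seq 'I_n)%type
  (fun t => a t.1 * b t.2) (fun t => t.1 ++ t.2)); split; first exact: m0.
  exists (Ma * Mb); have := nnsum_prod HA HB; rewrite setXTT.
  apply: eq_nnsum => -[u v] _ /=; rewrite size_cat exprD normrM; ring.
move=> y yr; have := hassum_prod (cA y yr) (cB y yr); rewrite setXTT.
by apply: eq_hassum => -[u v] _ /=; rewrite pw_cat; ring.
Qed.

Lemma analyticD (n : nat) (f g : 'rV[R]_n -> R) (x : 'rV[R]_n) :
  analytic_at f x -> analytic_at g x -> analytic_at (fun y => f y + g y) x.
Proof.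
move=> /analytic_words[a [ra A]] /analytic_words[b [rb B]].
have m0 : 0 < Num.min ra rb by case: A B => r0 _ _ [r0' _ _]; rewrite lt_min r0.
have [_ [Ma HA] cA] := power_family_shrink m0 (ge_minL _ _) A.
have [_ [Mb HB] cB] := power_family_shrink m0 (ge_minR _ _) B.
apply: (@analytic_family _ _ _ _ (seq 'I_n) (fun t => a t + b t) id).
split; first exact: m0.
  have [||M HM _] := nnsum_le (a := fun t => `|a t + b t| * Num.min ra rb ^+ size t)
    (nnsumD HA HB).
  - by move=> t _; rewrite mulr_ge0// exprn_ge0// ltW.
  - by move=> t _; rewrite -mulrDl ler_wpM2r ?ler_normD// exprn_ge0// ltW.
  by exists M.
move=> y yr; have := hassumD (cA y yr) (cB y yr).
by apply: eq_hassum => t _; rewrite mulrDl.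
Qed.

Lemma analytic_coord (n : nat) (x : 'rV[R]_n) i :
  analytic_at (fun y => y ord0 i) x.
Proof.
suff : analytic_at (fun y => x ord0 i + (y ord0 i - x ord0 i)) x.
  by apply: (@analytic_ext _ _ _ _ 1) => // y _; rewrite addrC subrK.
apply: analyticD; first exact: analytic_cst.
apply: (@analytic_family _ _ _ 1 unit (fun=> 1) (fun=> [:: i])); split=> //.
  exists 1; apply: hassum_nnsum => [_ _|].
    by rewrite expr1n mulr1.
  rewrite (_ : setT = [set tt]); last by apply/seteqP; split=> -[].
  by have := hassum1 tt (fun=> `|1 : R| * 1 ^+ size [:: i]); rewrite expr1n normr1 mulr1.
move=> y _; rewrite (_ : setT = [set tt]); last by apply/seteqP; split=> -[].
have := hassum1 tt (fun=> 1 * pw (y - x) [:: i]).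
by rewrite pw_cons pw_nil !mulr1 mul1r !mxE.
Qed.

(** The product of the series along [w], multiplied out: a list of pairs records which term is taken
    from the factor of each letter. *)
Lemma hassum_words (m n : nat) (b : 'I_n -> seq 'I_m -> R) (S : 'I_n -> R) :
  (forall i, hassum setT (b i) (S i)) -> forall w : seq 'I_n,
  hassum (unzip1 @^-1` [set w])
    (fun t : seq ('I_n * seq 'I_m) => \prod_(p <- t) b p.1 p.2)
    (\prod_(i <- w) S i).
Proof.
move=> H; elim=> [|i w IH].
  rewrite (_ : _ @^-1` _ = [set [::]]); last by apply/seteqP; split=> -[].
  have := hassum1 [::] (fun t : seq ('I_n * seq 'I_m) => \prod_(p <- t) b p.1 p.2).
  by rewrite !big_nil.
rewrite big_cons.
pose e (p : seq 'I_m * seq ('I_n * seq 'I_m)) := (i, p.1) :: p.2.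
apply: (hassum_image (P := setT `*` unzip1 @^-1` [set w]) (e := e)).
  split.
  - by move=> [v t] [/= _ <-].
  - by move=> [v t] [v' t'] _ _ [/= -> ->].
  - move=> [|[j v] t]//= [-> <-]; exists (v, t) => //.
apply: eq_hassum (hassum_prod (H i) IH) => -[v t] _ /=.
by rewrite big_cons.
Qed.

Lemma analytic_comp (m n : nat) (f : 'rV[R]_n -> R) (g : 'rV[R]_m -> 'rV[R]_n) u :
  analytic_at f (g u) -> analytic_map_at g u -> analytic_at (f \o g) u.
Proof.
move=> /analytic_words[a [r [r0 [Ma HA] cA]]] ga.
have /choice[b /choice[s Hb]] i : exists b, exists s, power_family (fun y => g y ord0 i) u s b id.
  by have [b [s ?]] := analytic_words (ga i); exists b, s.
have /choice[MB HB] i : exists M, nnsum setT (fun w => `|b i w| * s i ^+ size w) M.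
  by have [] := Hb i.
pose s0 := \big[Num.min/1]_i s i.
have s00 : 0 < s0.
  rewrite /s0; elim/big_ind : _ => //; last by move=> i _; have [] := Hb i.
  by move=> x y; rewrite lt_min => -> ->.
have s0le i : s0 <= s i by rewrite /s0 bigmin_le_cond.
pose K := 1 + \sum_i MB i.
have MB0 i : 0 <= MB i by apply: nnsum_ge0 (HB i).
have K1 : 1 <= K by rewrite lerDl sumr_ge0.
have MBK i : MB i <= K.
  rewrite /K (bigD1 i)//= addrCA lerDl addr_ge0// sumr_ge0//.
(* Shrinking the radius by [t <= 1] multiplies every nonconstant term by at most [t]. As
   [t * K <= r / 2], the increments of [g] stay inside the box of [f], even when summed in absolute
   value. *)
pose t := Num.min 1 (r / 2 / K).
have t0 : 0 < t by rewrite lt_min ltr01 !divr_gt0//; lra.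
have t1 : t <= 1 by rewrite ge_min lexx.
pose d := t * s0.
have d0 : 0 < d by rewrite mulr_gt0.
have ds i : d <= s i by apply: le_trans (s0le i); rewrite ler_piMl// ltW.
(* The constant terms are dropped because [f] is expanded around [g u]. *)
pose b' i w := if w == [::] then 0 else b i w.
have /choice[S HS] i : exists M, nnsum setT (fun w => `|b' i w| * d ^+ size w) M /\ M <= r / 2.
  have /nnsumZ : 0 <= t by exact: ltW.
  move=> /(_ _ _ _ _ (HB i)) H.
  have [||M HM ML] := nnsum_le (a := fun w => `|b' i w| * d ^+ size w) H.
  - by move=> w _; rewrite mulr_ge0// exprn_ge0// ltW.
  - move=> w _; rewrite /b'; case: eqP => [_|].
      have := Hb i; case=> si _ _.
      by rewrite normr0 mul0r !mulr_ge0 ?exprn_ge0 ?(ltW si) ?(ltW t0).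
    case: w => // j w _ /=; rewrite mulrCA ler_wpM2l//.
    rewrite /d exprMn ler_pM ?exprn_ge0 ?(ltW t0) ?(ltW s00)//.
      by rewrite exprS ler_piMr ?(ltW t0)// exprn_ile1// ltW.
    by rewrite lerXn2r// nnegrE ltW//; have [] := Hb i.
  exists M; split=> //; apply: le_trans ML _.
  apply: (@le_trans _ _ (t * K)); first by rewrite ler_wpM2l// ltW.
  rewrite -ler_pdivlMr ?(lt_le_trans ltr01)//.
  by rewrite ge_min lexx orbT.
have S0 i : 0 <= S i by apply: nnsum_ge0 (HS i).1.
have Sr i : S i < r by apply: le_lt_trans (HS i).2 _; lra.
have bE i (y : 'rV[R]_m) : (forall j, `|y ord0 j - u ord0 j| < d) ->
    hassum setT (fun w => b' i w * pw (y - u) w) (g y ord0 i - g u ord0 i).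
  move=> yd; have [si _ cB] := Hb i.
  have H1 := cB y (fun j => lt_le_trans (yd j) (ds i)).
  have H2 : b i [::] = g u ord0 i.
    have su j : `|u ord0 j - u ord0 j| < s i by rewrite subrr normr0.
    have H3 := cB u su; rewrite subrr in H3; apply: (hassum_inj _ H3).
    rewrite -[X in hassum _ _ X]mulr1 -(pw_nil (0 : 'rV[R]_m)).
    apply: (@hassum_single _ _ _ (fun w => b i w * pw (0 : 'rV[R]_m) w)) => w wn.
    by rewrite pw0// mulr0.
  have H4 : hassum setT (fun w => if w == [::] then b i w else 0) (b i [::]).
    have := @hassum_single _ _ [::] (fun w => if w == [::] then b i w else 0).
    by apply=> w wn; rewrite (negPf wn).
  rewrite -H2; apply: eq_hassum (hassumD H1 (hassumN H4)) => w _; rewrite /b'; case: eqP => [->|_]; last by rewrite oppr0 addr0.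
  by rewrite mul0r pw_nil mulr1 subrr.

(* [unzip1 t] is the word of the outer series, [flatten (unzip2 t)] the monomial that the inner
   series contribute. *)
pose c (t : seq ('I_n * seq 'I_m)) := a (unzip1 t) * \prod_(p <- t) b' p.1 p.2.
apply: (@analytic_family _ _ _ d _ c (fun t => flatten (unzip2 t))).
have dE (q : seq ('I_n * seq 'I_m)) : d ^+ size (flatten (unzip2 q)) = \prod_(p <- q) d ^+ size p.2.
  elim: q => [|p q IH]; first by rewrite big_nil.
  by rewrite big_cons /= size_cat exprD IH.
have [Mc Hc] : exists M, nnsum setT (fun t => `|c t| * d ^+ size (flatten (unzip2 t))) M.
  have [||M HM _] := nnsum_le (a := fun w => `|a w| * \prod_(i <- w) S i) HA.
  - by move=> w _; rewrite mulr_ge0// prodr_ge0.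
  - move=> w _; rewrite ler_wpM2l//; elim: w => [|i w IH]; first by rewrite big_nil.
    by rewrite big_cons exprS ler_pM ?prodr_ge0 ?(ltW (Sr _)).
  exists M; apply: (iffLR (nnsum_fibers (p := unzip1) _ _) HM) => w.
  apply: hassum_nnsum; first by move=> q _; rewrite mulr_ge0// exprn_ge0// ltW.
  have := hassumZ `|a w| (hassum_words (fun i => nnsum_hassum (HS i).1) w).
  apply: eq_hassum => q /= <-; rewrite /c dE big_split/= normrM normr_prod; ring.
split=> //; first by exists Mc.
move=> y yd.
have [z Hz _] : exists2 z, hassum setT (fun t => c t * pw (y - u) (flatten (unzip2 t))) z & `|z| <= Mc.
  apply: (hassum_dominated Hc) => q _; rewrite normrM ler_wpM2l// pw_le//.
  exact: box_sub.
rewrite (_ : (f \o g) y = z)//.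
have gr i : `|g y ord0 i - g u ord0 i| < r.
  apply: le_lt_trans (Sr i); apply: hassum_le (bE i y yd) (HS i).1 _ => w _.
  by rewrite normrM ler_wpM2l// pw_le//; exact: box_sub.
apply: hassum_inj (cA _ gr) _.
apply: (hassum_fibers (p := unzip1) _ Hz) => w.
have := hassumZ (a w) (hassum_words (fun i => bE i y yd) w).
rewrite (_ : \prod_(i <- w) _ = pw (g y - g u) w); last first.
  by apply: eq_bigr => i _; rewrite !mxE.
apply: eq_hassum => q /= <-; rewrite /c big_split/= mulrA; congr (_ * _).
elim: q => [|p q IH]; first by rewrite big_nil pw_nil.
by rewrite big_cons IH pw_cat.
Qed.

(** Nonempty words are grouped by their first letter, which is factored out; since words are
    ordered, the cofactors are explicit power series. *)
Lemma analytic_hadamard (n : nat) (f : 'rV[R]_n -> R) (x : 'rV[R]_n) :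
  analytic_at f x -> exists (g : 'I_n -> 'rV[R]_n -> R) (r : R),
    [/\ 0 < r, forall i, analytic_at (g i) x &
     forall y : 'rV[R]_n, (forall i, `|y ord0 i - x ord0 i| < r) ->
       f y = f x + \sum_i (y ord0 i - x ord0 i) * g i y].
Proof.
move=> /analytic_words[a [r [r0 [M HM] cA]]].
have consbij i : set_bij setT [set w : seq 'I_n | ohead w = Some i] (cons i).
  split=> //= [v w _ _ []//|[|j w]//= [->]]; by exists w.
have /choice[Mi HMi] i : exists M', nnsum setT (fun w => `|a (i :: w)| * r ^+ size w) M'.
  have [|A HA _] := @nnsum_sub _ _ _ [set w : seq 'I_n | ohead w = Some i] _ _ _ HM.
    by [].
  have /(nnsum_reindex _ _ (consbij i)) /= := HA.
  move=> /(nnsumZ (k := r^-1)); rewrite invr_ge0 => /(_ (ltW r0)) H.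
  exists (r^-1 * A); apply: eq_nnsum H => w _.
  by rewrite exprS mulrCA mulKf// gt_eqF.
have /choice[g Hg] i : exists g : 'rV[R]_n -> R,
    forall y : 'rV[R]_n, (forall j, `|y ord0 j - x ord0 j| < r) ->
    hassum setT (fun w => a (i :: w) * pw (y - x) w) (g y).
  suff /choice[h Hh] (y : 'rV[R]_n) : exists v, (forall j, `|y ord0 j - x ord0 j| < r) ->
    hassum setT (fun w => a (i :: w) * pw (y - x) w) v by exists h.
  have [yr|nyr] := pselect (forall j, `|y ord0 j - x ord0 j| < r); last by exists 0.
  have [|s Hs _] := @hassum_dominated _ _ _ (fun w => a (i :: w) * pw (y - x) w) _ _ (HMi i).
    by move=> w _; rewrite normrM ler_wpM2l// pw_le//; exact: box_sub.
  by exists s.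
exists g, r; split=> //.
  move=> i; apply: (@analytic_family _ _ _ r _ (fun w => a (i :: w)) id).
  by split=> //; [exists (Mi i)|exact: Hg].
have main (y : 'rV[R]_n) : (forall i, `|y ord0 i - x ord0 i| < r) ->
    f y = a [::] + \sum_i (y ord0 i - x ord0 i) * g i y.
  move=> yr; pose h o := if o is Some i then (y ord0 i - x ord0 i) * g i y else a [::].
  have : hassum setT h (f y).
    apply: (hassum_fibers (p := @ohead _) _ (cA y yr)) => -[i|] /=.
      rewrite (_ : _ @^-1` _ = [set w : seq 'I_n | ohead w = Some i]); last first.
        by apply/seteqP; split.
      apply: (hassum_image (consbij i)).
      have := hassumZ (y ord0 i - x ord0 i) (Hg i y yr).
      by apply: eq_hassum => w _; rewrite pw_cons !mxE; ring.
    rewrite (_ : _ @^-1` _ = [set [::]]); last first.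
      by apply/seteqP; split=> -[].
    by have := hassum1 [::] (fun w => a w * pw (y - x) w); rewrite pw_nil mulr1.
  have ub : uniq (index_enum (option 'I_n)) by exact: index_enum_uniq.
  have := hassum_seq h ub; rewrite (_ : [set` _] = setT); last first.
    by apply/seteqP; split=> // o _ /=; rewrite mem_index_enum.
  move=> H1 H2; rewrite (hassum_inj H2 H1) (bigD1 None)//=; congr (_ + _).
  rewrite (reindex_omap Some id)/=; last by case.
  by apply: eq_big => [i|i _]//; rewrite eqxx.
move=> y yr; rewrite (main y yr) [in RHS](main x); last by move=> i; rewrite subrr normr0.
rewrite -addrA; congr (_ + _); rewrite [X in _ = X + _]big1 ?add0r// => i _.
by rewrite subrr mul0r.
Qed.

(** Words are sorted by their number of letters in the second block. Those with exactly one such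
    letter form the power series of the derivative, and the radius does not depend on [u]. *)
Lemma analytic_partial (m n : nat) (F : 'rV[R]_(m + n) -> R) (u0 : 'rV[R]_m)
    (v0 xi : 'rV[R]_n) :
  analytic_at F (row_mx u0 v0) -> exists (D : 'rV[R]_m -> R) (r : R),
    [/\ 0 < r, analytic_at D u0 &
     forall u : 'rV[R]_m, (forall i, `|u ord0 i - u0 ord0 i| < r) ->
       is_derive (0 : R) (1 : R) (fun t => F (row_mx u (v0 + t *: xi))) (D u)].
Proof.
move=> /analytic_words[a [r [r0 [M HM] cA]]].
pose K := 1 + \sum_i `|xi ord0 i|.
have xiK i : `|xi ord0 i| <= K.
  by rewrite /K (bigD1 i)//= addrCA lerDl addr_ge0// sumr_ge0.
have K1 : 1 <= K by rewrite lerDl sumr_ge0.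
have K0 : 0 < K by apply: lt_le_trans K1.
(* For [|t| <= s] the entries of [t *: xi] are at most [r / 2]. *)
pose s := r / (2 * K).
have s0 : 0 < s by rewrite divr_gt0// mulr_gt0.
have sK : s * K = r / 2 by rewrite /s; field; rewrite gt_eqF.
pose isr (i : 'I_(m + n)) := if fintype.split i is inr _ then true else false.
pose j (w : seq 'I_(m + n)) := count isr w.
pose mu (u : 'rV[R]_m) (w : seq 'I_(m + n)) : R :=
  \prod_(i <- w) (match fintype.split i with inl k => u ord0 k - u0 ord0 k | inr k => xi ord0 k end).
have pwE (u : 'rV[R]_m) t w :
    pw (row_mx u (v0 + t *: xi) - row_mx u0 v0) w = mu u w * t ^+ j w.
  elim: w => [|i w IH]; first by rewrite pw_nil /mu big_nil mulr1.
  rewrite pw_cons IH /mu big_cons /j /= /isr !mxE; case: fintype.splitP => k _; rewrite /= ?add0n ?mxE.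
    by rewrite -!mulrA.
  by rewrite exprS addrAC subrr add0r; ring.
have bnd (u : 'rV[R]_m) w : (forall i, `|u ord0 i - u0 ord0 i| < r) ->
    `|mu u w| * s ^+ j w <= r ^+ size w.
  move=> ur; elim: w => [|i w IH]; first by rewrite /mu big_nil normr1 mulr1.
  rewrite /mu big_cons normrM /j /= exprD mulrACA exprS.
  apply: ler_pM => //; first by rewrite mulr_ge0 ?exprn_ge0// ltW.
    by rewrite mulr_ge0 ?exprn_ge0// ltW.
  rewrite /isr; case: fintype.splitP => k _; rewrite /= ?mulr1 ?expr1; first exact: ltW.
  apply: (@le_trans _ _ (K * s)); first by rewrite ler_wpM2r// ltW.
  by rewrite mulrC sK; lra.
pose d (w : seq 'I_(m + n)) : R := if j w == 1%N then a w * \prod_(i <- w)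
  (match fintype.split i with inl k => 1 | inr k => xi ord0 k end) else 0.
pose lw (w : seq 'I_(m + n)) : seq 'I_m :=
  pmap (fun i => match fintype.split i with inl k => Some k | inr _ => None end) w.
have dE u w : d w * pw (u - u0) (lw w) = (j w == 1%N)%:R * (a w * mu u w).
  rewrite /d; case: eqP => _; last by rewrite !mul0r.
  rewrite mul1r -mulrA; congr (_ * _); elim: w => [|i w IH].
    by rewrite /mu /lw !big_nil pw_nil mulr1.
  rewrite /mu !big_cons -/(mu u w) -IH /lw /=; case: fintype.splitP => k _ /=.
    by rewrite pw_cons !mxE; ring.
  by rewrite mulrA.
have dbnd w : `|d w| * r ^+ size (lw w) <= s^-1 * (`|a w| * r ^+ size w).
  have h : `|d w| * r ^+ size (lw w) <= (j w == 1%N)%:R * `|a w| *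
      \prod_(i <- w) (match fintype.split i with inl k => r | inr k => K end).
    rewrite /d; case: eqP => _; last by rewrite normr0 !mul0r.
    rewrite mul1r normrM -mulrA ler_wpM2l//; elim: w => [|i w IH].
      by rewrite !big_nil normr1 mulr1.
    rewrite !big_cons /lw /=; case: fintype.splitP => k _ /=.
      by rewrite mul1r exprS mulrCA ler_wpM2l// ltW.
    by rewrite normrM -mulrA ler_pM// mulr_ge0// exprn_ge0// ltW.
  apply: le_trans h _; rewrite ler_pdivlMl// mulrCA -mulrA mulrCA.
  have [jw|_] := eqVneq (j w) 1%N; last first.
    by rewrite !mul0r !mulr0 mulr_ge0 ?exprn_ge0// ltW.
  rewrite mul1r ler_wpM2l// -[s]expr1 -[X in s ^+ X]jw; elim: {jw} w => [|i w IH].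
    by rewrite big_nil mulr1.
  rewrite big_cons /j /= exprD mulrACA exprS; apply: ler_pM => //.
  - by case: fintype.splitP => k _; rewrite mulr_ge0 ?exprn_ge0 ?(ltW s0) ?(ltW r0) ?(ltW K0).
  - rewrite mulr_ge0 ?exprn_ge0 ?(ltW s0)// prodr_ge0// => k _.
    by case: fintype.splitP => l _; rewrite ltW.
  rewrite /isr; case: fintype.splitP => k _; rewrite /= ?mul1r// expr1 sK; lra.
have s0' : 0 <= s^-1 by rewrite invr_ge0 ltW.
have [||Md HMd _] := nnsum_le (a := fun w => `|d w| * r ^+ size (lw w)) (nnsumZ s0' HM).
- by move=> w _; rewrite mulr_ge0 ?exprn_ge0// ltW.
- by move=> w _; exact: dbnd.
have [D HD] : exists D : 'rV[R]_m -> R, forall u : 'rV[R]_m, (forall i, `|u ord0 i - u0 ord0 i| < r) ->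
    hassum setT (fun w => d w * pw (u - u0) (lw w)) (D u).
  suff /choice[h Hh] (u : 'rV[R]_m) : exists v, (forall i, `|u ord0 i - u0 ord0 i| < r) ->
    hassum setT (fun w => d w * pw (u - u0) (lw w)) v by exists h.
  have [ur|nur] := pselect (forall j, `|u ord0 j - u0 ord0 j| < r); last by exists 0.
  have [|z Hz _] := @hassum_dominated _ _ _ (fun w => d w * pw (u - u0) (lw w)) _ _ HMd.
    by move=> w _; rewrite normrM ler_wpM2l// pw_le//; exact: box_sub.
  by exists z.
exists D, r; split=> //.
  by apply: (@analytic_family _ _ _ r _ d lw); split=> //; exists Md.
move=> u ur; set f := fun t => F _.
have Ft t : `|t| <= s -> hassum setT (fun w => a w * mu u w * t ^+ j w) (f t).
  move=> ts; have := cA (row_mx u (v0 + t *: xi)); rewrite -/(f t) => H.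
  apply: (eq_hassum _ (H _)) => [w _|i]; first by rewrite pwE mulrA.
  rewrite !mxE; case: fintype.splitP => k _; rewrite ?mxE; first exact: ur.
  rewrite addrAC subrr add0r normrM; apply: (@le_lt_trans _ _ (s * K)).
    exact: ler_pM.
  by rewrite sK; lra.
(* Words with no letter or one letter in the second block cancel. Every other word carries [t ^+ j]
   with [j >= 2], of which two powers of [t / s] are kept and the rest is bounded by 1. *)
have est t : `|t| <= s -> `|f t - f 0 - t * D u| <= `|t| ^+ 2 * (s ^- 2 * M).
  move=> ts; have H0 := Ft 0; rewrite normr0 in H0.
  have H := hassumD (hassumD (Ft t ts) (hassumN (H0 (ltW s0)))) (hassumN (hassumZ t (HD u ur))).
  rewrite mulrA; apply: (hassum_le H (nnsumZ _ HM)).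
    by rewrite mulr_ge0 ?exprn_ge0// invr_ge0 exprn_ge0// ltW.
  move=> w _; rewrite dE expr0n.
  have e : `|a w * mu u w * s ^+ j w| <= `|a w| * r ^+ size w.
    by rewrite -mulrA normrM ler_wpM2l// normrM normrX (gtr0_norm s0) bnd.
  case: (j w) e => [|[|k]] e /=.
  - rewrite expr0 !mulr1 mul0r mulr0 !subrr normr0.
    by rewrite !mulr_ge0 ?invr_ge0 ?exprn_ge0 ?(ltW s0) ?(ltW r0).
  - rewrite (_ : _ + _ = 0) ?normr0; last by rewrite /=; ring.
    by rewrite !mulr_ge0 ?invr_ge0 ?exprn_ge0 ?(ltW s0) ?(ltW r0).
  - rewrite (_ : _ - _ - _ = a w * mu u w * t ^+ k.+2); last by rewrite /=; ring.
    have normE z : `|a w * mu u w * z ^+ k.+2| = `|a w * mu u w| * (`|z| ^+ 2 * `|z| ^+ k).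
      by rewrite normrM normrX -exprD.
    rewrite normE (gtr0_norm s0) in e; rewrite normE.
    apply: (@le_trans _ _ (`|t| ^+ 2 / s ^+ 2 * (`|a w * mu u w| * (s ^+ 2 * s ^+ k)))).
      rewrite (_ : _ / _ * _ = `|a w * mu u w| * (`|t| ^+ 2 * s ^+ k)); last by field; rewrite gt_eqF.
      by rewrite !ler_wpM2l ?exprn_ge0// lerXn2r// nnegrE ltW.
    by rewrite ler_wpM2l// mulr_ge0 ?exprn_ge0// invr_ge0 exprn_ge0// ltW.
have lim : (fun h : R => h^-1 *: ((f \o shift (0 : R)) (h *: (1 : R)) - f 0)) @ (0 : R)^' --> D u.
  apply/cvgrPdist_le => e e0.
  pose C := s ^- 2 * M + 1.
  have C0 : 0 < C by rewrite ltr_pwDr// mulr_ge0 ?(nnsum_ge0 HM)// invr_ge0 exprn_ge0// ltW.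
  near=> h.
  have h0 : h != 0 by near: h; exact: nbhs_dnbhs_neq.
  have hs : `|h| <= Num.min s (e / C).
    near: h; apply: dnbhs0_le; by rewrite lt_min s0 divr_gt0.
  move: hs; rewrite le_min => /andP[hs he].
  rewrite /= addr0 /GRing.scale/= mulr1 distrC.
  rewrite (_ : _ - _ = h^-1 * (f h - f 0 - h * D u)); last by field.
  rewrite normrM normfV -ler_pdivlMl ?invr_gt0 ?normr_gt0// invrK.
  apply: le_trans (est h hs) _; rewrite expr2 -mulrA ler_wpM2l//.
  apply: le_trans (_ : `|h| * C <= _); first by rewrite ler_wpM2l// lerDl.
  by rewrite -ler_pdivlMr.
have der : derivable f 0 1 by apply/cvg_ex; exists (D u).
by split=> //; apply: cvg_lim lim.
Unshelve. all: by end_near.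
Qed.
End Analytic.

(** * Left-invariant derivatives of analytic germs *)

Section LieGerms.
Context {R : realType} {n : nat} {G : lieGroupType R n}.
Implicit Types (f h : G -> R) (g x : G) (xi eta : 'rV[R]_n).

Local Notation crd := (@chart R n G).
Local Notation pnt := (@chart_inv R n G).
Local Notation e := (1%g : G).

Definition an_at f g : Prop := analytic_at (fun u => f (pnt g u)) (crd g g).

(** A straight line in the chart at the unit, not a one-parameter subgroup: only the derivative at 0
    matters. *)
Definition line xi x : R -> G := fun t => (x * pnt e (crd e e + t *: xi))%g.

Lemma chart_invK_center g : pnt g (crd g g) = g.
Proof. exact/chartK/chart_dom_center. Qed.

Lemma near_chart_inv g (P : G -> Prop) :
  (\forall x \near g, P x) -> \forall u \near crd g g, P (pnt g u).
Proof.
move=> Pg; have := @chart_inv_continuous R n G g g (chart_dom_center g).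
by apply; rewrite chart_invK_center.
Qed.

Lemma near_chart g (P : 'rV[R]_n -> Prop) :
  (\forall u \near crd g g, P u) -> \forall x \near g, P (crd g x).
Proof. by move=> Pg; exact: (@chart_continuous R n G g g (chart_dom_center g) _ Pg). Qed.

Lemma near_chart_dom g : \forall x \near g, chart_dom g x.
Proof. exact/open_nbhs_nbhs/(conj (chart_dom_open g) (chart_dom_center g)). Qed.

Lemma near_chartK g : \forall u \near crd g g, crd g (pnt g u) = u.
Proof.
have : nbhs (crd g g) (crd g @` chart_dom g).
  apply/open_nbhs_nbhs; split; first exact: chart_image_open.
  by exists g => //; exact: chart_dom_center.
by apply: filterS => _ [x xd <-]; rewrite chartK.
Qed.

Lemma an_at_cst (k : R) g : an_at (fun=> k) g.
Proof. exact: analytic_cst. Qed.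

Lemma an_atM f h g : an_at f g -> an_at h g -> an_at (fun x => f x * h x) g.
Proof. exact: analyticM. Qed.

Lemma an_atD f h g : an_at f g -> an_at h g -> an_at (fun x => f x + h x) g.
Proof. exact: analyticD. Qed.

Lemma an_atZ (k : R) f g : an_at f g -> an_at (fun x => k * f x) g.
Proof. by apply: an_atM; apply: an_at_cst. Qed.

Lemma an_atB f h g : an_at f g -> an_at h g -> an_at (fun x => f x - h x) g.
Proof.
move=> F H; rewrite (_ : (fun x => _) = (fun x => f x + (-1) * h x)).
  exact/an_atD/an_atZ.
by apply/funext => x; rewrite mulN1r.
Qed.

Lemma an_at_sum (I : Type) (r : seq I) (F : I -> G -> R) g :
  (forall i, an_at (F i) g) -> an_at (fun x => \sum_(i <- r) F i x) g.
Proof.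
move=> H; elim: r => [|i r IH].
  by under eq_fun do rewrite big_nil; apply: an_at_cst.
by under eq_fun do rewrite big_cons; apply: an_atD.
Qed.

Lemma an_at_coord g x k : chart_dom x g -> an_at (fun y => crd x y ord0 k) g.
Proof.
by move=> xg; have := @chart_transition R n G g x g (chart_dom_center g) xg; apply.
Qed.

Lemma an_at_chart (F : 'rV[R]_n -> R) g : analytic_at F (crd g g) ->
  an_at (fun x => F (crd g x)) g.
Proof.
apply: analytic_near; apply: filterS (near_chartK g) => u /= uE.
by rewrite uE.
Qed.

Lemma near_submx (p q : nat) (u : 'rV[R]_p) (v : 'rV[R]_q)
    (P : 'rV[R]_p -> Prop) (Q : 'rV[R]_q -> Prop) :
  (\forall x \near u, P x) -> (\forall y \near v, Q y) ->
  \forall w \near row_mx u v, P (lsubmx w) /\ Q (rsubmx w).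
Proof.
move=> /nbhs_ballP[a /= a0 Pa] /nbhs_ballP[b /= b0 Qb].
apply/nbhs_ballP; exists (Num.min a b); first by rewrite /= lt_min a0.
move=> w [_ H]; split.
  apply: Pa; split=> // i j; have := H i (lshift q j).
  rewrite row_mxEl !mxE; apply: le_ball; exact: ge_minL.
apply: Qb; split=> // i j; have := H i (rshift p j).
rewrite row_mxEr !mxE; apply: le_ball; exact: ge_minR.
Qed.

Lemma near_mul g x (P : G -> Prop) : (\forall y \near (g * x)%g, P y) ->
  \forall w \near row_mx (crd g g) (crd x x),
    P (pnt g (lsubmx w) * pnt x (rsubmx w))%g.
Proof.
move=> Pg; have := @lie_mul_continuous R n G (g, x) _ Pg.
move=> [[A1 A2] /= [A1g A2x] A12].
have := near_submx (near_chart_inv A1g) (near_chart_inv A2x).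
by apply: filterS => w [w1 w2]; apply: (A12 (_, _)).
Qed.

(** By continuity of the multiplication, products near the centre stay in the chart at [g]; there
    the chart expressions of [f] and of the product can be composed. *)
Lemma an_at_mul f g : an_at f g ->
  analytic_at (fun w => f (pnt g (lsubmx w) * pnt e (rsubmx w))%g)
    (row_mx (crd g g) (crd e e)).
Proof.
move=> fg; pose M (w : 'rV[R]_(n + n)) :=
  crd g (pnt g (lsubmx w) * pnt e (rsubmx w))%g.
have Man : analytic_map_at M (row_mx (crd g g) (crd e e)).
  by have := @lie_mul_analytic R n G g e; rewrite mulg1.
have M0 : M (row_mx (crd g g) (crd e e)) = crd g g.
  by rewrite /M row_mxKl row_mxKr !chart_invK_center mulg1.
have : analytic_at ((fun u => f (pnt g u)) \o M) (row_mx (crd g g) (crd e e)).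
  by apply: analytic_comp => //; rewrite M0.
apply: analytic_near.
have := @near_mul g e (chart_dom g).
rewrite mulg1 => /(_ (near_chart_dom g)); apply: filterS => w /chartK /= dw.
by rewrite /M dw.
Qed.

(** In charts, moving along [line xi] means moving the second block in [an_at_mul]. So
    [analytic_partial] gives at once existence of the derivative on a neighbourhood and its
    analyticity. *)
Lemma lieR_analytic xi f g : an_at f g -> exists D : 'rV[R]_n -> R,
  analytic_at D (crd g g) /\ \forall u \near crd g g,
    is_derive (0 : R) (1 : R) (fun t => f (line xi (pnt g u) t)) (D u).
Proof.
move=> /an_at_mul/(analytic_partial xi)[D [r [r0 Dan H]]]; exists D; split=> //.
apply/nbhs_ballP; exists r => //= u [_ ur].
have {}/H : forall i, `|u ord0 i - crd g g ord0 i| < r.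
  by move=> i; have := ur ord0 i; rewrite /ball/= distrC.
congr (is_derive _ _ _ _); apply/funext => t.
by rewrite row_mxKl row_mxKr.
Qed.

Lemma is_derive_lieR xi f x d :
  is_derive (0 : R) (1 : R) (fun t => f (line xi x t)) d -> lieR xi f x = d.
Proof. by move=> H; rewrite /lieR derive1E; apply: derive_val. Qed.

Lemma an_at_lieR xi f g : an_at f g -> an_at (lieR xi f) g.
Proof.
move=> /(lieR_analytic xi)[D [Dan H]]; apply: analytic_near Dan.
by apply: filterS H => u /is_derive_lieR ->.
Qed.

Lemma near_is_derive xi f g : an_at f g -> \forall x \near g,
  is_derive (0 : R) (1 : R) (fun t => f (line xi x t)) (lieR xi f x).
Proof.
move=> /(lieR_analytic xi)[D [_ /near_chart H]].
near=> x; have xK : pnt g (crd g x) = x.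
  by apply: chartK; near: x; apply: near_chart_dom.
have Hx : is_derive (0 : R) (1 : R)
    (fun t => f (line xi (pnt g (crd g x)) t)) (D (crd g x)) by near: x.
by rewrite xK in Hx; rewrite (is_derive_lieR Hx).
Unshelve. all: by end_near.
Qed.

Lemma an_at_is_derive xi f x : an_at f x ->
  is_derive (0 : R) (1 : R) (fun t => f (line xi x t)) (lieR xi f x).
Proof. by move=> /(near_is_derive xi)/nbhs_singleton. Qed.

Lemma line0 xi x : line xi x 0 = x.
Proof. by rewrite /line scale0r addr0 chart_invK_center mulg1. Qed.

Lemma near_line xi x (P : G -> Prop) : (\forall y \near x, P y) ->
  \forall t \near (0 : R), P (line xi x t).
Proof.
move=> Px; have := @near_mul x e P; rewrite mulg1 => /(_ Px).
move=> /nbhs_ballP[r /= r0 H].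
pose K := 1 + \sum_i `|xi ord0 i|.
have xiK i : `|xi ord0 i| <= K.
  by rewrite /K (bigD1 i)//= addrCA lerDl addr_ge0// sumr_ge0.
have K0 : 0 < K by rewrite (@lt_le_trans _ _ 1)// lerDl sumr_ge0.
apply/nbhs_ballP; exists (r / K) => /=; first by rewrite divr_gt0.
move=> t; rewrite /ball/= sub0r normrN => tr.
have := H (row_mx (crd x x) (crd e e + t *: xi)).
rewrite row_mxKl row_mxKr chart_invK_center; apply.
split=> // i j; rewrite /ball/= !mxE.
case: fintype.splitP => k _; first by rewrite subrr normr0.
rewrite !mxE (ord1 i) opprD addNKr normrN normrM.
by apply: le_lt_trans (ler_wpM2l _ (xiK k)) _; rewrite // -ltr_pdivlMr.
Qed.

Lemma lieR_eq xi f h x : (\forall y \near x, f y = h y) ->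
  lieR xi f x = lieR xi h x.
Proof.
move=> fh; rewrite /lieR !derive1E; apply: near_eq_derive.
exact: (near_line xi fh).
Qed.

Lemma lieR_near xi f h g : (\forall x \near g, f x = h x) ->
  \forall x \near g, lieR xi f x = lieR xi h x.
Proof. by move/near_join; apply: filterS => x; apply: lieR_eq. Qed.

Lemma lieR_cst xi (k : R) x : lieR xi (fun=> k) x = 0.
Proof. by rewrite /lieR derive1E; apply: derive_cst. Qed.

Lemma lieRM xi f h x : an_at f x -> an_at h x ->
  lieR xi (fun y => f y * h y) x = lieR xi f x * h x + f x * lieR xi h x.
Proof.
move=> /(an_at_is_derive xi) F /(an_at_is_derive xi) H.
apply: is_derive_lieR; have := is_deriveM F H; rewrite !line0 /GRing.scale/= => FH.
by rewrite (_ : _ + _ = f x * lieR xi h x + h x * lieR xi f x)//; ring.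
Qed.

Lemma lieRD xi f h x : an_at f x -> an_at h x ->
  lieR xi (fun y => f y + h y) x = lieR xi f x + lieR xi h x.
Proof.
move=> /(an_at_is_derive xi) F /(an_at_is_derive xi) H.
by apply: is_derive_lieR; apply: is_deriveD.
Qed.

Lemma lieRZ xi (k : R) f x : an_at f x ->
  lieR xi (fun y => k * f y) x = k * lieR xi f x.
Proof.
by move=> F; rewrite lieRM// ?lieR_cst ?mul0r ?add0r//; apply: an_at_cst.
Qed.

Lemma lieR_sum (I : Type) (r : seq I) xi (F : I -> G -> R) x :
  (forall i, an_at (F i) x) ->
  lieR xi (fun y => \sum_(i <- r) F i y) x = \sum_(i <- r) lieR xi (F i) x.
Proof.
move=> H; elim: r => [|i r IH].
  by under eq_fun do rewrite big_nil; rewrite lieR_cst big_nil.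
under eq_fun do rewrite big_cons; rewrite lieRD// ?IH ?big_cons//.
exact: an_at_sum.
Qed.

Lemma near_lieRM xi f h g : an_at f g -> an_at h g -> \forall y \near g,
  lieR xi (fun y => f y * h y) y = lieR xi f y * h y + f y * lieR xi h y.
Proof.
move=> /(near_is_derive xi) F /(near_is_derive xi) H.
apply: filterS2 F H => x F H; apply: is_derive_lieR; have := is_deriveM F H; rewrite !line0 /GRing.scale/= => FH.
by rewrite (_ : _ + _ = f x * lieR xi h x + h x * lieR xi f x)//; ring.
Qed.

Lemma near_lieRD xi f h g : an_at f g -> an_at h g -> \forall y \near g,
  lieR xi (fun y => f y + h y) y = lieR xi f y + lieR xi h y.
Proof.
move=> /(near_is_derive xi) F /(near_is_derive xi) H.
by apply: filterS2 F H => x F H; apply: is_derive_lieR; apply: is_deriveD.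
Qed.

Lemma lieR_translate xi f g x :
  lieR xi (fun y => f (g * y)%g) x = lieR xi f (g * x)%g.
Proof. by rewrite /lieR; congr (derive1 _ _); apply/funext => t; rewrite mulgA. Qed.

Lemma an_at_translate f g : an_at f g -> an_at (fun y => f (g * y)%g) e.
Proof.
move=> /an_at_mul fg.
have : analytic_at ((fun w => f (pnt g (lsubmx w) * pnt e (rsubmx w))%g) \o
    (fun v : 'rV[R]_n => row_mx (crd g g) v)) (crd e e).
  apply: analytic_comp => // i; rewrite -(splitK i); case: (fintype.split i) => j /=.
    by under eq_fun do rewrite row_mxEl; apply: analytic_cst.
  by under eq_fun do rewrite row_mxEr; apply: analytic_coord.
by congr (analytic_at _ _); apply/funext => u /=; rewrite row_mxKl row_mxKr chart_invK_center.
Qed.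

Lemma lieR_coord xi k : lieR xi (fun x => crd e x ord0 k) e = xi ord0 k.
Proof.
have H : \forall t \near (0 : R), crd e (line xi e t) ord0 k = crd e e ord0 k + t * xi ord0 k.
  have c0 : (fun t : R => crd e e + t *: xi) @ (0 : R) --> crd e e.
    rewrite -[X in _ --> X]addr0 -(scale0r xi).
    by apply: cvgD; [exact: cvg_cst|apply: cvgZl; exact: cvg_id].
  near=> t; rewrite /line mul1g.
  have -> : crd e (pnt e (crd e e + t *: xi)) = crd e e + t *: xi.
    by near: t; apply: (c0 (fun u => crd e (pnt e u) = u)); exact: near_chartK.
  by rewrite !mxE.
apply: is_derive_lieR; apply: (near_eq_is_derive (f := fun t : R => crd e e ord0 k + t * xi ord0 k)).
  by apply: filterS H => t ->.
have := is_deriveD (is_derive_cst (crd e e ord0 k) (0 : R) (1 : R))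
  (is_deriveZ (xi ord0 k) (is_derive_id (0 : R) (1 : R))).
rewrite add0r /GRing.scale/= mulr1; congr (is_derive _ _ _ _).
by apply/funext => t /=; rewrite -[(_ + _) t]/(_ + _) /= mulrC.
Unshelve. all: by end_near.
Qed.

Definition local_coord l x := crd e x ord0 l - crd e e ord0 l.

Lemma local_coord_an l x : chart_dom e x -> an_at (local_coord l) x.
Proof. by move=> /an_at_coord H; apply: an_atB; [exact: H|exact: an_at_cst]. Qed.

Lemma local_coord1 l : local_coord l e = 0.
Proof. by rewrite /local_coord subrr. Qed.

Lemma lieR_local_coord xi l x : chart_dom e x ->
  lieR xi (local_coord l) x = lieR xi (fun y => crd e y ord0 l) x.
Proof.
move=> /an_at_coord H; have Hc := an_at_cst (- crd e e ord0 l) x.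
by rewrite (lieRD _ (H l) Hc) lieR_cst addr0.
Qed.

Lemma an_at_hadamard f : an_at f e -> exists h : 'I_n -> G -> R,
  (forall l, an_at (h l) e) /\
  \forall x \near e, f x = f e + \sum_l local_coord l x * h l x.
Proof.
move=> /analytic_hadamard[h [r [r0 han H]]].
exists (fun l x => h l (crd e x)); split=> [l|]; first exact: an_at_chart.
have /near_chart H' : \forall u \near crd e e, f (pnt e u) =
    f (pnt e (crd e e)) + \sum_l (u ord0 l - crd e e ord0 l) * h l u.
  apply/nbhs_ballP; exists r => //= u [_ ur]; apply: H => i.
  by have := ur ord0 i; rewrite /ball/= distrC.
near=> x; have xK : pnt e (crd e x) = x.
  by apply: chartK; near: x; apply: near_chart_dom.
have : f (pnt e (crd e x)) = f (pnt e (crd e e)) +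
    \sum_l (crd e x ord0 l - crd e e ord0 l) * h l (crd e x) by near: x; exact: H'.
by rewrite xK chart_invK_center.
Unshelve. all: by end_near.
Qed.

Let an_coord l : an_at (local_coord l) e.
Proof. exact/local_coord_an/chart_dom_center. Qed.

(** After translation to the unit, Hadamard's formula writes the function with coordinates times
    cofactors; the product rule retains only the values of the cofactors at the unit, whatever [xi]
    is. *)
Lemma lieR_gradient f g : an_at f g -> exists a : 'I_n -> R,
  forall xi, lieR xi f g = \sum_l xi ord0 l * a l.
Proof.
move=> /an_at_translate/an_at_hadamard[h [han H]].
exists (fun l => h l e) => xi.
rewrite -[g in LHS]mulg1 -lieR_translate (lieR_eq _ H) lieRD; last 2 first.
- exact: an_at_cst.
- by apply: an_at_sum => l; apply: an_atM.
rewrite lieR_cst add0r lieR_sum => [|l]; last exact: an_atM.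
apply: eq_bigr => l _; rewrite lieRM// local_coord1 mul0r addr0.
by rewrite lieR_local_coord ?lieR_coord//; exact: chart_dom_center.
Qed.

(** The two sides differ by an additive functional [cm] that kills constants and, by the choice of
    [lie_bracket], the coordinates. On a coordinate vanishing at the unit times [h] it equals its
    value on the coordinate times [h] at the unit, hence 0, and Hadamard's formula leaves nothing
    else. *)
Lemma lieR_commutator1 xi eta f : an_at f e ->
  lieR xi (lieR eta f) e - lieR eta (lieR xi f) e = lieR (lie_bracket G xi eta) f e.
Proof.
pose cm f := lieR xi (lieR eta f) e - lieR eta (lieR xi f) e - lieR (lie_bracket G xi eta) f e.
have cmD f1 f2 : an_at f1 e -> an_at f2 e -> cm (fun x => f1 x + f2 x) = cm f1 + cm f2.
  move=> F1 F2; rewrite /cm (lieR_eq xi (near_lieRD eta F1 F2)).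
  rewrite (lieR_eq eta (near_lieRD xi F1 F2)) (lieRD _ F1 F2).
  rewrite (lieRD xi (an_at_lieR eta F1) (an_at_lieR eta F2)).
  rewrite (lieRD eta (an_at_lieR xi F1) (an_at_lieR xi F2)).
  move: (lieR xi (lieR eta f1) e) (lieR eta (lieR xi f1) e) (lieR _ f1 e) => a b c.
  move: (lieR xi (lieR eta f2) e) (lieR eta (lieR xi f2) e) (lieR _ f2 e) => a' b' c'.
  by ring.
have cm_eq f1 f2 : (\forall x \near e, f1 x = f2 x) -> cm f1 = cm f2.
  move=> F; rewrite /cm (lieR_eq xi (lieR_near eta F)) (lieR_eq eta (lieR_near xi F)).
  by rewrite (lieR_eq _ F).
have cmk k : cm (fun=> k) = 0.
  have E z : lieR z (fun=> k) = (fun=> 0) :> (G -> R).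
    by apply/funext => x; exact: lieR_cst.
  by rewrite /cm !E !lieR_cst !subr0.
have cmc l : cm (local_coord l) = 0.
  have E zeta x : chart_dom e x -> lieR zeta (local_coord l) x = lieR zeta (fun y => crd e y ord0 l) x.
    exact: lieR_local_coord.
  have N zeta : \forall x \near e, lieR zeta (local_coord l) x = lieR zeta (fun y => crd e y ord0 l) x.
    by apply: filterS (near_chart_dom e) => x; apply: E.
  rewrite /cm (lieR_eq _ (N eta)) (lieR_eq _ (N xi)) E; last exact: chart_dom_center.
  by rewrite lieR_coord /lie_bracket mxE subrr.
have cmM l h : an_at h e -> cm (fun x => local_coord l x * h x) = 0.
  move=> H; rewrite -[RHS](mul0r (h e)) -(cmc l) /cm.
  rewrite (lieR_eq xi (near_lieRM eta (an_coord l) H)).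
  rewrite (lieR_eq eta (near_lieRM xi (an_coord l) H)).
  (* The terms with one derivative on each factor are symmetric in [a] and [b], so they disappear
     from the commutator. *)
  have X a b : lieR a (fun x => lieR b (local_coord l) x * h x +
        local_coord l x * lieR b h x) e =
      lieR a (lieR b (local_coord l)) e * h e +
      (lieR b (local_coord l) e * lieR a h e +
       lieR a (local_coord l) e * lieR b h e).
    have H1 := an_at_lieR b (an_coord l); have H2 := an_at_lieR b H.
    rewrite (lieRD _ (an_atM H1 H) (an_atM (an_coord l) H2)).
    by rewrite (lieRM _ H1 H) (lieRM _ (an_coord l) H2) local_coord1 mul0r addr0 addrA.
  rewrite !X (lieRM _ (an_coord l) H) local_coord1 mul0r addr0 {X}.
  move: (lieR xi (lieR eta _) e) (lieR eta (lieR xi _) e) => a b.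
  move: (lieR eta (local_coord l) e) (lieR xi (local_coord l) e) (lieR eta h e) (lieR xi h e) => a1 b1 a2 b2.
  move: (lieR _ _ e) => c1.
  by ring.
move=> /an_at_hadamard[h [han H]]; apply/eqP; rewrite -subr_eq0 -/(cm f); apply/eqP.
rewrite (cm_eq _ _ H) cmD; last 2 first.
- exact: an_at_cst.
- by apply: an_at_sum => l; apply: an_atM.
rewrite cmk add0r; elim: (index_enum _) => [|l s IH].
  by under eq_fun do rewrite big_nil; rewrite cmk.
under eq_fun do rewrite big_cons.
rewrite cmD ?IH ?cmM ?addr0//; first exact: an_atM.
by apply: an_at_sum => k; apply: an_atM.
Qed.

Lemma lieR_commutator xi eta f g : an_at f g ->
  lieR xi (lieR eta f) g - lieR eta (lieR xi f) g = lieR (lie_bracket G xi eta) f g.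
Proof.
move=> /an_at_translate/(lieR_commutator1 xi eta).
have tr zeta (h : G -> R) : lieR zeta (fun y => h (g * y)%g) = fun y => lieR zeta h (g * y)%g.
  by apply/funext => y; rewrite lieR_translate.
by rewrite !tr mulg1.
Qed.

Section Basis.
Context (B : 'M[R]_n) (B_unit : B \in unitmx).

Definition lieR_word (w : seq 'I_n) f : G -> R :=
  foldr (fun i => lieR (row i B)) f w.

Lemma lieR_word_cat v w f : lieR_word (v ++ w) f = lieR_word v (lieR_word w f).
Proof. by rewrite /lieR_word foldr_cat. Qed.

Lemma an_at_lieR_word w f g : an_at f g -> an_at (lieR_word w f) g.
Proof. by move=> F; elim: w => //= i w; apply: an_at_lieR. Qed.

Lemma lieR_word_near w f h g : (\forall x \near g, f x = h x) ->
  \forall x \near g, lieR_word w f x = lieR_word w h x.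
Proof. by move=> F; elim: w => //= i w; apply: lieR_near. Qed.

Lemma lieR_wordD w f h g : (forall x, chart_dom g x -> an_at f x) ->
  (forall x, chart_dom g x -> an_at h x) -> forall x, chart_dom g x ->
  lieR_word w (fun y => f y + h y) x = lieR_word w f x + lieR_word w h x.
Proof.
move=> F H; elim: w => [//|i w IH] x gx /=.
rewrite -lieRD; try by apply: an_at_lieR_word; auto.
apply: lieR_eq; have := open_nbhs_nbhs (conj (chart_dom_open g) gx).
by apply: filterS => y; apply: IH.
Qed.

(** By [lieR_gradient] the derivative is linear in the vector, so the bracket may be expanded in the
    basis with [invmx B]. *)
Lemma lieR_relation i j f g : an_at f g ->
  lieR_word [:: i; j] f g - lieR_word [:: j; i] f g =
  \sum_k struct_const G B i j k * lieR_word [:: k] f g.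
Proof.
move=> F; rewrite /= lieR_commutator//; have [a aE] := lieR_gradient F.
rewrite aE; under [RHS]eq_bigr do rewrite aE mulr_sumr.
rewrite exchange_big /=; apply: eq_bigr => l _.
under eq_bigr do rewrite mulrA; rewrite -mulr_suml; congr (_ * _).
rewrite -[LHS](congr1 (fun M : 'rV[R]_n => M ord0 l) (mulmxKV B_unit _)).
by rewrite mxE; apply: eq_bigr => k _; rewrite /struct_const [row k B _ _]mxE.
Qed.

(* Vanishing to order k at the unit, tested with the fields X_i. *)
Definition vanishing (k : nat) f : Prop :=
  forall w : seq 'I_n, (size w < k)%N -> lieR_word w f e = 0.

(** Analyticity on the whole chart domain rather than at the unit alone: sum and product rules must
    hold on an open set before further derivatives are applied. *)
Definition analytic1 f : Prop := forall x, chart_dom e x -> an_at f x.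

Lemma analytic1M f h : analytic1 f -> analytic1 h -> analytic1 (fun x => f x * h x).
Proof. by move=> F H x ex; apply: an_atM; auto. Qed.

Lemma analytic1_lieR xi f : analytic1 f -> analytic1 (lieR xi f).
Proof. by move=> F x ex; apply: an_at_lieR; auto. Qed.

Lemma near_analytic1 (P : G -> Prop) : (forall x, chart_dom e x -> P x) ->
  \forall x \near e, P x.
Proof. by move=> H; apply: filterS (near_chart_dom e). Qed.

Lemma lieR_word_eq1 w f h : (forall x, chart_dom e x -> f x = h x) ->
  lieR_word w f e = lieR_word w h e.
Proof. by move=> /near_analytic1 /(lieR_word_near w)/nbhs_singleton. Qed.

Lemma lieR_word_rcons w i f : lieR_word (rcons w i) f = lieR_word w (lieR (row i B) f).
Proof. by rewrite -cats1 lieR_word_cat. Qed.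

Lemma lieR_wordM1 w i f h : analytic1 f -> analytic1 h ->
  lieR_word (rcons w i) (fun x => f x * h x) e =
  lieR_word w (fun x => lieR (row i B) f x * h x) e +
  lieR_word w (fun x => f x * lieR (row i B) h x) e.
Proof.
move=> F H; rewrite lieR_word_rcons.
have F' := analytic1_lieR (row i B) F; have H' := analytic1_lieR (row i B) H.
rewrite -(lieR_wordD w (analytic1M F' H) (analytic1M F H')); last exact: chart_dom_center.
by apply: lieR_word_eq1 => x ex; rewrite lieRM; auto.
Qed.

Lemma vanishing_lieR k i f : vanishing k.+1 f -> vanishing k (lieR (row i B) f).
Proof. by move=> V w wk; rewrite -lieR_word_rcons; apply: V; rewrite size_rcons. Qed.

Lemma vanishingM k f h : analytic1 f -> analytic1 h -> vanishing k f ->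
  vanishing k (fun x => h x * f x).
Proof.
move=> F H V w; elim/last_ind: w => [|w i IH] in k f h F H V * => wk.
  by have := V [::] wk; rewrite /= => ->; rewrite mulr0.
rewrite size_rcons in wk; case: k => [//|k] in V wk *.
rewrite lieR_wordM1// (IH k.+1)//; [|exact: analytic1_lieR|exact: ltnW].
rewrite (IH k)//; [by rewrite addr0|exact: analytic1_lieR|exact: vanishing_lieR].
Qed.

(** A derivative spent on [h] leaves fewer than [size w] for [f], so all of them act on [f]. *)
Lemma vanishing_top w f h : analytic1 f -> analytic1 h -> vanishing (size w) f ->
  lieR_word w (fun x => h x * f x) e = h e * lieR_word w f e.
Proof.
elim/last_ind: w => [//|w i IH] in f h *; rewrite size_rcons => F H V.
rewrite lieR_wordM1// (vanishingM (k := (size w).+1))//; last exact: analytic1_lieR.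
rewrite add0r IH//; [by rewrite lieR_word_rcons|exact: analytic1_lieR|].
exact: vanishing_lieR.
Qed.

(* The coordinates dual to the frame X_i at the unit. *)
Definition frame_coord (b : 'I_n) : G -> R :=
  fun x => \sum_l invmx B l b * local_coord l x.

Lemma frame_coord_an b : analytic1 (frame_coord b).
Proof.
by move=> x ex; apply: an_at_sum => l; apply: an_atZ; apply: local_coord_an.
Qed.

Lemma frame_coord1 b : frame_coord b e = 0.
Proof. by rewrite /frame_coord big1// => l _; rewrite local_coord1 mulr0. Qed.

Lemma lieR_frame_coord i b : lieR (row i B) (frame_coord b) e = (i == b)%:R.
Proof.
rewrite lieR_sum => [|l]; last exact: an_atZ.
transitivity ((B *m invmx B) i b); last by rewrite mulmxV// mxE.
rewrite mxE; apply: eq_bigr => l _.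
rewrite lieRZ// lieR_local_coord; last exact: chart_dom_center.
by rewrite lieR_coord mxE mulrC.
Qed.

Definition frame_prod (a : seq 'I_n) : G -> R := fun x => \prod_(b <- a) frame_coord b x.

Lemma frame_prod_an a : analytic1 (frame_prod a).
Proof.
move=> x ex; rewrite /frame_prod; elim: a => [|b a IH].
  by under eq_fun do rewrite big_nil; apply: an_at_cst.
under eq_fun do rewrite big_cons; apply: an_atM => //; exact: frame_coord_an.
Qed.

Lemma frame_prod_cons b a : frame_prod (b :: a) = fun x => frame_coord b x * frame_prod a x.
Proof. by apply/funext => x; rewrite /frame_prod big_cons. Qed.

Lemma vanishing_succ k y f : analytic1 y -> analytic1 f -> y e = 0 ->
  vanishing k f -> vanishing k.+1 (fun x => y x * f x).
Proof.
move=> Y F y0 V w; elim/last_ind: w => [|w i IH] in k f F V *.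
  by rewrite /= y0 mul0r.
rewrite size_rcons ltnS => wk; rewrite lieR_wordM1//.
rewrite (vanishingM (k := k))//; last exact: analytic1_lieR.
rewrite add0r; case: k => [//|k] in V wk *; apply: (IH k) => //.
  exact: analytic1_lieR.
exact: vanishing_lieR.
Qed.

(** At least [(size w).-1] letters must act on [f], and [y] needs at least one to be nonzero at the
    unit; so exactly one letter acts on [y]. *)
Lemma lieR_word_succ w y f : analytic1 y -> analytic1 f -> y e = 0 ->
  vanishing (size w).-1 f ->
  lieR_word w (fun x => y x * f x) e =
  \sum_(j < size w) lieR (row (tnth (in_tuple w) j) B) y e *
    lieR_word (take j w ++ drop j.+1 w) f e.
Proof.
move=> Y F y0; elim/last_ind: w => [|w i IH] in f F *.
  by rewrite big_ord0 /= y0 mul0r.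
move=> V; rewrite size_rcons /= in V; rewrite lieR_wordM1//= vanishing_top//; last first.
  exact: analytic1_lieR.
rewrite IH; last 2 first.
- exact: analytic1_lieR.
- case: (w) V => [|i' w'] V; first by move=> [].
  exact: vanishing_lieR.
have sz : size (rcons w i) = (size w).+1 by rewrite size_rcons.
pose g j := lieR (row (nth i (rcons w i) j) B) y e *
    lieR_word (take j (rcons w i) ++ drop j.+1 (rcons w i)) f e.
transitivity (\sum_(j < (size w).+1) g j); last first.
  rewrite -sz; apply: eq_bigr => j _; rewrite /g.
  by rewrite (tnth_nth i).
rewrite big_ord_recr /= addrC; congr (_ + _); last first.
  apply: eq_bigr => j _; rewrite /g (tnth_nth i) /= nth_rcons ltn_ord.
  have -> : take j (rcons w i) = take j w by rewrite -cats1 takel_cat// ltnW.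
  by rewrite drop_rcons ?ltn_ord// -rcons_cat lieR_word_rcons.
rewrite /g nth_rcons ltnn eqxx drop_oversize ?size_rcons// cats0.
by rewrite -cats1 take_size_cat.
Qed.

Lemma frame_prod_vanishing a : vanishing (size a) (frame_prod a).
Proof.
elim: a => [//|b a IH]; rewrite frame_prod_cons /=.
apply: vanishing_succ => //; [exact: frame_coord_an|exact: frame_prod_an|].
exact: frame_coord1.
Qed.

(** By [lieR_word_succ] each coordinate is hit by exactly one derivative, so the value counts the
    bijections that match the letters of [w] with those of [a]. *)
Lemma lieR_word_frame w a : size w = size a ->
  lieR_word w (frame_prod a) e =
  (perm_eq w a)%:R * (\prod_i (count_mem i a)`!)%:R.
Proof.
elim: a => [|b a IH] in w *.
  move=> /size0nil ->; rewrite /frame_prod /= big_nil big1 ?mulr1//.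
move=> sw; rewrite frame_prod_cons lieR_word_succ; first last.
- by rewrite sw; apply: frame_prod_vanishing.
- exact: frame_coord1.
- exact: frame_prod_an.
- exact: frame_coord_an.
have cE : (\prod_i (count_mem i (b :: a))`!)%N = ((count_mem b a).+1 * \prod_i (count_mem i a)`!)%N.
  rewrite (bigD1 b)//= [in RHS](bigD1 b)//= eqxx add1n factS mulnA; congr (_ * _)%N.
  by apply: eq_bigr => i ib; rewrite eq_sym (negPf ib).
have pw (j : 'I_(size w)) : perm_eq w (tnth (in_tuple w) j :: (take j w ++ drop j.+1 w)).
  rewrite (tnth_nth b) /= -{1}(cat_take_drop j w) (drop_nth b)//.
  by rewrite perm_sym -cat1s perm_catCA.
have pE (j : 'I_(size w)) : tnth (in_tuple w) j = b ->
    perm_eq (take j w ++ drop j.+1 w) a = perm_eq w (b :: a).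
  by move=> jb; rewrite (permPl (pw j)) jb perm_cons.
rewrite (eq_bigr (fun j : 'I_(size w) => (tnth (in_tuple w) j == b)%:R *
    ((perm_eq w (b :: a))%:R * (\prod_i (count_mem i a)`!)%:R))); last first.
  move=> j _; rewrite lieR_frame_coord; case: eqP => [jb|_]; last by rewrite !mul0r.
  rewrite IH ?pE// ?mul1r//; apply: succn_inj.
  by rewrite -[LHS](perm_size (pw j)) sw.
rewrite -mulr_suml -natr_sum cE natrM.
have -> : (\sum_(j < size w) (tnth (in_tuple w) j == b))%N = count_mem b w.
  rewrite -sum1_count [RHS](big_nth b) big_mkord [RHS]big_mkcond/=.
  by apply: eq_bigr => j _; rewrite (tnth_nth b); case: eqP.
have [/seq.permP h|_] := boolP (perm_eq w (b :: a)); last by rewrite !mul0r mulr0.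
by rewrite !mul1r h /= eqxx add1n.
Qed.
End Basis.
End LieGerms.

(** * Monomials and the symmetric algebra *)

Section Monomials.
Context {n : nat}.
Implicit Types (m : cmonom 'I_n) (w : seq 'I_n) (i : 'I_n).

Definition content w : cmonom 'I_n := foldr (fun i m => mmul (ucm i) m) mone w.

Lemma content_count w i : content w i = count_mem i w.
Proof. by elim: w => [|j w IH] /=; rewrite ?cm1// cmM cmU IH. Qed.

Lemma count_mword m i : count_mem i (mword m) = m i.
Proof.
rewrite /mword count_flatten -map_comp sumnE big_map.
rewrite (eq_bigr (fun j => (j == i) * m j)%N); last by move=> j _; rewrite /= count_nseq.
by rewrite big_enum/= (bigD1 i)//= eqxx mul1n big1 ?addn0// => j /negPf ->.
Qed.

Lemma mwordK m : content (mword m) = m.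
Proof. by apply/eqP/cmP => i; rewrite content_count count_mword. Qed.

Lemma perm_contentP v w : perm_eq v w <-> content v = content w.
Proof.
split=> [/seq.permP vw|vw].
  by apply/eqP/cmP => i; rewrite !content_count vw.
apply/allP => i _ /=; apply/eqP.
by rewrite -!content_count vw.
Qed.

Lemma mdeg_content w : mdeg (content w) = size w.
Proof. by elim: w => [|i w IH] /=; rewrite ?mdeg1// mdegM mdegU IH. Qed.

Lemma size_mword m : size (mword m) = mdeg m.
Proof. by rewrite -mdeg_content mwordK. Qed.

Lemma mul_ucmI i m m' : mmul (ucm i) m = mmul (ucm i) m' -> m = m'.
Proof.
move=> /eqP/cmP h; apply/eqP/cmP => j; have := h j; rewrite !cmM; exact: addnI.
Qed.

Lemma mul_divcm i m : (0 < m i)%N -> mmul (ucm i) (divcm m (ucm i)) = m.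
Proof.
move=> mi; apply/eqP/cmP => j; rewrite cmM divcmE cmU.
by case: eqP => [<-|_]; rewrite ?subn0// subnKC.
Qed.

(** The number of permutations of the positions that fix the word. *)
Definition wfact w : nat := \prod_i (count_mem i w)`!.

Lemma wfact_perm v w : perm_eq v w -> wfact v = wfact w.
Proof. by move=> /seq.permP h; apply: eq_bigr => i _; rewrite h. Qed.

Lemma wfact_cons i w : wfact (i :: w) = ((count_mem i w).+1 * wfact w)%N.
Proof.
rewrite /wfact (bigD1 i)//= [in RHS](bigD1 i)//= eqxx add1n factS mulnA.
by congr (_ * _)%N; apply: eq_bigr => j; rewrite eq_sym => /negPf ->.
Qed.

Lemma wfact_gt0 w : (0 < wfact w)%N.
Proof. by apply: prodn_gt0 => i; apply: fact_gt0. Qed.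

Lemma sum_tupleS (V : zmodType) k (F : seq 'I_n -> V) :
  \sum_(u : k.+1.-tuple 'I_n) F u = \sum_i \sum_(u : k.-tuple 'I_n) F (i :: u).
Proof.
rewrite pair_bigA/=.
rewrite (reindex (fun p : 'I_n * k.-tuple 'I_n => [tuple of p.1 :: p.2]))//=.
exists (fun u : k.+1.-tuple 'I_n => (thead u, [tuple of behead u])).
  by move=> [i u] _ /=; rewrite theadE; congr (_, _); apply: val_inj.
by move=> u _; apply: val_inj; rewrite /= [in RHS](tuple_eta u).
Qed.

Lemma sum_tuple0 (V : zmodType) (F : seq 'I_n -> V) :
  \sum_(u : 0.-tuple 'I_n) F u = F [::].
Proof.
rewrite (bigD1 [tuple])//= big1 ?addr0// => u /eqP[]; exact: tuple0.
Qed.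

Definition permt k (t : k.-tuple 'I_n) (s : 'S_k) : seq 'I_n :=
  [seq tnth t (s j) | j <- enum 'I_k].

Definition removet k (t : k.+1.-tuple 'I_n) (l : 'I_k.+1) : k.-tuple 'I_n :=
  [tuple tnth t (lift l j) | j < k].

Lemma permt_lift k (t : k.+1.-tuple 'I_n) l (s : 'S_k) :
  permt t (lift_perm ord0 l s) = tnth t l :: permt (removet t l) s.
Proof.
rewrite /permt enum_ordSl /= lift_perm_id -map_comp; congr (_ :: _).
by apply: eq_map => j /=; rewrite lift_perm_lift tnth_mktuple.
Qed.

Lemma sum_permS (V : zmodType) k (t : k.+1.-tuple 'I_n) (F : seq 'I_n -> V) :
  \sum_(s : 'S_k.+1) F (permt t s) =
  \sum_l \sum_(s : 'S_k) F (tnth t l :: permt (removet t l) s).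
Proof.
rewrite pair_bigA/= (reindex (fun p : 'I_k.+1 * 'S_k => lift_perm ord0 p.1 p.2))/=.
  by apply: eq_bigr => p _; rewrite permt_lift.
apply: onW_bij; apply: inj_card_bij; last first.
  by rewrite card_prod card_ord !card_Sn factS.
move=> [l s] [l' s'] /= e.
have el : l = l' by rewrite -(lift_perm_id ord0 l s) e lift_perm_id.
rewrite -{}el in e *; congr (_, _); apply/permP => j.
by apply: (@lift_inj _ l); rewrite -!(lift_perm_lift ord0) e.
Qed.

Lemma perm_removet k (t : k.+1.-tuple 'I_n) l :
  perm_eq t (tnth t l :: removet t l).
Proof.
have cE (r : seq 'I_n) b : count_mem b r = (\sum_(x <- r) (x == b))%N.
  by rewrite -sum1_count big_mkcond/=; apply: eq_bigr => x _; case: eqP.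
apply/seq.permP => a; suff H b : count_mem b t = count_mem b (tnth t l :: removet t l).
  have /seq.permP : perm_eq t (tnth t l :: removet t l) by apply/allP => b _ /=; rewrite H.
  by apply.
rewrite !cE big_cons !big_tuple (bigD1_ord l)//=; congr (_ + _)%N.
by apply: eq_bigr => j _; rewrite tnth_mktuple.
Qed.

(** Orbit counting: every rearrangement of [t] arises from as many permutations as fix the word. The
    induction runs over the letter sent to the first place. *)
Lemma sum_permt (V : zmodType) k (t : k.-tuple 'I_n) (F : seq 'I_n -> V) :
  \sum_(s : 'S_k) F (permt t s) =
  \sum_(u : k.-tuple 'I_n | perm_eq u t) F u *+ wfact t.
Proof.
elim: k t F => [|k IH] t F.
  rewrite (tuple0 t) [RHS]big_mkcond.
  have /= -> := sum_tuple0 (fun u => if perm_eq u [::] then F u *+ wfact [::] else 0).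
  have -> : wfact [::] = 1%N by rewrite /wfact big1.
  rewrite mulr1n (bigD1 1%g)//= big1 ?addr0; last first.
    by move=> s /eqP[]; apply/permP => -[].
  by rewrite /permt; congr F; apply: size0nil; rewrite size_map size_enum_ord.
rewrite sum_permS [RHS]big_mkcond.
have /= -> := sum_tupleS k (fun u => if perm_eq u t then F u *+ wfact t else 0).
pose H b := \sum_(u : k.-tuple 'I_n | perm_eq (b :: u) t) F (b :: u).
have cnt b : count_mem b t = (\sum_(l < k.+1) (tnth t l == b))%N.
  rewrite -sum1_count big_mkcond/= big_tuple.
  by apply: eq_bigr => l _; case: eqP.
transitivity (\sum_(l < k.+1) \sum_b (if tnth t l == b then
    H b *+ wfact (removet t l) else 0)).
  apply: eq_bigr => l _; rewrite -big_mkcond/= (big_pred1 (tnth t l)); last by move=> b; rewrite /= eq_sym.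
  rewrite (IH _ (fun u => F (tnth t l :: u))) /H -sumrMnl.
  by apply: eq_bigl => u; rewrite (permPr (perm_removet t l)) perm_cons.
rewrite exchange_big/=; apply: eq_bigr => b _.
rewrite -big_mkcond/= -[RHS]big_mkcond/= sumrMnl -/(H b).
have [tb|tb] := boolP (b \in (t : seq _)); last first.
  rewrite big1 => [|l /eqP lb]; last by rewrite -lb mem_tnth in tb.
  rewrite /H big_pred0 ?mul0rn// => u; apply/negP => /perm_mem/(_ b).
  by rewrite (negPf tb) mem_head.
have [l0 bl0] := tnthP _ _ tb.
have W l : tnth t l = b -> (wfact t = (count_mem b t) * wfact (removet t l))%N.
  move=> lb; have h := perm_removet t l; rewrite lb in h.
  by rewrite (wfact_perm h) wfact_cons (seq.permP h) /= eqxx.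
have bt0 : (0 < count_mem b t)%N by rewrite -has_count has_pred1.
rewrite (W l0)// mulnC mulrnA cnt -sumrMnr [RHS]big_mkcond/= [LHS]big_mkcond/=.
apply: eq_bigr => l _; have [lb|_] := eqVneq (tnth t l) b; last by rewrite mulr0n.
rewrite mulr1n; congr (_ *+ _); apply/eqP; rewrite -(eqn_pmul2l bt0).
by rewrite -!W.
Qed.
End Monomials.

(* Locked, because the conversion test explodes on finitely supported
   functions; the same holds for the other locked definitions below. *)
HB.lock Definition mk (K : choiceType) (V : zmodType) (k : K) (v : V) : malg K V :=
  mkmalgU k v.

HB.lock Definition cf (K : choiceType) (V : zmodType) (k : K) (P : malg K V) : V :=
  mcoeff k P.

Section MonalgSums.
Context {K : choiceType} {V : zmodType}.
Implicit Types (P Q : malg K V) (k : K).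

Lemma cfE k P : mcoeff k P = cf k P.
Proof. by rewrite cf.unlock. Qed.

Lemma mkE k (v : V) : mkmalgU k v = mk k v.
Proof. by rewrite mk.unlock. Qed.

Lemma cf_ext P Q : (forall k, cf k P = cf k Q) -> P = Q.
Proof. by move=> PQ; apply/malgP => k; rewrite !cfE PQ. Qed.

Lemma cfD k P Q : cf k (P + Q) = cf k P + cf k Q.
Proof. by rewrite -!cfE mcoeffD. Qed.

Lemma cf0 k : cf k (0 : malg K V) = 0.
Proof. by rewrite -cfE mcoeff0. Qed.

Lemma cfN k P : cf k (- P) = - cf k P.
Proof. by rewrite -!cfE mcoeffN. Qed.

Lemma cf_sum k (I : Type) (r : seq I) (p : pred I) (F : I -> malg K V) :
  cf k (\sum_(i <- r | p i) F i) = \sum_(i <- r | p i) cf k (F i).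
Proof. by rewrite -cfE raddf_sum; apply: eq_bigr => i _; rewrite -cfE. Qed.

Lemma cf_outdom k P : k \notin msupp P -> cf k P = 0.
Proof. by move=> kP; rewrite -cfE mcoeff_outdom. Qed.

Lemma cf_neq0 k P : (cf k P != 0) = (k \in msupp P).
Proof. by rewrite -cfE mcoeff_neq0. Qed.

Lemma cf_mk k (v : V) k' : cf k' (mk k v) = v *+ (k == k').
Proof. by rewrite -cfE -mkE mcoeffU. Qed.

Lemma cf_mkk k (v : V) : cf k (mk k v) = v.
Proof. by rewrite cf_mk eqxx mulr1n. Qed.

Lemma mk_D k (v v' : V) : mk k (v + v') = mk k v + mk k v'.
Proof. by rewrite -!mkE monalgUD. Qed.

Lemma mk_0 k : mk k 0 = 0 :> malg K V.
Proof. by rewrite -mkE monalgU0. Qed.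

(** Terms vanish off the support, so any duplicate-free list containing it will do. This makes sums
    over the supports of different elements comparable. *)
Lemma big_msuppw (W : zmodType) P (d : seq K) (F : K -> V -> W) : uniq d ->
  (forall k, k \in msupp P -> k \in d) -> (forall k, F k 0 = 0) ->
  \sum_(m <- msupp P) F m (cf m P) = \sum_(m <- d) F m (cf m P).
Proof.
move=> ud sub F0; rewrite [RHS](bigID (mem (msupp P)))/= [X in _ = _ + X]big1 => [|k kP].
  rewrite addr0 -[in RHS]big_filter; apply: perm_big; apply: uniq_perm => //.
    exact: filter_uniq.
  move=> k; rewrite mem_filter; case: (boolP (k \in msupp P)) => //= kP.
  by rewrite sub.
by rewrite cf_outdom// F0.
Qed.

Definition msupp2 P Q : seq K := undup (msupp P ++ msupp Q).

Lemma msupp2_uniq P Q : uniq (msupp2 P Q). Proof. exact: undup_uniq. Qed.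

Lemma msupp2l P Q k : k \in msupp P -> k \in msupp2 P Q.
Proof. by move=> h; rewrite mem_undup mem_cat h. Qed.

Lemma msupp2r P Q k : k \in msupp Q -> k \in msupp2 P Q.
Proof. by move=> h; rewrite mem_undup mem_cat h orbT. Qed.

Lemma msupp2D P Q k : k \in msupp (P + Q) -> k \in msupp2 P Q.
Proof.
rewrite -cf_neq0 cfD mem_undup mem_cat -!cf_neq0.
by apply: contraNT; rewrite negb_or !negbK => /andP[/eqP -> /eqP ->]; rewrite addr0.
Qed.

Lemma big_msuppD (W : zmodType) P Q (F : K -> V -> W) : (forall k, F k 0 = 0) ->
  (forall k, F k (cf k P + cf k Q) = F k (cf k P) + F k (cf k Q)) ->
  \sum_(m <- msupp (P + Q)) F m (cf m (P + Q)) =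
  \sum_(m <- msupp P) F m (cf m P) + \sum_(m <- msupp Q) F m (cf m Q).
Proof.
move=> F0 FD; rewrite (big_msuppw (msupp2_uniq P Q) (@msupp2D P Q) F0).
rewrite (big_msuppw (msupp2_uniq P Q) (@msupp2l P Q) F0).
rewrite (big_msuppw (msupp2_uniq P Q) (@msupp2r P Q) F0) -big_split/=.
by apply: eq_bigr => k _; rewrite cfD FD.
Qed.

Lemma malg_mkE P : P = \sum_(m <- msupp P) mk m (cf m P).
Proof. by rewrite {1}[P]monalgE; apply: eq_bigr => m _; rewrite cfE mkE. Qed.

Lemma big_msuppU (W : zmodType) k v (F : K -> V -> W) : (forall k, F k 0 = 0) ->
  \sum_(m <- msupp (mk k v)) F m (cf m (mk k v)) = F k v.
Proof.
move=> F0; rewrite (big_msuppw (d := [:: k]))//; first by rewrite big_seq1 cf_mkk.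
by move=> m; rewrite -mkE => /(fsubsetP msuppU_le); rewrite finmap.inE mem_seq1.
Qed.
End MonalgSums.

Section DegreeBounds.
Context {V : zmodType} {n : nat}.
Implicit Types v : malg (cmonom 'I_n) V.

(** The bound is strict, so that it fits sums over [k < N] and [N = 0] forces [v = 0]. *)
Definition degbound (N : nat) v : Prop := forall m, (N <= mdeg m)%N -> cf m v = 0.

Lemma degbound_msize v : degbound (@mmeasure _ _ mdeg v) v.
Proof. by move=> m /mmeasure_mnm_ge/cf_outdom. Qed.

Lemma degboundW N N' v : (N <= N')%N -> degbound N v -> degbound N' v.
Proof. by move=> le H m Nm; apply: H; apply: leq_trans Nm. Qed.

Lemma degboundD N v v' : degbound N v -> degbound N v' -> degbound N (v + v').
Proof. by move=> H K m Nm; rewrite cfD H// K// addr0. Qed.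

Lemma degbound_eq0 v : degbound 0 v -> v = 0.
Proof. by move=> H; apply: cf_ext => m; rewrite H// cf0. Qed.

Lemma degbound_sum N (I : Type) (r : seq I) (F : I -> malg (cmonom 'I_n) V) :
  (forall i, degbound N (F i)) -> degbound N (\sum_(i <- r) F i).
Proof.
move=> H; elim: r => [|i r IH]; first by rewrite big_nil => m _; rewrite cf0.
by rewrite big_cons; apply: degboundD.
Qed.
End DegreeBounds.

HB.lock Definition deriv (C : comNzRingType) (n : nat) (a : 'I_n)
    (v : malg (cmonom 'I_n) C) : malg (cmonom 'I_n) C :=
  \sum_(m <- msupp v) (cf m v * (m a)%:R) *: mk (divcm m (ucm a)) 1.

Section SymmetricAlgebra.
Context {C : comNzRingType} {n : nat}.
Local Notation SymC := (malg (cmonom 'I_n) C).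
Implicit Types (v : SymC) (m k : cmonom 'I_n) (w : seq 'I_n) (a : 'I_n).

Definition mono m : SymC := mk m 1.

Lemma cfZ k (c : C) v : cf k (c *: v) = c * cf k v.
Proof. by rewrite -!cfE mcoeffZ. Qed.

Lemma monoM m m' : mono m * mono m' = mono (mmul m m').
Proof. by rewrite /mono -!mkE malgM_def fgmulUU mulr1. Qed.

Lemma malg_monoE v : v = \sum_(m <- msupp v) cf m v *: mono m.
Proof.
rewrite {1}[v]malg_mkE; apply: eq_bigr => m _; apply: cf_ext => k.
by rewrite cfZ !cf_mk mulr_natr.
Qed.

Lemma cf_mono m k : cf k (mono m) = (m == k)%:R.
Proof. by rewrite /mono cf_mk. Qed.

Lemma cf_ucmM a v m : cf (mmul (ucm a) m) (mono (ucm a) * v) = cf m v.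
Proof.
rewrite [in LHS](malg_monoE v) [in RHS](malg_monoE v) mulr_sumr !cf_sum.
apply: eq_bigr => k _; rewrite -scalerAr monoM !cfZ !cf_mono.
congr (_ * _%:R); congr nat_of_bool; apply/eqP/eqP => [/mul_ucmI//|->//].
Qed.

Lemma cf_ucmM0 a v m : m a = 0%N -> cf m (mono (ucm a) * v) = 0.
Proof.
move=> ma; rewrite (malg_monoE v) mulr_sumr cf_sum big1// => k _.
rewrite -scalerAr monoM cfZ cf_mono; case: eqP => [e|_]; last by rewrite mulr0.
by move: ma; rewrite -e cmM cmU eqxx.
Qed.

Lemma cf_deriv a v m :
  cf m (deriv a v) = (m a).+1%:R * cf (mmul (ucm a) m) v.
Proof.
rewrite deriv.unlock cf_sum.
pose F (k : cmonom 'I_n) (c : C) : C := c * (k a)%:R * (divcm k (ucm a) == m)%:R.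
rewrite (eq_bigr (fun k => F k (cf k v))); last by move=> k _; rewrite cfZ cf_mk.
rewrite (big_msuppw (d := mmul (ucm a) m :: rem (mmul (ucm a) m) (msupp v))); first last.
- by move=> k; rewrite /F !mul0r.
- move=> k kv; rewrite in_cons; case: eqP => //= /eqP kn.
  by rewrite mem_rem_uniq ?fset_uniq// /predD1 unfold_in /= kn.
- by rewrite /= rem_uniq// andbT mem_rem_uniq ?fset_uniq// /predD1 unfold_in /= eqxx.
rewrite big_cons big1_seq => [|k /andP[_]].
  rewrite addr0 /F (_ : divcm _ _ = m) ?eqxx ?mulr1; first by rewrite cmM cmU eqxx add1n mulrC.
  by apply/eqP/cmP => i; rewrite divcmE cmM addKn.
rewrite mem_rem_uniq ?fset_uniq// /predD1 unfold_in /= => /andP[kn _]; rewrite /F.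
have [->|ka] := posnP (k a); first by rewrite mulr0 mul0r.
case: eqP => [e|_]; last by rewrite mulr0.
by rewrite -e mul_divcm ?eqxx in kn.
Qed.

Lemma derivD a v v' : deriv a (v + v') = deriv a v + deriv a v'.
Proof. by apply: cf_ext => m; rewrite cfD !cf_deriv cfD mulrDr. Qed.

Lemma derivZ a c v : deriv a (c *: v) = c *: deriv a v.
Proof. by apply: cf_ext => m; rewrite cfZ !cf_deriv cfZ mulrCA. Qed.

Lemma deriv0 a : deriv a (0 : SymC) = 0.
Proof. by apply: cf_ext => m; rewrite cf_deriv !cf0 mulr0. Qed.

Lemma derivC a b v : deriv a (deriv b v) = deriv b (deriv a v).
Proof.
apply: cf_ext => m; rewrite !cf_deriv !cmM !cmU.
have -> : mmul (ucm b) (mmul (ucm a) m) = mmul (ucm a) (mmul (ucm b) m).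
  by apply/eqP/cmP => i; rewrite !cmM addnCA.
have [->//|ab] := eqVneq a b.
by rewrite !add0n mulrCA.
Qed.

Lemma deriv_mul a b v :
  deriv a (mono (ucm b) * v) = (a == b)%:R *: v + mono (ucm b) * deriv a v.
Proof.
apply: cf_ext => m; rewrite cfD cfZ cf_deriv.
have [mb|mb] := posnP (m b).
  rewrite [X in _ + X]cf_ucmM0// addr0.
  have [->|ab] := eqVneq a b; first by rewrite cf_ucmM mb.
  by rewrite cf_ucmM0 ?mulr0 ?mul0r// cmM cmU mb (negPf ab).
set m1 := divcm m (ucm b); have mE : m = mmul (ucm b) m1 by rewrite mul_divcm.
have E : mmul (ucm a) (mmul (ucm b) m1) = mmul (ucm b) (mmul (ucm a) m1).
  by apply/eqP/cmP => i; rewrite !cmM addnCA.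
rewrite mE E !cf_ucmM cf_deriv cmM cmU.
have [->|ab] := eqVneq a b; last by rewrite mul0r !add0r.
by rewrite mul1r add1n [_.+2%:R]mulrSr mulrDl mul1r addrC.
Qed.

(* v is read as a polynomial; this is its iterated derivative along w at 0. *)
Definition taylor w v : C := (wfact w)%:R * cf (content w) v.

Lemma taylor_cons a w v : taylor (a :: w) v = taylor w (deriv a v).
Proof.
rewrite /taylor cf_deriv wfact_cons natrM content_count.
by rewrite [LHS]mulrAC -mulrA mulrCA [in RHS]mulrCA mulrC -!mulrA mulrCA.
Qed.

Lemma degbound_deriv N a v : degbound N.+1 v -> degbound N (deriv a v).
Proof.
by move=> H m Nm; rewrite cf_deriv H ?mulr0// mdegM mdegU.
Qed.

Lemma degboundZ N c v : degbound N v -> degbound N (c *: v).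
Proof. by move=> V m Nm; rewrite cfZ V// mulr0. Qed.

Lemma degbound_mono m N : (mdeg m < N)%N -> degbound N (mono m).
Proof.
move=> mN k Nk; rewrite cf_mono; case: eqP => // mk.
by rewrite mk ltnNge Nk in mN.
Qed.

Lemma taylor_degbound N w v : degbound N v -> (N <= size w)%N -> taylor w v = 0.
Proof. by move=> H Nw; rewrite /taylor H ?mulr0// mdeg_content. Qed.
End SymmetricAlgebra.

Lemma sym_wordE (R : realType) (n : nat) (w : seq 'I_n) :
  sym_word R w = mono (content w).
Proof.
rewrite /sym_word; elim: w => [|i w IH]; first by rewrite big_nil /mono -mkE.
by rewrite big_cons IH mkE; exact: monoM.
Qed.

Section TaylorLemmas.
Context {C : comNzRingType} {n : nat}.
Local Notation SymC := (malg (cmonom 'I_n) C).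

Lemma taylorD w (v v' : SymC) : taylor w (v + v') = taylor w v + taylor w v'.
Proof. by rewrite /taylor cfD mulrDr. Qed.

Lemma taylorZ w c (v : SymC) : taylor w (c *: v) = c * taylor w v.
Proof. by rewrite /taylor cfZ mulrCA. Qed.

Lemma taylor0 w : taylor w (0 : SymC) = 0.
Proof. by rewrite /taylor cf0 mulr0. Qed.

Lemma deriv_sum a (I : Type) (r : seq I) (F : I -> SymC) :
  deriv a (\sum_(i <- r) F i) = \sum_(i <- r) deriv a (F i).
Proof.
elim: r => [|i r IH]; first by rewrite !big_nil deriv0.
by rewrite !big_cons derivD IH.
Qed.

(** A family [u] encodes the tensor with component [u b] along the basis vector [b]; [mu] multiplies
    its two factors. *)
Definition mu (u : 'I_n -> SymC) : SymC := \sum_b mono (ucm b) * u b.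

Lemma deriv_mu a u : deriv a (mu u) = u a + mu (fun b => deriv a (u b)).
Proof.
rewrite /mu deriv_sum; under eq_bigr do rewrite deriv_mul.
rewrite big_split/=; congr (_ + _).
rewrite (bigD1 a)//= eqxx scale1r big1 ?addr0// => b.
by rewrite eq_sym => /negPf ->; rewrite scale0r.
Qed.

Lemma taylor_nil_mu u : taylor [::] (mu u) = 0.
Proof.
rewrite /taylor /mu cf_sum big1 ?mulr0// => b _.
by rewrite cf_ucmM0// cm1.
Qed.

Context (cst : 'I_n -> 'I_n -> 'I_n -> C).

(* The coadjoint part of the commutator of a vector with a symmetric tensor:
   zeta (x) w goes to the sum over l of [w_l, zeta] (x) (w without w_l). *)
Definition adD (u : 'I_n -> SymC) : 'I_n -> SymC :=
  fun c => \sum_a \sum_b cst a b c *: deriv a (u b).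

Lemma adD_deriv a u : adD (fun b => deriv a (u b)) = fun b => deriv a (adD u b).
Proof.
apply/funext => c; rewrite /adD deriv_sum; apply: eq_bigr => i _.
by rewrite deriv_sum; apply: eq_bigr => j _; rewrite derivZ derivC.
Qed.

Lemma degbound_adD N u : (forall b, degbound N.+1 (u b)) ->
  forall b, degbound N (adD u b).
Proof.
move=> H b; apply: degbound_sum => i; apply: degbound_sum => j.
by apply: degboundZ; apply: degbound_deriv.
Qed.

Lemma degbound_iter_adD N k u : (forall b, degbound N (u b)) ->
  forall b, degbound (N - k) (iter k adD u b).
Proof.
move=> H; elim: k => [|k IH] b; first by rewrite subn0.
rewrite /= subnS; case E : (N - k)%N IH => [|M] IH; last exact: degbound_adD.
move=> m _; rewrite /adD cf_sum big1// => i _; rewrite cf_sum big1// => j _.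
by rewrite (degbound_eq0 (IH j)) deriv0 scaler0 cf0.
Qed.
End TaylorLemmas.

Lemma sum_shift (V : zmodType) N a (F : nat -> V) : (a <= N)%N ->
  (forall k, (k < a)%N -> F k = 0) ->
  \sum_(s < N) F s = \sum_(k < N - a) F (k + a)%N.
Proof.
move=> aN F0; rewrite -(big_mkord xpredT F) -(big_mkord xpredT (fun k => F (k + a)%N)).
rewrite (big_cat_nat (n := a))//= [X in X + _ = _]big_nat_cond [X in X + _ = _]big1 ?add0r.
  by rewrite -{1}[a]add0n big_addn.
by move=> k /andP[/andP[_ /F0]].
Qed.

Lemma sum_trunc (V : zmodType) N M (F : nat -> V) : (M <= N)%N ->
  (forall k, (M <= k)%N -> F k = 0) -> \sum_(s < N) F s = \sum_(k < M) F k.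
Proof.
move=> MN F0; rewrite -!(big_mkord xpredT F).
rewrite (big_cat_nat (n := M))//= [X in _ + X = _]big_nat_cond [X in _ + X = _]big1 ?addr0//.
by move=> k /andP[/andP[/F0]].
Qed.

(** * Left multiplication in the enveloping algebra *)

Section SymmetrizedProducts.
Context {C : numFieldType} {n : nat} {A : lalgType C}.
Hypothesis scaleAr : forall (c : C) (x y : A), x * (c *: y) = c *: (x * y).
Local Notation SymC := (malg (cmonom 'I_n) C).
Context (e : 'I_n -> A) (cst : 'I_n -> 'I_n -> 'I_n -> C) (J : A -> Prop).
Hypotheses (J0 : J 0) (JD : forall x y, J x -> J y -> J (x + y)).
Hypothesis JZ : forall c x, J x -> J (c *: x).
Hypothesis JMl : forall x y, J y -> J (x * y).
Hypothesis JMr : forall x y, J x -> J (x * y).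
Hypothesis Jrel : forall a b,
  J (e a * e b - e b * e a - \sum_c cst a b c *: e c).
Local Notation adD := (adD cst).

Lemma Jsum (I : Type) (r : seq I) (p : pred I) (F : I -> A) :
  (forall i, p i -> J (F i)) -> J (\sum_(i <- r | p i) F i).
Proof. by move=> H; elim/big_ind : _. Qed.

Lemma Jtrans y x z : J (x - y) -> J (y - z) -> J (x - z).
Proof. by move=> H1 H2; rewrite -(subrK y x) -addrA; apply: JD. Qed.

Definition eword (w : seq 'I_n) : A := \prod_(i <- w) e i.

(** The polarization of [v]: on a monomial of degree k it is the sum over all permutations of its
    word, that is, k! times the symmetrized product. *)
Definition symz (k : nat) (v : SymC) : A :=
  \sum_(u : k.-tuple 'I_n) taylor u v *: eword u.

Lemma symz0 v : symz 0 v = taylor [::] v *: 1.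
Proof.
by rewrite /symz (sum_tuple0 (fun u => taylor u v *: eword u)) /eword big_nil.
Qed.

Lemma symzS k v : symz k.+1 v = \sum_a e a * symz k (deriv a v).
Proof.
rewrite /symz (sum_tupleS k (fun u => taylor u v *: eword u)).
apply: eq_bigr => a _; rewrite mulr_sumr; apply: eq_bigr => u _.
by rewrite scaleAr taylor_cons /eword big_cons.
Qed.

Lemma symzD k v v' : symz k (v + v') = symz k v + symz k v'.
Proof. by rewrite /symz -big_split/=; apply: eq_bigr => u _; rewrite taylorD scalerDl. Qed.

Lemma symzZ k c v : symz k (c *: v) = c *: symz k v.
Proof. by rewrite /symz scaler_sumr; apply: eq_bigr => u _; rewrite taylorZ scalerA. Qed.

Lemma symz_0 k : symz k 0 = 0.
Proof. by rewrite /symz big1// => u _; rewrite taylor0 scale0r. Qed.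

Lemma symz_sum k (I : Type) (r : seq I) (F : I -> SymC) :
  symz k (\sum_(i <- r) F i) = \sum_(i <- r) symz k (F i).
Proof.
elim: r => [|i r IH]; first by rewrite !big_nil symz_0.
by rewrite !big_cons symzD IH.
Qed.

Lemma symz_degbound N k v : degbound N v -> (N <= k)%N -> symz k v = 0.
Proof.
move=> H Nk; rewrite /symz big1// => u _.
by rewrite (taylor_degbound H) ?scale0r// size_tuple.
Qed.

#[local] Opaque symz.

(* The vector in the first factor of u is inserted at position i of the
   symmetrized product of the second factor. *)
Fixpoint insz (i k : nat) (u : 'I_n -> SymC) : A :=
  match i, k with
  | 0%N, _ => \sum_b e b * symz k (u b)
  | i.+1, 0%N => 0
  | i.+1, k.+1 => \sum_a e a * insz i k (fun b => deriv a (u b))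
  end.

Lemma inszS i k u : insz i.+1 k.+1 u = \sum_a e a * insz i k (fun b => deriv a (u b)).
Proof. by []. Qed.

Lemma insz0 k u : insz 0 k u = \sum_b e b * symz k (u b).
Proof. by case: k. Qed.

#[local] Opaque insz.

(** By the Leibniz rule the vector of the first factor lands once in each of the [k.+1]
    positions. *)
Lemma symz_mu k u : symz k.+1 (mu u) = \sum_(i < k.+1) insz i k u.
Proof.
elim: k u => [|k IH] u; rewrite symzS big_ord_recl.
  rewrite big_ord0 addr0 insz0; apply: eq_bigr => a _.
  by rewrite deriv_mu symzD [symz 0 (mu _)]symz0 taylor_nil_mu scale0r addr0.
under eq_bigr do rewrite deriv_mu symzD mulrDr IH [X in _ + X]mulr_sumr.
rewrite big_split/=; congr (_ + _).
by rewrite exchange_big; apply: eq_bigr => i _; rewrite -inszS.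
Qed.

(** Moving the inserted vector one place to the left past a letter leaves their commutator modulo
    [J]; [adD] collects these commutators over all letters. *)
Lemma insz_succ i k u : (i <= k)%N ->
  J (insz i.+1 k.+1 u - (insz i k.+1 u + insz i k (adD u))).
Proof.
elim: i k u => [|i IH] k u ik.
  suff -> : insz 1 k.+1 u - (insz 0 k.+1 u + insz 0 k (adD u)) =
      \sum_a \sum_b (e a * e b - e b * e a - \sum_c cst a b c *: e c) *
        symz k (deriv a (u b)).
    by apply: Jsum => a _; apply: Jsum => b _; apply: JMr.
  have -> : insz 0 k (adD u) = \sum_a \sum_b (\sum_c cst a b c *: e c) * symz k (deriv a (u b)).
    rewrite insz0; under eq_bigr do rewrite symz_sum mulr_sumr.
    rewrite exchange_big/=; apply: eq_bigr => a _.
    under eq_bigr do rewrite symz_sum mulr_sumr.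
    rewrite exchange_big/=; apply: eq_bigr => b _.
    by rewrite mulr_suml; apply: eq_bigr => c _; rewrite symzZ scaleAr scalerAl.
  have -> : insz 0 k.+1 u = \sum_a \sum_b e b * e a * symz k (deriv a (u b)).
    rewrite insz0; under eq_bigr do rewrite symzS mulr_sumr.
    rewrite exchange_big/=; apply: eq_bigr => a _; apply: eq_bigr => b _.
    by rewrite mulrA.
  rewrite (inszS 0) opprD addrA -!sumrB; apply: eq_bigr => a _.
  rewrite insz0 mulr_sumr -!sumrB; apply: eq_bigr => b _.
  by rewrite mulrA !mulrBl.
case: k ik => [//|k] ik.
suff -> : insz i.+2 k.+2 u - (insz i.+1 k.+2 u + insz i.+1 k.+1 (adD u)) =
   \sum_a e a * (insz i.+1 k.+1 (fun b => deriv a (u b)) -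
     (insz i k.+1 (fun b => deriv a (u b)) + insz i k (adD (fun b => deriv a (u b))))).
  by apply: Jsum => a _; apply: JMl; apply: IH.
rewrite (inszS i.+1 k.+1 u) (inszS i k.+1 u) (inszS i k (adD u)).
rewrite opprD addrA -!sumrB; apply: eq_bigr => a _.
by rewrite adD_deriv opprD addrA !mulrDr !mulrN.
Qed.

(** [insz_succ] is iterated; Pascal's rule counts in how many ways [a] of the [i] transpositions
    produce a commutator. *)
Lemma insz_expand N i k u : (i <= k)%N -> (i < N)%N ->
  J (insz i k u - \sum_(a < N) 'C(i, a)%:R *: insz 0 (k - a) (iter a adD u)).
Proof.
elim: i k u => [|i IH] k u ik iN.
  case: N iN => // N _; rewrite big_ord_recl big1 => [|a _].
    by rewrite bin0 scale1r subn0 addr0 subrr.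
  by rewrite scale0r.
case: k ik => [//|k] ik.
apply: (Jtrans (insz_succ u (ik : (i <= k)%N))).
have -> : \sum_(a < N) 'C(i.+1, a)%:R *: insz 0 (k.+1 - a) (iter a adD u) =
    \sum_(a < N) 'C(i, a)%:R *: insz 0 (k.+1 - a) (iter a adD u) +
    \sum_(a < N) 'C(i, a)%:R *: insz 0 (k - a) (iter a adD (adD u)).
  case: N iN {IH} => [//|N]; rewrite ltnS => iN.
  rewrite big_ord_recl [X in _ = X + _]big_ord_recl [X in _ = _ + X]big_ord_recr/=.
  rewrite (bin_small iN) scale0r addr0 !bin0 -addrA -big_split/=; congr (_ + _).
  apply: eq_bigr => a _; rewrite binS natrD scalerDl; congr (_ + _).
  by rewrite -iterSr.
rewrite opprD addrACA; apply: JD; apply: IH => //; exact: ltnW.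
Qed.

Lemma sum_bin_diag k a : (\sum_(i < k) 'C(i, a))%N = 'C(k, a.+1).
Proof.
elim: k => [|k IH]; first by rewrite big_ord0.
by rewrite big_ord_recr /= IH binS.
Qed.

(** Summing these binomials over the positions is the hockey-stick identity [sum_bin_diag]. *)
Lemma symz_mu_expand N k u : (k < N)%N ->
  J (symz k.+1 (mu u) -
     \sum_(a < N) 'C(k.+1, a.+1)%:R *: insz 0 (k - a) (iter a adD u)).
Proof.
move=> kN; rewrite symz_mu.
have -> : \sum_(a < N) 'C(k.+1, a.+1)%:R *: insz 0 (k - a) (iter a adD u) =
    \sum_(i < k.+1) \sum_(a < N) 'C(i, a)%:R *: insz 0 (k - a) (iter a adD u).
  rewrite exchange_big/=; apply: eq_bigr => a _.
  by rewrite -scaler_suml -natr_sum sum_bin_diag.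
rewrite -sumrB; apply: Jsum => i _; apply: insz_expand; first by rewrite -ltnS.
by apply: leq_trans kN; rewrite ltn_ord.
Qed.

Definition quantz (N : nat) (z : C) (v : SymC) : A :=
  \sum_(k < N) (z ^+ k / k`!%:R) *: symz k v.

Lemma quantzW N N' z v : degbound N v -> (N <= N')%N -> quantz N' z v = quantz N z v.
Proof.
move=> H le; apply: (sum_trunc (F := fun k => (z ^+ k / k`!%:R) *: symz k v)) => // k Nk.
by rewrite (symz_degbound H Nk) scaler0.
Qed.

Lemma quantzD N z v v' : quantz N z (v + v') = quantz N z v + quantz N z v'.
Proof. by rewrite /quantz -big_split; apply: eq_bigr => k _; rewrite symzD scalerDr. Qed.

Lemma quantzZ N z c v : quantz N z (c *: v) = c *: quantz N z v.
Proof.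
rewrite /quantz scaler_sumr; apply: eq_bigr => k _.
by rewrite symzZ !scalerA mulrC.
Qed.

Lemma quantz0 N z : quantz N z 0 = 0.
Proof. by rewrite /quantz big1// => k _; rewrite symz_0 scaler0. Qed.

Lemma quantz_sum N z (I : Type) (r : seq I) (F : I -> SymC) :
  quantz N z (\sum_(i <- r) F i) = \sum_(i <- r) quantz N z (F i).
Proof.
elim: r => [|i r IH]; first by rewrite !big_nil quantz0.
by rewrite !big_cons quantzD IH.
Qed.

Definition leftz (N : nat) (z : C) (u : 'I_n -> SymC) : A :=
  \sum_b e b * quantz N z (u b).

Lemma leftzE N z u : leftz N z u = \sum_(k < N) (z ^+ k / k`!%:R) *: insz 0 k u.
Proof.
rewrite /leftz /quantz; under eq_bigr do rewrite mulr_sumr.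
rewrite exchange_big/=; apply: eq_bigr => k _; rewrite scaler_sumr.
by apply: eq_bigr => b _; rewrite scaleAr.
Qed.

(** In generating functions: quantization after [mu] is left multiplication after (exp(zD) - 1)/D,
    with D = [adD]. Indeed z^(k+1)/(k+1)! times the binomial splits into z^(a+1)/(a+1)! and
    z^(k-a)/(k-a)!. *)
Lemma quantz_mu N z u : (forall b, degbound N (u b)) ->
  J (quantz N.+1 z (mu u) -
     \sum_(a < N) (z * (z ^+ a / a.+1`!%:R)) *: leftz N z (iter a adD u)).
Proof.
move=> H.
have -> : quantz N.+1 z (mu u) = \sum_(k < N) (z ^+ k.+1 / k.+1`!%:R) *: symz k.+1 (mu u).
  by rewrite /quantz big_ord_recl symz0 taylor_nil_mu scale0r scaler0 add0r.
pose X k a := insz 0 (k - a) (iter a adD u).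
have -> : \sum_(a < N) (z * (z ^+ a / a.+1`!%:R)) *: leftz N z (iter a adD u) =
    \sum_(k < N) (z ^+ k.+1 / k.+1`!%:R) *: \sum_(a < N) 'C(k.+1, a.+1)%:R *: X k a.
  under [RHS]eq_bigr do rewrite scaler_sumr.
  rewrite exchange_big/=; apply: eq_bigr => a _; rewrite leftzE scaler_sumr.
  have aN : (a <= N)%N by rewrite ltnW.
  rewrite [RHS](sum_shift (F := fun k => (z ^+ k.+1 / k.+1`!%:R) *: ('C(k.+1, a.+1)%:R *: X k a)) aN); last first.
    by move=> k ka; rewrite bin_small ?scale0r ?scaler0.
  rewrite (sum_trunc (F := fun k => (z * (z ^+ a / a.+1`!%:R)) *: ((z ^+ k / k`!%:R) *: insz 0 k (iter a adD u))) (leq_subr a N)); last first.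
    move=> k Nk; rewrite insz0 big1 ?scaler0// => b _.
    by rewrite (symz_degbound (degbound_iter_adD (k:=a) cst H b))// mulr0.
  apply: eq_bigr => k _; rewrite /X addnK !scalerA; congr (_ *: _).
  rewrite -(addnS k a) exprD exprS.
  have := bin_fact (leq_addl k a.+1); rewrite addnK => /(congr1 (fun m => m%:R : C)).
  rewrite !natrM => bE; have F m : m`!%:R != 0 :> C by rewrite pnatr_eq0 -lt0n fact_gt0.
  rewrite -bE; field; rewrite !F /=.
  by rewrite nat1r !pnatr_eq0 -!lt0n bin_gt0 leq_addl.
rewrite -sumrB; apply: Jsum => k _; rewrite -scalerBr; apply: JZ.
exact: symz_mu_expand.
Qed.

Context (beta : nat -> C).
Hypothesis beta_rec : forall s,
  \sum_(j < s.+1) beta j / (s - j).+1`!%:R = (s == 0%N)%:R.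

Definition slot (b : 'I_n) (v : SymC) : 'I_n -> SymC := fun c => if c == b then v else 0.

(* D / (exp D - 1), up to scaling, inverts the passage from left
   multiplication to symmetrization; beta are its Taylor coefficients. *)
Definition gutt_left (N : nat) (z : C) (b : 'I_n) (v : SymC) : SymC :=
  \sum_(j < N) (beta j * z ^+ j) *: mu (iter j adD (slot b v)).

Lemma leftz_degbound0 N k z u : (forall b, degbound N (u b)) -> (N <= k)%N ->
  leftz N z (iter k adD u) = 0.
Proof.
move=> H Nk; rewrite /leftz big1// => b _.
have := degbound_iter_adD (k:=k) cst H b; rewrite (eqP (_ : N - k == 0)%N) ?subn_eq0//.
by move=> /degbound_eq0 ->; rewrite quantz0 mulr0.
Qed.

Lemma quantz_gutt_left N z b v : degbound N v ->
  J (quantz N.+1 z (gutt_left N z b v) - z *: (e b * quantz N z v)).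
Proof.
move=> H; have Hs c : degbound N (slot b v c).
  by rewrite /slot; case: eqP => // _ m _; rewrite cf0.
have Hi j c : degbound N (iter j adD (slot b v) c).
  exact: degboundW (leq_subr j N) (degbound_iter_adD (k:=j) cst Hs c).
pose L s := leftz N z (iter s adD (slot b v)).
have -> : z *: (e b * quantz N z v) = \sum_(s < N) (s == 0%N :> nat)%:R *: ((z * z ^+ s) *: L s).
  case: N H {Hs Hi} @L => [|N] H L.
    rewrite big_ord0 (degbound_eq0 H) quantz0 mulr0 scaler0//.
  rewrite big_ord_recl big1 ?addr0; last by move=> s _; rewrite /= scale0r.
  rewrite /= scale1r mulr1; congr (_ *: _); rewrite /L /= /leftz (bigD1 b)//= /slot eqxx.
  by rewrite big1 ?addr0// => c /negPf ->; rewrite quantz0 mulr0.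
pose Y j := \sum_(a < N) (z * (z ^+ a / a.+1`!%:R)) *: L (a + j)%N.
apply: (@Jtrans (\sum_(j < N) (beta j * z ^+ j) *: Y j)).
  rewrite /gutt_left quantz_sum -sumrB; apply: Jsum => j _.
  rewrite quantzZ -scalerBr; apply: JZ.
  have := quantz_mu z (Hi j); congr (J (_ - _)); apply: eq_bigr => a _.
  by rewrite /L iterD.
(* Collected by the power [s] of [adD], the coefficients are those of the Cauchy product of [beta]
   with 1/(a+1)!, which [beta_rec] evaluates. *)
suff -> : \sum_(j < N) (beta j * z ^+ j) *: Y j = \sum_(s < N) (s == 0%N :> nat)%:R *: ((z * z ^+ s) *: L s).
  by rewrite subrr.
transitivity (\sum_(j < N) \sum_(s < N | (j <= s)%N)
    (beta j / (s - j).+1`!%:R) *: ((z * z ^+ s) *: L s)).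
  apply: eq_bigr => j _; rewrite /Y scaler_sumr.
  have jN : (j <= N)%N by rewrite ltnW.
  pose F s := if (j <= s)%N then (beta j / (s - j).+1`!%:R) *: ((z * z ^+ s) *: L s) else 0.
  rewrite [RHS]big_mkcond/= [RHS](sum_shift (F := F) jN); last first.
    by move=> s sj; rewrite /F leqNgt sj.
  rewrite (sum_trunc (F := fun a => (beta j * z ^+ j) *: ((z * (z ^+ a / a.+1`!%:R)) *: L (a + j)%N)) (leq_subr j N)); last first.
    by move=> a Na; rewrite /L leftz_degbound0 ?scaler0// addnC -leq_subLR.
  apply: eq_bigr => a _; rewrite /F leq_addl addnK !scalerA exprD; congr (_ *: _).
  by ring.
rewrite (exchange_big_dep xpredT)//=; apply: eq_bigr => s _.
rewrite -scaler_suml -beta_rec; congr (_ *: _).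
rewrite big_mkcond/= (sum_trunc (M := s.+1) (F := fun j => if (j <= s)%N then beta j / (s - j).+1`!%:R else 0))//.
  by apply: eq_bigr => j _; rewrite -ltnS ltn_ord.
by move=> j sj; rewrite leqNgt sj.
Qed.
End SymmetrizedProducts.

Section MonalgScale.
Context {K : monomType} {C : comNzRingType}.

Lemma mkZ (c a : C) (m : K) : c *: mk m a = mk m (c * a).
Proof. by apply: cf_ext => k; rewrite -cfE mcoeffZ cfE !cf_mk mulrnAr. Qed.

Lemma mkM (a b : C) (m m' : K) : mk m a * mk m' b = mk (mmul m m') (a * b).
Proof. by rewrite -!mkE malgM_def fgmulUU. Qed.

Lemma malg_scaleAr (c : C) (x y : malg K C) : x * (c *: y) = c *: (x * y).
Proof.
rewrite [x]malg_mkE [y]malg_mkE scaler_sumr !mulr_suml scaler_sumr.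
apply: eq_bigr => m _; rewrite !mulr_sumr scaler_sumr; apply: eq_bigr => m' _.
by rewrite mkZ !mkM mkZ mulrCA.
Qed.
End MonalgScale.

Section IdealOfRelators.
Context {C : numFieldType} {n : nat} {A : lalgType C}.
Hypothesis scaleAr : forall (c : C) (x y : A), x * (c *: y) = c *: (x * y).
Context (e : 'I_n -> A) (cst : 'I_n -> 'I_n -> 'I_n -> C).

Definition relator (i j : 'I_n) : A :=
  eword e [:: i; j] - eword e [:: j; i] - \sum_k cst i j k *: eword e [:: k].

Definition env_ideal (t : A) : Prop :=
  exists s : seq ((A * A) * ('I_n * 'I_n)),
    t = \sum_(x <- s) x.1.1 * relator x.2.1 x.2.2 * x.1.2.

Lemma env_ideal0 : env_ideal 0. Proof. by exists [::]; rewrite big_nil. Qed.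

Lemma env_idealD x y : env_ideal x -> env_ideal y -> env_ideal (x + y).
Proof. by move=> [s ->] [t ->]; exists (s ++ t); rewrite big_cat. Qed.

Lemma env_idealMl x y : env_ideal y -> env_ideal (x * y).
Proof.
move=> [s ->]; exists [seq ((x * p.1.1, p.1.2), p.2) | p <- s].
by rewrite big_map mulr_sumr; apply: eq_bigr => p _; rewrite !mulrA.
Qed.

Lemma env_idealMr x y : env_ideal x -> env_ideal (x * y).
Proof.
move=> [s ->]; exists [seq ((p.1.1, p.1.2 * y), p.2) | p <- s].
by rewrite big_map mulr_suml; apply: eq_bigr => p _; rewrite !mulrA.
Qed.

Lemma env_idealZ c x : env_ideal x -> env_ideal (c *: x).
Proof. by move=> /(env_idealMl (c *: 1)); rewrite -scalerAl mul1r. Qed.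

Lemma eword1 i : eword e [:: i] = e i.
Proof. by rewrite /eword big_seq1. Qed.

Lemma eword_cat v w : eword e (v ++ w) = eword e v * eword e w.
Proof. by rewrite /eword big_cat. Qed.

Lemma env_ideal_rel i j :
  env_ideal (e i * e j - e j * e i - \sum_k cst i j k *: e k).
Proof.
exists [:: ((1, 1), (i, j))]; rewrite big_seq1 mul1r mulr1 /relator /=.
rewrite -![eword e [:: _; _]]/(eword e ([:: _] ++ [:: _])) !eword_cat !eword1.
by congr (_ - _); apply: eq_bigr => k _; rewrite eword1.
Qed.

(** A functional defined on words need only be checked on relators placed between two arbitrary
    words, so no module over the enveloping algebra has to be constructed. *)
Lemma env_ideal_functional (phi : A -> C) (L : seq 'I_n -> C) (t : A) :
  (forall x y, phi (x + y) = phi x + phi y) ->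
  (forall c x, phi (c *: x) = c * phi x) ->
  (forall x : A, exists s : seq (C * seq 'I_n), x = \sum_(p <- s) p.1 *: eword e p.2) ->
  (forall w, phi (eword e w) = L w) ->
  (forall v w i j, L (v ++ [:: i; j] ++ w) - L (v ++ [:: j; i] ++ w) =
    \sum_k cst i j k * L (v ++ [:: k] ++ w)) ->
  env_ideal t -> phi t = 0.
Proof.
move=> phiD phiZ span phiL HL [s ->].
have phi0 : phi 0 = 0 by rewrite -[0](scale0r (0 : A)) phiZ mul0r.
have phi_sum (I : Type) (r : seq I) (F : I -> A) : phi (\sum_(i <- r) F i) = \sum_(i <- r) phi (F i).
  by elim: r => [|i r IH]; rewrite ?big_nil// !big_cons phiD IH.
have phiB x y : phi (x - y) = phi x - phi y by rewrite phiD -scaleN1r phiZ mulN1r.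
rewrite phi_sum big1// => -[[a b] [i j]] _ /=.
have [sa ->] := span a; have [sb ->] := span b.
rewrite !mulr_suml phi_sum big1// => -[c v] _ /=.
rewrite mulr_sumr phi_sum big1// => -[d w] _ /=.
rewrite scaleAr phiZ -!scalerAl phiZ.
suff -> : phi (eword e v * relator i j * eword e w) = 0 by rewrite !mulr0.
rewrite /relator !(mulrBr, mulrBl) !phiB -!mulrA -!eword_cat !phiL.
rewrite mulr_suml mulr_sumr phi_sum HL; apply/eqP; rewrite subr_eq0; apply/eqP.
by apply: eq_bigr => k _; rewrite -scalerAl scaleAr phiZ -!eword_cat phiL.
Qed.
End IdealOfRelators.

Section FreeAlgebra.
Context {C : numFieldType} {n : nat}.
Local Notation A := (malg (fmonom 'I_n) C).

Definition gen (i : 'I_n) : A := mkmalgU (fmu i) 1.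

Lemma eword_gen w : eword gen w = mk (FMonom w) 1.
Proof.
rewrite /eword; elim: w => [|i w IH].
  by rewrite big_nil -fmoneE -mkE.
rewrite big_cons IH /gen mkE mkM mulr1; congr (mk _ _).
by rewrite -[mmul _ _]/(fmmul _ _) fmmulE fmuE.
Qed.

Lemma free_span (x : A) : exists s : seq (C * seq 'I_n), x = \sum_(p <- s) p.1 *: eword gen p.2.
Proof.
exists [seq (cf m x, m : seq 'I_n) | m <- msupp x]; rewrite big_map.
rewrite {1}[x]malg_mkE; apply: eq_bigr => m _ /=.
by rewrite eword_gen fmK mkZ mulr1.
Qed.

Lemma free_functional (L : seq 'I_n -> C) : exists phi : A -> C,
  [/\ forall x y, phi (x + y) = phi x + phi y,
      forall c x, phi (c *: x) = c * phi x
    & forall w, phi (eword gen w) = L w].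
Proof.
pose F (m : fmonom 'I_n) c := c * L (m : seq 'I_n).
have F0 m : F m 0 = 0 by rewrite /F mul0r.
exists (fun t => \sum_(m <- msupp t) F m (cf m t)); split=> [x y|c x|w].
- by apply: big_msuppD => // m; rewrite /F mulrDl.
- rewrite (big_msuppw (d := msupp x))//; last first.
    by move=> m; rewrite -!cf_neq0 -!cfE mcoeffZ; apply: contraNN => /eqP ->; rewrite mulr0.
  rewrite mulr_sumr; apply: eq_bigr => m _.
  by rewrite -!cfE mcoeffZ /F mulrA.
- by rewrite eword_gen big_msuppU// /F mul1r.
Qed.
End FreeAlgebra.

(** * Words as differential operators at the unit *)

Section Action.
Context {R : realType} {n : nat} {G : lieGroupType R n}.
Context (B : 'M[R]_n) (B_unit : B \in unitmx).
Implicit Types (f h : G -> R).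
Local Notation e := (1%g : G).

Lemma lieR_wordZ w (k : R) f : analytic1 f ->
  lieR_word B w (fun x => k * f x) e = k * lieR_word B w f e.
Proof.
elim/last_ind: w f => [//|w i IH] f F.
rewrite !lieR_word_rcons -IH; last exact: analytic1_lieR.
by apply: lieR_word_eq1 => x ex; rewrite lieRZ; auto.
Qed.

Lemma analytic1Z (k : R) f : analytic1 f -> analytic1 (fun x => k * f x).
Proof. by move=> F x ex; apply: an_atZ; auto. Qed.

Lemma lieR_word0 w : lieR_word B w (fun=> 0) e = 0.
Proof.
have := @lieR_wordZ w 0 (fun=> 0) (fun x _ => an_at_cst 0 x).
by under eq_fun do rewrite mul0r; rewrite mul0r.
Qed.

Lemma lieR_word_lin w (I : Type) (r : seq I) (k : I -> R) (F : I -> G -> R) :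
  (forall i, analytic1 (F i)) ->
  lieR_word B w (fun x => \sum_(i <- r) k i * F i x) e =
  \sum_(i <- r) k i * lieR_word B w (F i) e.
Proof.
move=> H; elim: r => [|i r IH].
  by under eq_fun do rewrite big_nil; rewrite lieR_word0 big_nil.
under eq_fun do rewrite big_cons.
rewrite big_cons -IH -lieR_wordZ//; apply: (@lieR_wordD _ _ _ _ _ _ _ e); last exact: chart_dom_center.
  exact: analytic1Z.
by move=> x ex; apply: an_at_sum => j; apply: an_atZ; apply: H.
Qed.

Lemma lieR_word_relation v w i j f : analytic1 f ->
  lieR_word B (v ++ [:: i; j] ++ w) f e - lieR_word B (v ++ [:: j; i] ++ w) f e =
  \sum_k struct_const G B i j k * lieR_word B (v ++ [:: k] ++ w) f e.
Proof.
move=> F; under eq_bigr do rewrite !lieR_word_cat.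
rewrite !lieR_word_cat.
have gan : analytic1 (lieR_word B w f) by move=> x ex; apply: an_at_lieR_word; auto.
move: (lieR_word B w f) gan => g gan {F}.
have wan u : analytic1 (lieR_word B u g) by move=> x ex; apply: an_at_lieR_word; auto.
rewrite -(lieR_word_lin v _ _ (fun k => wan [:: k])).
rewrite -[X in _ - X]mul1r -mulNr -(lieR_wordZ v _ (wan [:: j; i])).
rewrite -(@lieR_wordD _ _ _ _ v _ _ e (wan [:: i; j]) (analytic1Z _ (wan [:: j; i]))); last exact: chart_dom_center.
apply: lieR_word_eq1 => x ex; rewrite mulN1r.
by apply: lieR_relation; auto.
Qed.

(* Injectivity half of the Poincare-Birkhoff-Witt theorem: symmetrized
   tensors are tested on products of coordinates, as differential operators
   at the unit; only the leading symbol contributes. *)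
Lemma quantz_inj (C : numFieldType) (inC : {rmorphism R -> C}) (z : C) N
    (v : malg (cmonom 'I_n) C) : z != 0 ->
  degbound N v ->
  env_ideal (@gen C n) (fun i j k => inC (struct_const G B i j k)) (quantz (@gen C n) N z v) ->
  v = 0.
Proof.
move=> z0; elim: N => [|N IH] H J; first exact: degbound_eq0.
suff HN : degbound N v by apply: IH => //; rewrite -(quantzW _ z HN (leqnSn N)).
move=> m; rewrite leq_eqVlt => /predU1P[mN|mN]; last exact: H.
have szm : size (mword m) = N by rewrite size_mword.
pose f := frame_prod (G := G) B (mword m).
have fan : analytic1 f by exact: frame_prod_an.
have [phi [phiD phiZ phiL]] := free_functional (fun w => inC (lieR_word B w f e)).
have phi0 : phi 0 = 0 by rewrite -[0](scale0r (0 : malg (fmonom 'I_n) C)) phiZ mul0r.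
have phi_sum (I : Type) (r : seq I) (F : I -> malg (fmonom 'I_n) C) :
    phi (\sum_(i <- r) F i) = \sum_(i <- r) phi (F i).
  by elim: r => [|i r IHr]; rewrite ?big_nil// !big_cons phiD IHr.
have : phi (quantz (@gen C n) N.+1 z v) = 0.
  apply: (env_ideal_functional _ phiD phiZ (@free_span C n) phiL _ J).
    exact: malg_scaleAr.
  move=> p q i j; rewrite -rmorphB lieR_word_relation// rmorph_sum.
  by apply: eq_bigr => k _; rewrite rmorphM.
have symE k : phi (symz (@gen C n) k v) = \sum_(u : k.-tuple 'I_n) taylor u v * inC (lieR_word B u f e).
  by rewrite /symz phi_sum; apply: eq_bigr => u _; rewrite phiZ phiL.
rewrite /quantz phi_sum big_ord_recr/= big1 => [|k _]; last first.
  rewrite phiZ symE big1 ?mulr0// => u _.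
  rewrite (_ : lieR_word B u f e = 0) ?rmorph0 ?mulr0//.
  by apply: frame_prod_vanishing; rewrite // szm size_tuple /= ltn_ord.
rewrite add0r phiZ symE => /eqP; rewrite mulf_eq0 mulf_eq0 invr_eq0 expf_eq0 (negPf z0) andbF.
rewrite pnatr_eq0 eqn0Ngt fact_gt0 /=.
(* All surviving words are rearrangements of the word of [m] and enter with the same positive
   weight, so nothing can cancel. *)
rewrite (eq_bigr (fun u : N.-tuple 'I_n => cf m v * ((perm_eq u (mword m))%:R * (wfact (mword m) * wfact (mword m))%:R))); last first.
  move=> u _; rewrite lieR_word_frame ?size_tuple// rmorphM !rmorph_nat /taylor.
  case: (boolP (perm_eq u (mword m))) => [um|_]; last by rewrite !mul0r !mulr0.
  rewrite (wfact_perm um) ((perm_contentP _ _).1 um) mwordK natrM !mul1r.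
  by rewrite -/(wfact _) -mulrA mulrCA.
rewrite -mulr_sumr mulf_eq0 => /orP[/eqP//|].
rewrite -mulr_suml mulf_eq0 -natr_sum !pnatr_eq0 muln_eq0 !eqn0Ngt wfact_gt0 orbF /=.
have szm' : size (mword m) == N by rewrite szm.
by rewrite (bigD1 (Tuple szm'))//= perm_refl.
Qed.
End Action.

(** * The Gutt star product *)

Section GuttWords.
Context {C : numFieldType} {n : nat}.
Local Notation SymC := (malg (cmonom 'I_n) C).
Implicit Types (v : SymC) (w : seq 'I_n).
Context (cst : 'I_n -> 'I_n -> 'I_n -> C) (beta : nat -> C).

(** [N] bounds the degree of [v]. Each letter raises the bound by one, and this fixes where the
    series in [gutt_left] is truncated. *)
Fixpoint gutt_word (N : nat) (z : C) w v : SymC :=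
  if w is b :: w' then gutt_left cst beta (N + size w') z b (gutt_word N z w' v) else v.

Definition gutt_prod (N : nat) (z : C) w v : SymC :=
  ((size w)`!%:R)^-1 *: \sum_(s : 'S_(size w)) gutt_word N z (permt (in_tuple w) s) v.

Lemma degbound_mul_gen N b v : degbound N v -> degbound N.+1 (mono (ucm b) * v).
Proof.
move=> H m Nm; have [mb|mb] := posnP (m b); first by rewrite cf_ucmM0.
rewrite -(mul_divcm mb) cf_ucmM H//.
by rewrite -(mul_divcm mb) mdegM mdegU in Nm.
Qed.

Lemma degbound_gutt_left N z b v : degbound N v -> degbound N.+1 (gutt_left cst beta N z b v).
Proof.
move=> H; apply: degbound_sum => j; apply: degboundZ; apply: degbound_sum => c.
apply: degbound_mul_gen; apply: degboundW (leq_subr j N) _.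
apply: degbound_iter_adD => c'; rewrite /slot; case: eqP => // _ m _.
by rewrite cf0.
Qed.

Lemma degbound_gutt_word N z w v : degbound N v -> degbound (N + size w) (gutt_word N z w v).
Proof.
move=> H; elim: w => [|b w IH] /=; first by rewrite addn0.
by rewrite addnS; apply: degbound_gutt_left.
Qed.

Lemma size_permt k (t : k.-tuple 'I_n) (s : 'S_k) : size (permt t s) = k.
Proof. by rewrite size_map size_enum_ord. Qed.

Lemma degbound_gutt_prod N z w v : degbound N v -> degbound (N + size w) (gutt_prod N z w v).
Proof.
move=> H; apply: degboundZ; apply: degbound_sum => s.
by have := @degbound_gutt_word N z (permt (in_tuple w) s) v H; rewrite size_permt.
Qed.

Hypothesis beta_rec : forall s,
  \sum_(j < s.+1) beta j / (s - j).+1`!%:R = (s == 0%N)%:R.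

Lemma mu_slot b v : mu (slot b v) = mono (ucm b) * v.
Proof.
rewrite /mu (bigD1 b) /=; last by [].
rewrite big1; last by move=> c /negPf cb; rewrite /slot cb mulr0.
by rewrite addr0 /slot eqxx.
Qed.

Lemma beta0 : beta 0 = 1.
Proof. by have := beta_rec 0; rewrite big_ord1 subn0 /= divr1. Qed.

Lemma gutt_word0 N w v : degbound N v -> gutt_word N 0 w v = mono (content w) * v.
Proof.
move=> H; elim: w => [|b w IH] /=.
  by rewrite (_ : mono mone = 1) ?mul1r// /mono -mkE.
rewrite -monoM -mulrA -IH.
have {H} := @degbound_gutt_word N 0 w v H; move: (gutt_word _ _ _ _) (N + size w)%N => u M H.
rewrite /gutt_left; case: M H => [|M] H; first by rewrite big_ord0 (degbound_eq0 H) mulr0.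
rewrite big_ord_recl big1; last by move=> j _; rewrite expr0n mulr0 scale0r.
have -> : beta (@ord0 M) * 0 ^+ @ord0 M = 1 by rewrite /= expr0 mulr1 beta0.
have -> : iter (@ord0 M) (adD cst) (slot b u) = slot b u by [].
rewrite addr0 scale1r; exact: mu_slot.
Qed.

Lemma perm_permt k (t : k.-tuple 'I_n) (s : 'S_k) : perm_eq (permt t s) t.
Proof.
rewrite /permt; apply/tuple_permP; exists s.
by rewrite /=; apply: eq_map => j.
Qed.

Lemma gutt_prod0 N w v : degbound N v -> gutt_prod N 0 w v = mono (content w) * v.
Proof.
move=> H; rewrite /gutt_prod (eq_bigr (fun=> mono (content w) * v)); last first.
  move=> s _; rewrite (gutt_word0 _ H).
  by have /perm_contentP -> := perm_permt (in_tuple w) s.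
rewrite sumr_const card_Sn -[X in _ *: X]scaler_nat scalerA mulVf; last by rewrite pnatr_eq0 -lt0n fact_gt0.
by rewrite scale1r.
Qed.

Context {A : lalgType C}.
Hypothesis scaleAr : forall (c : C) (x y : A), x * (c *: y) = c *: (x * y).
Context (e : 'I_n -> A).
Local Notation J := (env_ideal e cst).

Lemma env_ideal_sum (I : Type) (r : seq I) (F : I -> A) :
  (forall i, J (F i)) -> J (\sum_(i <- r) F i).
Proof.
move=> H; elim: r => [|i r IH]; first by rewrite big_nil; apply: env_ideal0.
by rewrite big_cons; apply: env_idealD.
Qed.

Lemma quantz_gutt_word N z w v : degbound N v ->
  J (quantz e (N + size w) z (gutt_word N z w v) -
     z ^+ size w *: (eword e w * quantz e N z v)).
Proof.
move=> H; elim: w => [|b w IH] /=.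
  rewrite addn0 scale1r /eword big_nil mul1r subrr; exact: env_ideal0.
rewrite addnS.
have := @quantz_gutt_left C n A scaleAr e cst J (env_ideal0 e cst)
  (@env_idealD _ _ _ e cst) (@env_idealZ _ _ _ e cst) (@env_idealMl _ _ _ e cst)
  (@env_idealMr _ _ _ e cst) (env_ideal_rel e cst) beta beta_rec (N + size w) z b
  _ (@degbound_gutt_word N z w v H).
move=> /env_idealD-/(_ _ (env_idealZ z (env_idealMl (e b) IH))).
congr J; rewrite mulrBr scalerBr addrA subrK; congr (_ - _).
by rewrite /eword big_cons scaleAr scalerA -exprS mulrA.
Qed.

Lemma symz_content w :
  symz e (size w) (mono (content w)) = \sum_(s : 'S_(size w)) eword e (permt (in_tuple w) s).
Proof.
rewrite (sum_permt (in_tuple w) (fun u => eword e u)) /symz big_mkcond/=.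
rewrite [RHS]big_mkcond/=; apply: eq_bigr => u _; rewrite /taylor cf_mono.
have -> : perm_eq u w = (content w == content u).
  by apply/idP/eqP => [/perm_contentP ->//|uw]; apply/perm_contentP.
case: eqP => [uw|_]; last by rewrite mulr0 scale0r.
have -> : wfact u = wfact w by apply/wfact_perm/perm_contentP.
by rewrite mulr1 scaler_nat.
Qed.

Lemma quantz_content N z w : (size w < N)%N ->
  quantz e N z (mono (content w)) =
  (z ^+ size w / (size w)`!%:R) *: \sum_(s : 'S_(size w)) eword e (permt (in_tuple w) s).
Proof.
move=> wN; rewrite -symz_content /quantz (bigD1 (Ordinal wN))//= big1 ?addr0// => k kw.
rewrite [symz _ _ _]big1 ?scaler0// => u _.
rewrite /taylor cf_mono; case: eqP => [wu|_]; last by rewrite mulr0 scale0r.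
case/eqP: kw; apply: val_inj; rewrite /=.
have := mdeg_content w; rewrite wu mdeg_content size_tuple => <-.
by [].
Qed.

(** The powers of [z] from the successive left multiplications and the average over permutations
    together form the quantization of the word. *)
Lemma quantz_gutt_prod N z w v : degbound N v ->
  J (quantz e (N + size w) z (gutt_prod N z w v) -
     quantz e (size w).+1 z (mono (content w)) * quantz e N z v).
Proof.
move=> H; rewrite quantz_content// quantzZ quantz_sum mulrC -scalerA -scalerAl -scalerBr.
apply: env_idealZ; rewrite scaler_sumr mulr_suml -sumrB; apply: env_ideal_sum => s.
by have := quantz_gutt_word z (permt (in_tuple w) s) H; rewrite size_permt scalerAl.
Qed.
End GuttWords.

(** * Bernoulli coefficients *)

Section Bernoulli.
Context (R : realType).

(** Course-of-values recursion: the list keeps all earlier coefficients. [bern s] is the s-th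
    Bernoulli number divided by s!. *)
Fixpoint bern_seq (s : nat) : seq R :=
  if s is s'.+1 then
    let l := bern_seq s' in
    rcons l (- \sum_(j < s) l`_j / (s - j).+1`!%:R)
  else [:: 1].

Definition bern (s : nat) : R := (bern_seq s)`_s.

Lemma size_bern_seq s : size (bern_seq s) = s.+1.
Proof. by elim: s => //= s IH; rewrite size_rcons IH. Qed.

Lemma bern_seqE s j : (j <= s)%N -> (bern_seq s)`_j = bern j.
Proof.
elim: s => [|s IH]; first by rewrite leqn0 => /eqP ->.
rewrite leq_eqVlt => /predU1P[->//|]; rewrite ltnS => js.
by rewrite /= nth_rcons size_bern_seq ltnS js IH.
Qed.

Lemma bernS s : bern s.+1 = - \sum_(j < s.+1) bern j / (s.+1 - j).+1`!%:R.
Proof.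
rewrite {1}/bern /= nth_rcons size_bern_seq ltnn eqxx; congr (- _).
by apply: eq_bigr => j _; rewrite bern_seqE// -ltnS.
Qed.

Lemma bern_rec s : \sum_(j < s.+1) bern j / (s - j).+1`!%:R = (s == 0%N)%:R.
Proof.
case: s => [|s]; first by rewrite big_ord1 /bern /= divr1.
by rewrite big_ord_recr /= subnn divr1 bernS addrN.
Qed.

Lemma fact_exp2 k : (2 ^ k.+1 <= k.+2`!)%N.
Proof.
elim: k => [//|k IH]; rewrite expnS factS; apply: leq_mul => //.
Qed.

(** By [fact_exp2] the recursion is dominated by the geometric series with ratio 1/2 that starts at
    1/2, whose partial sums stay below 1. *)
Lemma bern_le1 s : `|bern s| <= 1.
Proof.
elim/ltn_ind: s => -[|s] IH; first by rewrite /bern /= normr1.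
rewrite bernS normrN; apply: le_trans (ler_norm_sum _ _ _) _.
have half k : \sum_(i < k) (2^-1 : R) ^+ i.+1 = 1 - 2^-1 ^+ k.
  elim: k => [|k IHk]; first by rewrite big_ord0 expr0 subrr.
  by rewrite big_ord_recr /= IHk exprS; lra.
apply: (@le_trans _ _ (\sum_(i < s.+1) (2^-1 : R) ^+ i.+1)).
  rewrite (reindex_inj rev_ord_inj)/=; apply: ler_sum => j _.
  rewrite normrM -[leRHS]mul1r ler_pM//; first by apply: IH; rewrite subSS ltnS leq_subr.
  rewrite normfV ger0_norm// subKn//.
  rewrite exprVn lef_pV2 ?posrE ?exprn_gt0 ?ltr0n ?fact_gt0//.
  by rewrite -natrX ler_nat fact_exp2.
by rewrite half gerBl exprn_ge0.
Qed.
End Bernoulli.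

(** * Weighted norms and the cost of left multiplication *)

Section WeightedNorm.
Context {R : realType} {C : numFieldType} {n : nat}.
Context (nrm : C -> R).
Hypothesis nrm_ge0 : forall x, 0 <= nrm x.
Hypothesis nrmD : forall x y, nrm (x + y) <= nrm x + nrm y.
Hypothesis nrmM : forall x y, nrm (x * y) = nrm x * nrm y.
Hypothesis nrmV : forall x, nrm x^-1 = (nrm x)^-1.
Hypothesis nrm_nat : forall k, nrm k%:R = k%:R.
Local Notation SymC := (malg (cmonom 'I_n) C).
Implicit Types (v : SymC) (W : nat -> R).

Definition wnorm W v : R := \sum_(m <- msupp v) nrm (cf m v) * W (mdeg m).

Lemma nrm0 : nrm 0 = 0. Proof. exact: (nrm_nat 0). Qed.

Lemma nrm1 : nrm 1 = 1. Proof. exact: (nrm_nat 1). Qed.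

Lemma wnorm_ge0 W v : (forall k, 0 <= W k) -> 0 <= wnorm W v.
Proof. by move=> W0; apply: sumr_ge0 => m _; rewrite mulr_ge0. Qed.

Lemma wnormW W W' v : (forall k, W k <= W' k) -> wnorm W v <= wnorm W' v.
Proof. by move=> WW; apply: ler_sum => m _; rewrite ler_wpM2l. Qed.

Lemma wnormD W v v' : (forall k, 0 <= W k) -> wnorm W (v + v') <= wnorm W v + wnorm W v'.
Proof.
move=> W0; pose F (m : cmonom 'I_n) c := nrm c * W (mdeg m).
have F0 m : F m 0 = 0 by rewrite /F nrm0 mul0r.
rewrite /wnorm -!/(F _ _).
rewrite (big_msuppw (F := F) (msupp2_uniq v v') (@msupp2D _ _ v v') F0).
rewrite (big_msuppw (F := F) (msupp2_uniq v v') (@msupp2l _ _ v v') F0).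
rewrite (big_msuppw (F := F) (msupp2_uniq v v') (@msupp2r _ _ v v') F0).
rewrite -big_split/=; apply: ler_sum => m _.
by rewrite cfD -mulrDl ler_wpM2r.
Qed.

Lemma wnorm0 W : wnorm W 0 = 0.
Proof. by rewrite /wnorm msupp0 big_seq_fset0. Qed.

Lemma wnormZ W c v : wnorm W (c *: v) = nrm c * wnorm W v.
Proof.
pose F (m : cmonom 'I_n) c := nrm c * W (mdeg m).
have F0 m : F m 0 = 0 by rewrite /F nrm0 mul0r.
rewrite /wnorm -!/(F _ _) (big_msuppw (F := F) (fset_uniq (msupp v)) _ F0); last first.
  by move=> m; rewrite -!cf_neq0 cfZ; apply: contraNN => /eqP ->; rewrite mulr0.
by rewrite mulr_sumr; apply: eq_bigr => m _; rewrite cfZ /F nrmM mulrA.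
Qed.

Lemma wnorm_mono W m : wnorm W (mono m) = W (mdeg m).
Proof.
pose F (m : cmonom 'I_n) c := nrm c * W (mdeg m).
have F0 k : F k 0 = 0 by rewrite /F nrm0 mul0r.
by rewrite /wnorm /mono (big_msuppU m 1 F0) /F nrm1 mul1r.
Qed.

Lemma wnorm_sum W (I : Type) (r : seq I) (F : I -> SymC) : (forall k, 0 <= W k) ->
  wnorm W (\sum_(i <- r) F i) <= \sum_(i <- r) wnorm W (F i).
Proof.
move=> W0; elim: r => [|i r IH]; first by rewrite !big_nil wnorm0.
by rewrite !big_cons; apply: le_trans (wnormD _ _ W0) _; rewrite lerD2l.
Qed.

(** A weighted l^1-norm need only be tested on monomials. The maps [T i] are treated jointly, so
    that their sum is estimated without a factor for their number. *)
Lemma wnorm_linear (I : finType) (T : I -> SymC -> SymC) W W' v :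
  (forall k, 0 <= W k) ->
  (forall i u u', T i (u + u') = T i u + T i u') ->
  (forall i c u, T i (c *: u) = c *: T i u) ->
  (forall m, \sum_i wnorm W (T i (mono m)) <= W' (mdeg m)) ->
  \sum_i wnorm W (T i v) <= wnorm W' v.
Proof.
move=> W0 TD TZ Tm.
have T0 i : T i 0 = 0 by have := TZ i 0 0; rewrite !scale0r.
have T_sum i (r : seq (cmonom 'I_n)) (F : cmonom 'I_n -> SymC) :
    T i (\sum_(k <- r) F k) = \sum_(k <- r) T i (F k).
  by elim: r => [|k r IH]; rewrite ?big_nil// !big_cons TD IH.
apply: (@le_trans _ _ (\sum_i \sum_(m <- msupp v) nrm (cf m v) * wnorm W (T i (mono m)))).
  apply: ler_sum => i _; rewrite {1}[v]malg_monoE T_sum.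
  apply: le_trans (wnorm_sum _ _ W0) _; apply: ler_sum => m _.
  by rewrite TZ wnormZ.
rewrite exchange_big/=; apply: ler_sum => m _.
by rewrite -mulr_sumr ler_wpM2l.
Qed.

Lemma wnorm_mul_gen W b v : (forall k, 0 <= W k) ->
  wnorm W (mono (ucm b) * v) <= wnorm (fun k => W k.+1) v.
Proof.
move=> W0; rewrite {1}[v]malg_monoE mulr_sumr; apply: le_trans (wnorm_sum _ _ W0) _.
apply: ler_sum => m _.
by rewrite malg_scaleAr monoM wnormZ wnorm_mono mdegM mdegU.
Qed.

Lemma deriv_mono a m : deriv a (mono m) = (m a)%:R *: mono (divcm m (ucm a)) :> SymC.
Proof.
apply: cf_ext => k; rewrite cf_deriv cfZ !cf_mono.
have [ma|ma] := posnP (m a).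
  case: eqP => [e|_]; last by rewrite ma mul0r mulr0.
  by move: ma; rewrite e cmM cmU eqxx.
case: eqP => [e|ne].
  have -> : divcm m (ucm a) = k.
    by apply: (@mul_ucmI _ a); rewrite mul_divcm// e.
  by rewrite eqxx e cmM cmU eqxx add1n.
case: eqP => [e|_]; last by rewrite !mulr0.
by case: ne; rewrite -e mul_divcm.
Qed.

(** The multiplicities in a monomial add up to its degree, so all partial derivatives together cost
    one factor of the degree. *)
Lemma wnorm_deriv W W' v : (forall k, 0 <= W k) ->
  (forall k, k.+1%:R * W k <= W' k.+1) -> 0 <= W' 0%N ->
  \sum_a wnorm W (deriv a v) <= wnorm W' v.
Proof.
move=> W0 WW W'0; apply: wnorm_linear => //.
- by move=> a u u'; rewrite derivD.
- by move=> a c u; rewrite derivZ.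
move=> m; have -> : \sum_a wnorm W (deriv a (mono m)) = \sum_a (m a)%:R * W (mdeg m).-1.
  apply: eq_bigr => a _; rewrite deriv_mono wnormZ nrm_nat wnorm_mono.
  have [->|ma] := posnP (m a); first by rewrite !mul0r.
  by congr (_ * W _); rewrite -[in RHS](mul_divcm ma) mdegM mdegU.
rewrite -mulr_suml -natr_sum.
have -> : (\sum_a m a)%N = mdeg m.
  rewrite -size_mword /mword size_flatten /shape -map_comp sumnE big_map big_enum/=.
  by apply: eq_bigr => a _; rewrite /= size_nseq.
by case: (mdeg m) => [|k]; rewrite ?mul0r//= WW.
Qed.

Lemma wnorm_mu W (u : 'I_n -> SymC) : (forall k, 0 <= W k) ->
  wnorm W (mu u) <= \sum_b wnorm (fun k => W k.+1) (u b).
Proof.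
move=> W0; apply: le_trans (wnorm_sum _ _ W0) _; apply: ler_sum => b _.
exact: wnorm_mul_gen.
Qed.

Context (cst : 'I_n -> 'I_n -> 'I_n -> C) (g : R).
Hypothesis cst_le : forall a b, \sum_c nrm (cst a b c) <= g.

Hypothesis g_ge0 : 0 <= g.

Lemma wnorm_adD W W' (u : 'I_n -> SymC) : (forall k, 0 <= W k) ->
  (forall k, k.+1%:R * W k <= W' k.+1) -> 0 <= W' 0%N ->
  \sum_c wnorm W (adD cst u c) <= g * \sum_b wnorm W' (u b).
Proof.
move=> W0 WW W'0.
apply: (@le_trans _ _ (\sum_c \sum_a \sum_b nrm (cst a b c) * wnorm W (deriv a (u b)))).
  apply: ler_sum => c _; apply: le_trans (wnorm_sum _ _ W0) _; apply: ler_sum => a _.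
  apply: le_trans (wnorm_sum _ _ W0) _; apply: ler_sum => b _.
  by rewrite wnormZ.
rewrite exchange_big/=.
apply: (@le_trans _ _ (\sum_a \sum_b g * wnorm W (deriv a (u b)))).
  apply: ler_sum => a _; rewrite exchange_big/=; apply: ler_sum => b _.
  by rewrite -mulr_suml ler_wpM2r// wnorm_ge0.
rewrite exchange_big/= mulr_sumr; apply: ler_sum => b _.
by rewrite -mulr_sumr ler_wpM2l //; apply: wnorm_deriv.
Qed.

Context (beta : nat -> C).
Hypothesis beta_le1 : forall j, nrm (beta j) <= 1.
Context (rho : R) (rho_ge1 : 1 <= rho).

Definition factp (k : nat) : R := k`!%:R `^ rho.

Lemma factp_ge0 k : 0 <= factp k. Proof. exact: powR_ge0. Qed.

(** The cost of a derivative in degree [k.+1] is absorbed by one step of the weight; this is where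
    [rho >= 1] enters. *)
Lemma factpS k : k.+1%:R * factp k <= factp k.+1.
Proof.
rewrite /factp factS natrM powRM// ler_wpM2r ?powR_ge0//.
by rewrite le1r_powR// ler1n.
Qed.

(* The shift by t makes every left multiplication cost a constant factor. *)
Definition gweight (c : R) (t k : nat) : R := factp (k + t) * c ^+ k.

Lemma gweight_ge0 c t k : 0 <= c -> 0 <= gweight c t k.
Proof. by move=> c0; rewrite mulr_ge0 ?factp_ge0// exprn_ge0. Qed.

Lemma wnorm_scale a W v : wnorm (fun k => a * W k) v = a * wnorm W v.
Proof. by rewrite /wnorm mulr_sumr; apply: eq_bigr => m _; rewrite mulrCA. Qed.

(** Lowering the degree by one frees a factor [c], so a large [c] makes the coadjoint operator
    small. The weights are taken at [k.+1] because [mu] raises the degree again. *)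
Lemma wnorm_iter_adD c t j (u : 'I_n -> SymC) : 0 < c ->
  \sum_b wnorm (fun k => gweight c t k.+1) (iter j (adD cst) u b) <=
  (g / c) ^+ j * \sum_b wnorm (fun k => gweight c t k.+1) (u b).
Proof.
move=> c0; elim: j => [|j IH]; first by rewrite mul1r.
have V0 k : 0 <= gweight c t k.+1 by rewrite gweight_ge0// ltW.
rewrite iterS exprS -mulrA; apply: le_trans (ler_wpM2l _ IH); last by rewrite divr_ge0// ltW.
apply: (le_trans (wnorm_adD (W' := fun k => c^-1 * gweight c t k.+1) _ V0 _ _)).
- move=> k; rewrite /gweight [c ^+ k.+2]exprS [leRHS]mulrCA mulKf ?gt_eqF// mulrA.
  rewrite ler_wpM2r ?exprn_ge0 ?(ltW c0)//.
  have := factpS (k.+1 + t); rewrite -addSn; apply: le_trans.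
  by rewrite ler_wpM2r ?factp_ge0// ler_nat; lia.
- by rewrite mulr_ge0 ?V0// invr_ge0 ltW.
rewrite -mulrA ler_wpM2l//; under eq_bigr do rewrite wnorm_scale.
by rewrite -mulr_sumr.
Qed.

Lemma half_sum k : \sum_(i < k) (2^-1 : R) ^+ i <= 2.
Proof.
suff -> : \sum_(i < k) (2^-1 : R) ^+ i = 2 - 2 * 2^-1 ^+ k.
  by rewrite gerBl mulr_ge0// exprn_ge0.
elim: k => [|k IHk]; first by rewrite big_ord0 expr0 mulr1 subrr.
by rewrite big_ord_recr /= IHk exprS; lra.
Qed.

(** The condition on [c] bounds the j-th term by [2^-1 ^+ j], whence the factor 2; the factor [c]
    comes from trading one degree for one unit of the shift. *)
Lemma wnorm_gutt_left N z c t b v : 0 < c -> 2 * (nrm z * g) <= c ->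
  wnorm (gweight c t) (gutt_left cst beta N z b v) <= 2 * c * wnorm (gweight c t.+1) v.
Proof.
move=> c0 zc; have W0 k : 0 <= gweight c t k by rewrite gweight_ge0// ltW.
have nX j : nrm (z ^+ j) = nrm z ^+ j.
  by elim: j => [|j IH]; rewrite ?nrm1// !exprS nrmM IH.
apply: le_trans (wnorm_sum _ _ W0) _.
pose S := wnorm (fun k => gweight c t k.+1) v.
have S0 : 0 <= S by apply: wnorm_ge0 => k.
have slotS : \sum_d wnorm (fun k => gweight c t k.+1) (slot b v d) = S.
  rewrite (bigD1 b)//= /slot eqxx big1 ?addr0// => d /negPf ->.
  by rewrite wnorm0.
apply: (@le_trans _ _ (\sum_(j < N) 2^-1 ^+ j * S)).
  apply: ler_sum => j _; rewrite wnormZ nrmM nX.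
  apply: (@le_trans _ _ (nrm z ^+ j * ((g / c) ^+ j * S))).
    apply: ler_pM; rewrite ?mulr_ge0 ?exprn_ge0 ?wnorm_ge0//.
      by rewrite ler_piMl ?exprn_ge0.
    by apply: le_trans (wnorm_mu _ W0) _; rewrite -slotS; apply: wnorm_iter_adD.
  rewrite mulrA -exprMn ler_wpM2r// lerXn2r ?nnegrE ?invr_ge0//.
    by rewrite mulr_ge0// divr_ge0// ltW.
  by rewrite mulrA ler_pdivrMr// ler_pdivlMl.
rewrite -mulr_suml.
have -> : 2 * c * wnorm (gweight c t.+1) v = 2 * S.
  rewrite -mulrA -wnorm_scale /S; congr (_ * wnorm _ _); apply/funext => k.
  by rewrite /gweight exprS mulrCA addnS addSn.
by rewrite ler_wpM2r ?half_sum.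
Qed.

Lemma wnorm_gutt_word N z c t w v : 0 < c -> 2 * (nrm z * g) <= c ->
  wnorm (gweight c t) (gutt_word cst beta N z w v) <=
  (2 * c) ^+ size w * wnorm (gweight c (t + size w)) v.
Proof.
move=> c0 zc; elim: w t => [|b w IH] t /=; first by rewrite mul1r addn0.
apply: le_trans (wnorm_gutt_left _ _ _ _ c0 zc) _.
by rewrite exprS -[leRHS]mulrA ler_wpM2l ?mulr_ge0 ?(ltW c0)// -addSnnS IH.
Qed.

Lemma factpD k l : factp (k + l) <= (2 `^ rho) ^+ (k + l) * (factp k * factp l).
Proof.
rewrite /factp -powRM// -powR_mulrn ?powR_ge0// -powRrM [rho * _]mulrC powRrM -powRM ?powR_ge0 ?mulr_ge0//.
rewrite ge0_ler_powR ?nnegrE ?mulr_ge0 ?powR_ge0 ?ler0n ?(le_trans ler01 rho_ge1)//.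
rewrite powR_mulrn// -natrX -!natrM ler_nat.
rewrite -(bin_fact (leq_addr l k)) addKn leq_mul2r; apply/orP; right.
rewrite -[X in (X ^ _)%N]/(1 + 1)%N expnDn.
under eq_bigr do rewrite !exp1n !muln1.
have kl : (k < (k + l).+1)%N by rewrite ltnS leq_addr.
by rewrite (bigD1 (Ordinal kl))//= leq_addr.
Qed.

(** The letters of [w] produce a shift by [size w]; [factpD] splits the resulting factorial at the
    price of a geometric factor, and averaging over permutations is free. *)
Lemma wnorm_gutt_prod N z c w m : 0 < c -> 2 * (nrm z * g) <= c ->
  wnorm (gweight c 0) (gutt_prod cst beta N z w (mono m)) <=
  (2 * c * 2 `^ rho) ^+ (size w + mdeg m) * (factp (size w) * factp (mdeg m)).
Proof.
move=> c0 zc; have W0 k : 0 <= gweight c 0 k by rewrite gweight_ge0// ltW.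
rewrite wnormZ nrmV nrm_nat ler_pdivrMl ?ltr0n ?fact_gt0//.
apply: le_trans (wnorm_sum _ _ W0) _.
pose d := (2 * c * 2 `^ rho) ^+ (size w + mdeg m) * (factp (size w) * factp (mdeg m)).
apply: (@le_trans _ _ (\sum_(s : 'S_(size w)) d)); last first.
  by rewrite sumr_const card_Sn [leRHS]mulr_natl.
apply: ler_sum => s _; apply: le_trans (wnorm_gutt_word _ _ _ _ c0 zc) _.
rewrite size_permt wnorm_mono add0n /gweight /d [(mdeg m + _)%N]addnC.
apply: (@le_trans _ _ ((2 * c) ^+ size w * (((2 `^ rho) ^+ (size w + mdeg m) *
   (factp (size w) * factp (mdeg m))) * c ^+ mdeg m))).
  rewrite ler_wpM2l ?exprn_ge0 ?mulr_ge0 ?(ltW c0)// ler_wpM2r ?exprn_ge0 ?(ltW c0)//.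
  exact: factpD.
set a := 2 * c; set F := factp _ * factp _.
rewrite [(a * _) ^+ _]exprMn [a ^+ (_ + _)]exprD; set P := 2 `^ rho ^+ _.
have E (x y p f : R) : x * (p * f * y) = x * y * (p * f) by ring.
rewrite E -[leRHS]mulrA.
have a0 : 0 <= a by rewrite mulr_ge0 ?(ltW c0).
rewrite ler_wpM2r ?mulr_ge0 ?factp_ge0 ?exprn_ge0 ?powR_ge0//.
rewrite ler_wpM2l ?exprn_ge0// lerXn2r ?nnegrE ?(ltW c0)//.
by rewrite ler_peMl ?(ltW c0)// ler1n.
Qed.
End WeightedNorm.

(** * Identification of the Gutt star product *)

Section GuttStar.
Context {R : realType} {n : nat}.
Implicit Types (v : Sym R n) (z : R[i]).
Local Notation betaC := (fun j => real_complex R (bern R j)).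
Local Notation gen := (@gen R[i] n).

Lemma betaC_rec s : \sum_(j < s.+1) betaC j / (s - j).+1`!%:R = (s == 0%N)%:R.
Proof.
rewrite -[RHS](rmorph_nat (real_complex R)) -(bern_rec R s) rmorph_sum /=.
by apply: eq_bigr => j _; rewrite fmorph_div /= rmorph_nat.
Qed.

Lemma gutt_quantE N z v : degbound N v -> gutt_quant z v = quantz gen N z v.
Proof.
move=> H; rewrite {2}[v]malg_monoE quantz_sum /gutt_quant.
rewrite [LHS]big_seq_cond [RHS]big_seq_cond; apply: eq_bigr => m /andP[mv _].
have wN : (size (mword m) < N)%N.
  rewrite size_mword ltnNge; apply/negP => /H mv0.
  by move: mv; rewrite -cf_neq0 mv0 eqxx.
have -> : mono m = mono (content (mword m)) :> Sym R n by rewrite mwordK.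
rewrite quantzZ quantz_content; last exact: wN.
rewrite scalerA [X in _ = X *: _]mulrA cfE; congr (_ *: _).
Qed.

Lemma env_eqE (cst : 'I_n -> 'I_n -> 'I_n -> R) (t u : Tens R n) : env_eq cst t u <-> env_ideal gen (fun i j k => real_complex R (cst i j k)) (t - u).
Proof.
split=> [[N [a [b [i [j E]]]]]|[s E]].
  exists [seq ((a l, b l), (i l, j l)) | l <- enum 'I_N].
  by rewrite big_map big_enum /= E.
exists (size s), (fun l => (tnth (in_tuple s) l).1.1), (fun l => (tnth (in_tuple s) l).1.2),
  (fun l => (tnth (in_tuple s) l).2.1), (fun l => (tnth (in_tuple s) l).2.2).
by rewrite E big_tnth.
Qed.
End GuttStar.

Section IdealDifferences.
Context {C : numFieldType} {n : nat} {A : lalgType C}.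
Context (e : 'I_n -> A) (cst : 'I_n -> 'I_n -> 'I_n -> C).

Lemma degboundB N (v v' : malg (cmonom 'I_n) C) :
  degbound N v -> degbound N v' -> degbound N (v - v').
Proof. by move=> H H' m Nm; rewrite cfD cfN H// H'// subr0. Qed.

Lemma quantz_ideal_congr N z v v' x :
  env_ideal e cst (quantz e N z v - x) -> env_ideal e cst (quantz e N z v' - x) ->
  env_ideal e cst (quantz e N z (v - v')).
Proof.
move=> H /(env_idealZ (-1)) /(env_idealD H); congr env_ideal.
by rewrite scaleN1r opprB addrA subrK -[X in quantz e N z (v + X)]scaleN1r quantzD quantzZ scaleN1r.
Qed.
End IdealDifferences.

Section GuttStarLie.
Context {R : realType} {n : nat} {G : lieGroupType R n}.
Context (B : 'M[R]_n) (B_unit : B \in unitmx).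
Local Notation cst := (struct_const G B).
Local Notation cstC := (fun i j k => real_complex R (cst i j k)).
Local Notation betaC := (fun j => real_complex R (bern R j)).
Local Notation gen := (@gen R[i] n).

Lemma gutt_star_word N z w (v : Sym R n) : degbound N v ->
  gutt_star cst z (sym_word R w) v = gutt_prod cstC betaC N z w v.
Proof.
move=> H; rewrite /gutt_star sym_wordE; case: eqP => [->|/eqP z0].
  by rewrite (gutt_prod0 _ betaC_rec _ H).
have Hw : degbound (size w).+1 (mono (content w) : Sym R n).
  by apply: degbound_mono; rewrite mdeg_content.
have Hp : degbound (N + size w) (gutt_prod cstC betaC N z w v) by apply: degbound_gutt_prod.
have Pp : env_eq cst (gutt_quant z (gutt_prod cstC betaC N z w v))
    (gutt_quant z (mono (content w)) * gutt_quant z v).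
  apply/env_eqE; rewrite (gutt_quantE z Hw) (gutt_quantE z H) (gutt_quantE z Hp).
  have sA := @malg_scaleAr (fmonom 'I_n : monomType) R[i].
  by apply: quantz_gutt_prod; [exact: betaC_rec|exact: sA|exact: H].
apply: xget_unique => // u /env_eqE uP; move/env_eqE: Pp => Pp.
set p := gutt_prod _ _ _ _ _ _ in Hp Pp *.
have [D uD] : exists D, degbound D u by eexists; apply: degbound_msize.
(* The competing solution [u] has an unrelated degree, so a common bound is needed before the two
   quantizations can be subtracted. *)
pose M := maxn (N + size w) D.
have uM : degbound M u by apply: degboundW (leq_maxr _ _) uD.
have pM : degbound M p by apply: degboundW (leq_maxl _ _) Hp.
apply/eqP; rewrite -subr_eq0; apply/eqP.
apply: (@quantz_inj R n G B B_unit _ (real_complex R) z M).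
- exact: z0.
- exact: degboundB uM pM.
move: uP Pp; rewrite (gutt_quantE z uM) (gutt_quantE z pM).
exact: quantz_ideal_congr.
Qed.
End GuttStarLie.

(** * Norms of analytic functions *)

Section ComplexLieDerivatives.
Context {R : realType} {n : nat} {G : lieGroupType R n}.
Implicit Types (phi psi : G -> R[i]) (g : G) (xi : 'rV[R]_n).
Local Notation re phi := (fun x => complex.Re (phi x)).
Local Notation im phi := (fun x => complex.Im (phi x)).

Lemma real_analytic_an phi : real_analytic phi <->
  forall g, an_at (re phi) g /\ an_at (im phi) g.
Proof. by []. Qed.

Lemma real_analyticD phi psi : real_analytic phi -> real_analytic psi ->
  real_analytic (phi + psi).
Proof.
move=> H K; apply/real_analytic_an => g.
have /real_analytic_an/(_ g)[a b] := H; have /real_analytic_an/(_ g)[c d] := K.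
have -> : re (phi + psi) = fun x => complex.Re (phi x) + complex.Re (psi x).
  by apply/funext => x; rewrite fctE; case: (phi x); case: (psi x).
have -> : im (phi + psi) = fun x => complex.Im (phi x) + complex.Im (psi x).
  by apply/funext => x; rewrite fctE; case: (phi x); case: (psi x).
by split; apply: an_atD.
Qed.

Lemma real_analytic_cst (c : R[i]) : real_analytic (fun _ : G => c).
Proof. by apply/real_analytic_an => g; split; apply: an_at_cst. Qed.

Let ReM phi psi : re (fun x => phi x * psi x) =
  fun x => complex.Re (phi x) * complex.Re (psi x) - complex.Im (phi x) * complex.Im (psi x).
Proof. by apply/funext => x; case: (phi x); case: (psi x). Qed.

Let ImM phi psi : im (fun x => phi x * psi x) =
  fun x => complex.Re (phi x) * complex.Im (psi x) + complex.Im (phi x) * complex.Re (psi x).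
Proof. by apply/funext => x; case: (phi x); case: (psi x). Qed.

Lemma real_analyticM phi psi : real_analytic phi -> real_analytic psi ->
  real_analytic (fun x => phi x * psi x).
Proof.
move=> H K; apply/real_analytic_an => g.
have /real_analytic_an/(_ g)[a b] := H; have /real_analytic_an/(_ g)[c d] := K.
rewrite ReM ImM; split; first by apply: an_atB; apply: an_atM.
by apply: an_atD; apply: an_atM.
Qed.

Lemma real_analytic0 : real_analytic (0 : G -> R[i]).
Proof. exact: real_analytic_cst. Qed.

Lemma real_analyticZ (c : R[i]) phi : real_analytic phi ->
  real_analytic (fun x => c * phi x).
Proof. exact/real_analyticM/real_analytic_cst. Qed.

Lemma real_analytic_lieC xi phi : real_analytic phi -> real_analytic (lieC xi phi).
Proof.
move=> H; apply/real_analytic_an => g; have /real_analytic_an/(_ g)[a b] := H.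
by split; apply: an_at_lieR.
Qed.

Lemma lieCD xi phi psi : real_analytic phi -> real_analytic psi ->
  lieC xi (phi + psi) = lieC xi phi + lieC xi psi.
Proof.
move=> H K; apply/funext => g; rewrite fctE /lieC.
have /real_analytic_an/(_ g)[a b] := H; have /real_analytic_an/(_ g)[c d] := K.
have -> : re (phi + psi) = fun x => complex.Re (phi x) + complex.Re (psi x).
  by apply/funext => x; rewrite fctE; case: (phi x); case: (psi x).
have -> : im (phi + psi) = fun x => complex.Im (phi x) + complex.Im (psi x).
  by apply/funext => x; rewrite fctE; case: (phi x); case: (psi x).
by rewrite !lieRD.
Qed.

Lemma lieC_cst xi (c : R[i]) : lieC xi (fun _ : G => c) = 0.
Proof. by apply/funext => g; rewrite /lieC !lieR_cst. Qed.

Lemma lieCM xi phi psi : real_analytic phi -> real_analytic psi ->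
  lieC xi (fun x => phi x * psi x) =
  (fun x => lieC xi phi x * psi x) + (fun x => phi x * lieC xi psi x).
Proof.
move=> H K; apply/funext => g; rewrite fctE /lieC.
have /real_analytic_an/(_ g)[a b] := H; have /real_analytic_an/(_ g)[c d] := K.
have aM f h : an_at f g -> an_at h g -> an_at (fun x => f x * h x) g by apply: an_atM.
rewrite ReM ImM [in X in Complex _ X]lieRD; [|by apply: aM|by apply: aM].
have -> : (fun x => complex.Re (phi x) * complex.Re (psi x) - complex.Im (phi x) * complex.Im (psi x)) =
   (fun x => complex.Re (phi x) * complex.Re (psi x) + (-1) * (complex.Im (phi x) * complex.Im (psi x))).
  by apply/funext => x; rewrite mulN1r.
rewrite lieRD; [|by apply: aM|by apply: an_atZ; apply: aM].
rewrite lieRZ; last by apply: aM.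
rewrite !lieRM//.
by case: (phi g) => p q; case: (psi g) => s t; apply/eqP; rewrite eq_complex /=; apply/andP; split; apply/eqP; ring.
Qed.

Lemma lieCZ xi (c : R[i]) phi : real_analytic phi ->
  lieC xi (fun x => c * phi x) = fun x => c * lieC xi phi x.
Proof.
move=> H; rewrite lieCM// ?lieC_cst; last exact: real_analytic_cst.
by apply/funext => x; rewrite fctE mul0r add0r.
Qed.

Context (B : 'M[R]_n).

Lemma real_analytic_lie_word w phi : real_analytic phi -> real_analytic (lie_word B w phi).
Proof. by move=> H; elim: w => [|i w IH] //=; apply: real_analytic_lieC. Qed.

Lemma lie_word_cat v w phi : lie_word B (v ++ w) phi = lie_word B v (lie_word B w phi).
Proof. by rewrite /lie_word foldr_cat. Qed.

Lemma lie_wordD w phi psi : real_analytic phi -> real_analytic psi ->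
  lie_word B w (phi + psi) = lie_word B w phi + lie_word B w psi.
Proof.
by move=> H K; elim: w => [|i w IH] //=; rewrite IH lieCD//; apply: real_analytic_lie_word.
Qed.

Lemma lie_wordZ w (c : R[i]) phi : real_analytic phi ->
  lie_word B w (fun x => c * phi x) = fun x => c * lie_word B w phi x.
Proof.
by move=> H; elim: w => [|i w IH] //=; rewrite IH lieCZ//; apply: real_analytic_lie_word.
Qed.

Lemma lie_word0 w : lie_word B w (0 : G -> R[i]) = 0.
Proof. by elim: w => [|i w IH] //=; rewrite IH; apply: (lieC_cst _ 0). Qed.
End ComplexLieDerivatives.

Section Normc.
Context {R : realType}.
Implicit Types (x : R[i]).

Lemma normc_ge0 x : 0 <= normc x.
Proof. by case: x => a b; apply: sqrtr_ge0. Qed.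

Lemma normc_natr k : normc (k%:R : R[i]) = k%:R.
Proof. by rewrite -[1]/(1%C) normcMn ComplexField.Normc.normc1. Qed.

Lemma normcX x k : normc (x ^+ k) = normc x ^+ k.
Proof.
elim: k => [|k IH]; first exact: (normc_natr 1).
by rewrite !exprS ComplexField.Normc.normcM IH.
Qed.

Lemma normc_sum (I : Type) (r : seq I) (F : I -> R[i]) :
  normc (\sum_(i <- r) F i) <= \sum_(i <- r) normc (F i).
Proof.
elim: r => [|i r IH]; first by rewrite !big_nil ComplexField.Normc.normc0.
rewrite !big_cons; apply: le_trans (le_normcD _ _) _.
by rewrite lerD2l.
Qed.
End Normc.

Lemma sum_tuple_cat (V : zmodType) (n k p : nat) (F : seq 'I_n -> V) :
  \sum_(w : (k + p).-tuple 'I_n) F w =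
  \sum_(w : k.-tuple 'I_n) \sum_(u : p.-tuple 'I_n) F (w ++ u).
Proof.
elim: k F => [|k IH] F.
  by rewrite (sum_tuple0 (fun w => \sum_(u : p.-tuple 'I_n) F (w ++ u))).
rewrite (sum_tupleS _ (fun w => \sum_(u : p.-tuple 'I_n) F (w ++ u))).
rewrite (@sum_tupleS _ _ (k + p) F); apply: eq_bigr => i _.
exact: (IH (fun w => F (i :: w))).
Qed.

Section AnalyticNorms.
Context {R : realType} {n : nat} {G : lieGroupType R n}.
Context (B : 'M[R]_n) (r : R) (r_ge0 : 0 <= r).
Implicit Types (phi psi : G -> R[i]) (w : seq 'I_n) (c : R).
Local Notation normcM := ComplexField.Normc.normcM.

Definition jet (k : nat) phi : R := \sum_(w : k.-tuple 'I_n) normc (lie_word B w phi 1%g).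

Lemma jet_ge0 k phi : 0 <= jet k phi.
Proof. by apply: sumr_ge0 => w _; apply: normc_ge0. Qed.

Lemma jetD k phi psi : real_analytic phi -> real_analytic psi ->
  jet k (phi + psi) <= jet k phi + jet k psi.
Proof.
move=> H K; rewrite /jet -big_split/=; apply: ler_sum => w _.
by rewrite lie_wordD// fctE le_normcD.
Qed.

Lemma jetZ k (a : R[i]) phi : real_analytic phi ->
  jet k (fun x => a * phi x) = normc a * jet k phi.
Proof.
move=> H; rewrite /jet mulr_sumr; apply: eq_bigr => w _.
by rewrite lie_wordZ// normcM.
Qed.

Lemma jet_0 k : jet k 0 = 0.
Proof. by rewrite /jet big1// => w _; rewrite lie_word0 ComplexField.Normc.normc0. Qed.

(** The letter split off is the innermost one, which acts first; the Leibniz rule is then applied to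
    the function itself and not to a derivative of it. *)
Lemma jetS k phi : jet k.+1 phi = \sum_i jet k (lieC (row i B) phi).
Proof.
rewrite /jet -addn1 (sum_tuple_cat _ _ (fun w => normc (lie_word B w phi 1%g))).
rewrite exchange_big/= (sum_tupleS _ (fun u => \sum_(w : k.-tuple 'I_n) normc (lie_word B (w ++ u) phi 1%g))).
apply: eq_bigr => i _.
rewrite (sum_tuple0 (fun u => \sum_(w : k.-tuple 'I_n) normc (lie_word B (w ++ i :: u) phi 1%g))).
by apply: eq_bigr => w _; rewrite lie_word_cat.
Qed.

Lemma jet_lie_word k w phi : jet k (lie_word B w phi) <= jet (k + size w) phi.
Proof.
rewrite /jet (sum_tuple_cat _ _ (fun w => normc (lie_word B w phi 1%g))).
apply: ler_sum => u _; rewrite (bigD1 (in_tuple w))//= lie_word_cat lerDl.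
by apply: sumr_ge0 => v _; apply: normc_ge0.
Qed.

Lemma sum_binS (a b : nat -> R) k :
  \sum_(j < k.+2) 'C(k.+1, j)%:R * (a j * b (k.+1 - j)%N) =
  \sum_(j < k.+1) 'C(k, j)%:R * (a j.+1 * b (k - j)%N + a j * b (k.+1 - j)%N).
Proof.
rewrite big_ord_recl /=.
under eq_bigr do rewrite /bump /= add1n binS natrD mulrDl subSS.
rewrite big_split/= addrA addrC [RHS](eq_bigr _ (fun j _ => mulrDr _ _ _)) big_split/=; congr (_ + _).
have -> : \sum_(j < k.+1) 'C(k, j)%:R * (a j * b (k.+1 - j)%N) =
  \sum_(j < k.+2) 'C(k, j)%:R * (a j * b (k.+1 - j)%N).
  by rewrite [RHS]big_ord_recr /= bin_small// mul0r addr0.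
by rewrite [RHS]big_ord_recl /= !bin0; congr (_ + _).
Qed.

Lemma jetM k phi psi : real_analytic phi -> real_analytic psi ->
  jet k (fun x => phi x * psi x) <=
  \sum_(j < k.+1) 'C(k, j)%:R * (jet j phi * jet (k - j) psi).
Proof.
elim: k phi psi => [|k IH] phi psi H K.
  rewrite big_ord1 bin0 mul1r /jet !(sum_tuple0 (fun w => normc (lie_word B w _ 1%g))).
  by rewrite /= normcM.
rewrite jetS [leRHS](sum_binS (jet^~ phi) (jet^~ psi)).
apply: (@le_trans _ _ (\sum_i \sum_(j < k.+1) 'C(k, j)%:R *
   (jet j (lieC (row i B) phi) * jet (k - j) psi + jet j phi * jet (k - j) (lieC (row i B) psi)))).
  apply: ler_sum => i _; rewrite lieCM//.
  have Hi := real_analytic_lieC (row i B) H; have Ki := real_analytic_lieC (row i B) K.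
  apply: le_trans (jetD _ _ _) _; [exact: real_analyticM|exact: real_analyticM|].
  rewrite [leRHS](eq_bigr _ (fun j _ => mulrDr _ _ _)) big_split/=.
  by apply: lerD; apply: IH.
rewrite exchange_big/=; apply: ler_sum => j _.
rewrite -mulr_sumr big_split/= -mulr_suml -mulr_sumr -!jetS subSn//.
by rewrite -ltnS.
Qed.

Definition qweight (k : nat) : R := k`!%:R `^ (r - 1).

Lemma qweight_ge0 k : 0 <= qweight k. Proof. exact: powR_ge0. Qed.

Lemma qweightE k : qweight k = k`!%:R `^ r / k`!%:R.
Proof. by rewrite /qweight powRB ?powRr1 ?ler0n// ?pnatr_eq0 -?lt0n ?fact_gt0 ?implybT. Qed.

(** Partial sums stay real. Bounds uniform in [K] pass to [qnorm] by [qnorm_part] and also yield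
    membership in [ER]. *)
Definition qpart (K : nat) c phi : R := \sum_(k < K) qweight k * c ^+ k * jet k phi.

Lemma qpart_ge0 K c phi : 0 <= c -> 0 <= qpart K c phi.
Proof.
move=> c0; apply: sumr_ge0 => k _.
by rewrite !mulr_ge0 ?qweight_ge0 ?exprn_ge0 ?jet_ge0.
Qed.

Lemma qpart_mono K c c' phi : 0 <= c -> c <= c' -> qpart K c phi <= qpart K c' phi.
Proof.
move=> c0 cc; apply: ler_sum => k _; rewrite ler_wpM2r ?jet_ge0// ler_wpM2l ?qweight_ge0//.
by rewrite lerXn2r ?nnegrE// (le_trans c0).
Qed.

Lemma qpartD K c phi psi : 0 <= c -> real_analytic phi -> real_analytic psi ->
  qpart K c (phi + psi) <= qpart K c phi + qpart K c psi.
Proof.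
move=> c0 H H'; rewrite /qpart -big_split/=; apply: ler_sum => k _.
by rewrite -mulrDr ler_wpM2l ?jetD// mulr_ge0 ?qweight_ge0 ?exprn_ge0.
Qed.

Lemma qpartZ K c (a : R[i]) phi : real_analytic phi ->
  qpart K c (fun x => a * phi x) = normc a * qpart K c phi.
Proof.
move=> H; rewrite /qpart mulr_sumr; apply: eq_bigr => k _.
by rewrite jetZ// mulrCA.
Qed.

Lemma sum_conv_le (a b : nat -> R) K : (forall j, 0 <= a j) -> (forall j, 0 <= b j) ->
  \sum_(k < K) \sum_(j < k.+1) a j * b (k - j)%N <= (\sum_(j < K) a j) * \sum_(l < K) b l.
Proof.
move=> a0 b0; pose F j k := if (j <= k)%N then a j * b (k - j)%N else 0.
have -> : \sum_(k < K) \sum_(j < k.+1) a j * b (k - j)%N = \sum_(k < K) \sum_(j < K) F j k.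
  apply: eq_bigr => k _; rewrite [RHS](@sum_trunc _ _ k.+1 (fun j => F j k))//.
    by apply: eq_bigr => j _; rewrite /F -ltnS ltn_ord.
  by move=> j kj; rewrite /F leqNgt kj.
rewrite exchange_big/= mulr_suml; apply: ler_sum => j _.
rewrite (@sum_shift _ _ j)//; first last.
- by move=> k kj; rewrite /F leqNgt kj.
- exact: ltnW.
rewrite mulr_sumr [leRHS](bigID (fun l : 'I_K => (l < K - j)%N))/=.
rewrite ler_wpDr//; first by apply: sumr_ge0 => l _; rewrite mulr_ge0.
rewrite (big_ord_widen_cond K xpredT (fun k => F j (k + j)%N)) ?leq_subr//.
by apply: ler_sum => l _; rewrite /F leq_addl addnK.
Qed.

(* In terms of factorials the left-hand side is 'C(k, j)^r times the product
   of the weights of j and k - j. *)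
Lemma bin_powr k j : (j <= k)%N ->
  qweight k * 'C(k, j)%:R <= (2 `^ r) ^+ k * (qweight j * qweight (k - j)).
Proof.
move=> jk; have C0 : (0 < 'C(k, j))%N by rewrite bin_gt0.
have -> : qweight k * 'C(k, j)%:R = 'C(k, j)%:R `^ r * (qweight j * qweight (k - j)).
  rewrite !qweightE -(bin_fact jk) !natrM !powRM ?mulr_ge0 ?ler0n//.
  field; rewrite !pnatr_eq0 -!lt0n !fact_gt0 C0 //.
rewrite ler_wpM2r ?mulr_ge0 ?qweight_ge0//.
rewrite -powR_mulrn ?powR_ge0// -powRrM [r * _]mulrC powRrM.
rewrite ge0_ler_powR ?nnegrE ?ler0n ?powR_ge0// powR_mulrn// -natrX ler_nat.
rewrite -[X in (X ^ _)%N]/(1 + 1)%N expnDn.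
under eq_bigr do rewrite !exp1n !muln1.
have kl : (j < k.+1)%N by rewrite ltnS.
by rewrite (bigD1 (Ordinal kl))//= leq_addr.
Qed.

Lemma qpartM K c phi psi : 0 <= c -> real_analytic phi -> real_analytic psi ->
  qpart K c (fun x => phi x * psi x) <=
  qpart K (2 `^ r * c) phi * qpart K (2 `^ r * c) psi.
Proof.
move=> c0 H H'; set d := 2 `^ r * c.
have d0 : 0 <= d by rewrite mulr_ge0 ?powR_ge0.
pose a f k := qweight k * d ^+ k * jet k f.
have a0 f k : 0 <= a f k by rewrite !mulr_ge0 ?qweight_ge0 ?exprn_ge0 ?jet_ge0.
apply: le_trans (sum_conv_le K (a0 phi) (a0 psi)); apply: ler_sum => k _.
apply: (@le_trans _ _ (qweight k * c ^+ k *
    \sum_(j < k.+1) 'C(k, j)%:R * (jet j phi * jet (k - j) psi))).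
  by rewrite ler_wpM2l ?jetM// mulr_ge0 ?qweight_ge0 ?exprn_ge0.
rewrite mulr_sumr; apply: ler_sum => j _; have jk : (j <= k)%N by rewrite -ltnS.
have E (x y z u v : R) : x * y * (z * (u * v)) = (x * z) * (y * (u * v)) by ring.
rewrite E /a.
apply: (@le_trans _ _ ((2 `^ r) ^+ k * (qweight j * qweight (k - j)) *
    (c ^+ k * (jet j phi * jet (k - j) psi)))).
  by rewrite ler_wpM2r ?bin_powr// !mulr_ge0 ?exprn_ge0 ?jet_ge0.
have -> : (2 `^ r) ^+ k * (qweight j * qweight (k - j)) * (c ^+ k * (jet j phi * jet (k - j) psi)) =
    d ^+ k * (qweight j * qweight (k - j) * (jet j phi * jet (k - j) psi)).
  by rewrite /d exprMn; move: (qweight _) (qweight _) (jet _ _) (jet _ _) => *; ring.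
rewrite -{1}(subnKC jk) exprD.
by move: (qweight _) (qweight _) (jet _ _) (jet _ _) (d ^+ _) (d ^+ _) => *; rewrite le_eqVlt; apply/orP; left; apply/eqP; ring.
Qed.

(** (k+p)! is at most 2^(k+p) k! p!, and k!^r increases with k because [r >= 0]. *)
Lemma qweight_shift k p : qweight k <= p`!%:R * (2 ^+ (k + p) * qweight (k + p)).
Proof.
rewrite !qweightE.
have kp : ((k + p)`! = 'C(k + p, p) * (p`! * k`!))%N by rewrite -{3}(addnK p k) bin_fact// leq_addl.
have C2 : ('C(k + p, p)%:R : R) <= 2 ^+ (k + p).
  rewrite -natrX ler_nat -[X in (X ^ _)%N]/(1 + 1)%N expnDn.
  under eq_bigr do rewrite !exp1n !muln1.
  have kl : (p < (k + p).+1)%N by rewrite ltnS leq_addl.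
  by rewrite (bigD1 (Ordinal kl))//= leq_addr.
rewrite ler_pdivrMr ?ltr0n ?fact_gt0//.
apply: (@le_trans _ _ ((k + p)`!%:R `^ r)).
  by rewrite ge0_ler_powR ?nnegrE ?ler0n// ler_nat leq_fact// leq_addr.
have -> : p`!%:R * (2 ^+ (k + p) * ((k + p)`!%:R `^ r / (k + p)`!%:R)) * k`!%:R =
    2 ^+ (k + p) * (p`! * k`!)%:R / (k + p)`!%:R * (k + p)`!%:R `^ r :> R.
  by rewrite natrM; move: (_ `^ _) (_^-1) (p`!%:R) (k`!%:R) => *; ring.
rewrite ler_peMl ?powR_ge0// ler_pdivlMr ?ltr0n ?fact_gt0// mul1r {1}kp natrM.
by rewrite ler_wpM2r.
Qed.

(** Derivatives of order k of a derivative along [w] are among those of order [k + size w]. The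
    maximum with 1 lets [c ^+ k] be replaced by a power with the larger exponent. *)
Lemma qpart_lie_word K c w phi : 0 <= c ->
  qpart K c (lie_word B w phi) <=
  (size w)`!%:R * qpart (K + size w) (2 * Num.max c 1) phi.
Proof.
move=> c0; set d := 2 * _; set p := size w.
have m1 : 1 <= Num.max c 1 by rewrite le_max lexx orbT.
have m0 : 0 <= Num.max c 1 by apply: le_trans m1.
have d0 : 0 <= d by rewrite mulr_ge0.
rewrite /qpart mulr_sumr.
rewrite [leRHS](bigID (fun s : 'I_(K + p) => (p <= s)%N))/= ler_wpDr//.
  by apply: sumr_ge0 => s _; rewrite !mulr_ge0 ?qweight_ge0 ?exprn_ge0 ?jet_ge0.
pose F s : R := if (p <= s)%N then p`!%:R * (qweight s * d ^+ s * jet s phi) else 0.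
have -> : \sum_(i < K + p | (p <= i)%N) p`!%:R * (qweight i * d ^+ i * jet i phi) = \sum_(i < K + p) F i.
  by rewrite [LHS]big_mkcond.
rewrite (@sum_shift _ (K + p) p F) ?leq_addl//; last first.
  by move=> k kp; rewrite /F leqNgt kp.
rewrite addnK; apply: ler_sum => k _; rewrite /F leq_addl.
have E (x y z u : R) : x * (y * z * u) = (x * y) * (z * u) by ring.
rewrite E -mulrA.
apply: (@le_trans _ _ (p`!%:R * (2 ^+ (k + p) * qweight (k + p)) *
   (Num.max c 1 ^+ (k + p) * jet (k + p) phi))).
  apply: ler_pM; rewrite ?qweight_ge0 ?qweight_shift ?mulr_ge0 ?exprn_ge0 ?jet_ge0//.
  apply: ler_pM; rewrite ?exprn_ge0 ?jet_ge0 ?jet_lie_word//.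
  apply: (@le_trans _ _ (Num.max c 1 ^+ k)).
    by rewrite lerXn2r ?nnegrE// le_max lexx.
  by rewrite ler_weXn2l// leq_addr.
rewrite /d exprMn; move: (qweight _) (jet _ _) (_ ^+ _) (_ ^+ _) (_`!%:R) => *.
by rewrite le_eqVlt; apply/orP; left; apply/eqP; ring.
Qed.

Definition qn c phi : R := fine (qnorm B r c phi).

Lemma qnorm_part c phi (M : R) : 0 <= c ->
  (forall K, qpart K c phi <= M) <-> (qnorm B r c phi <= M%:E)%E.
Proof.
move=> c0.
have a0 k : (0 <= ((k`!%:R `^ (r - 1)) * c ^+ k * jet k phi)%:E)%E.
  by rewrite lee_fin !mulr_ge0 ?qweight_ge0 ?exprn_ge0 ?jet_ge0.
have E K : (\sum_(0 <= k < K) ((k`!%:R `^ (r - 1)) * c ^+ k * jet k phi)%:E)%E = (qpart K c phi)%:E.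
  by rewrite sumEFin big_mkord.
split=> H.
  apply: lime_le; first exact: is_cvg_nneseries.
  by apply: nearW => K; rewrite E lee_fin.
move=> K; rewrite -lee_fin -E; apply: le_trans H.
exact: nneseries_lim_ge.
Qed.

Lemma ER_analytic phi : ER B r phi -> real_analytic phi. Proof. by case. Qed.

Lemma qnorm_ge0 c phi : 0 <= c -> (0 <= qnorm B r c phi)%E.
Proof.
move=> c0; apply: nneseries_ge0 => k _ _.
by rewrite lee_fin !mulr_ge0 ?qweight_ge0 ?exprn_ge0 ?jet_ge0.
Qed.

Lemma qnormE c phi : 0 <= c -> ER B r phi -> qnorm B r c phi = (qn c phi)%:E.
Proof.
move=> c0 [_ /(_ c c0) H]; rewrite /qn fineK// fin_numE -ltey H andbT.
by apply/eqP => E; have := qnorm_ge0 phi c0; rewrite E.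
Qed.

Lemma qn_ge0 c phi : 0 <= c -> 0 <= qn c phi.
Proof. by move=> c0; apply: fine_ge0; apply: qnorm_ge0. Qed.

Lemma qpart_le_qn K c phi : 0 <= c -> ER B r phi -> qpart K c phi <= qn c phi.
Proof. move=> c0 H; have : (qnorm B r c phi <= (qn c phi)%:E)%E by rewrite qnormE.
by move/(qnorm_part _ _ c0); apply. Qed.

Lemma qn_le c phi M : 0 <= c -> ER B r phi ->
  (forall K, qpart K c phi <= M) -> qn c phi <= M.
Proof. by move=> c0 H /(qnorm_part _ _ c0); rewrite qnormE// lee_fin. Qed.

Lemma ER_bounded phi : real_analytic phi ->
  (forall c, 0 <= c -> exists M, forall K, qpart K c phi <= M) -> ER B r phi.
Proof.
move=> H B'; split=> // c c0; have [M /(qnorm_part _ _ c0)/le_lt_trans] := B' c c0.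
by apply; rewrite ltry.
Qed.

Lemma qn_mono c c' phi : 0 <= c -> c <= c' -> ER B r phi -> qn c phi <= qn c' phi.
Proof.
move=> c0 cc H; apply: qn_le => // K; apply: le_trans (qpart_mono _ _ c0 cc) _.
by apply: qpart_le_qn => //; apply: le_trans cc.
Qed.

Lemma ER0 : ER B r (0 : G -> R[i]).
Proof.
apply: ER_bounded; first exact: real_analytic0.
by move=> c _; exists 0 => K; rewrite /qpart big1// => k _; rewrite jet_0 mulr0.
Qed.

Lemma ERD phi psi : ER B r phi -> ER B r psi -> ER B r (phi + psi).
Proof.
move=> H K; apply: ER_bounded => [|c c0].
  by apply: real_analyticD; apply: ER_analytic.
exists (qn c phi + qn c psi) => N; apply: le_trans (qpartD _ c0 _ _) _; try exact: ER_analytic.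
by apply: lerD; apply: qpart_le_qn.
Qed.

Lemma qnD c phi psi : 0 <= c -> ER B r phi -> ER B r psi ->
  qn c (phi + psi) <= qn c phi + qn c psi.
Proof.
move=> c0 H K; apply: qn_le => // [|N]; first exact: ERD.
apply: le_trans (qpartD _ c0 _ _) _; try exact: ER_analytic.
by apply: lerD; apply: qpart_le_qn.
Qed.

Lemma qn0 c : 0 <= c -> qn c 0 = 0.
Proof.
move=> c0; apply/eqP; rewrite eq_le qn_ge0// andbT; apply: qn_le => //; first exact: ER0.
by move=> K; rewrite /qpart big1// => k _; rewrite jet_0 mulr0.
Qed.

Lemma ERZ (a : R[i]) phi : ER B r phi -> ER B r (fun x => a * phi x).
Proof.
move=> H; have Ha := ER_analytic H; apply: ER_bounded => [|c c0].
  exact: real_analyticZ.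
exists (normc a * qn c phi) => N; rewrite qpartZ// ler_wpM2l ?normc_ge0//.
exact: qpart_le_qn.
Qed.

Lemma qnZ c (a : R[i]) phi : 0 <= c -> ER B r phi ->
  qn c (fun x => a * phi x) <= normc a * qn c phi.
Proof.
move=> c0 H; have Ha := ER_analytic H; apply: qn_le => // [|N]; first exact: ERZ.
rewrite qpartZ// ler_wpM2l ?normc_ge0//; exact: qpart_le_qn.
Qed.

Lemma powr2_ge0 : 0 <= 2 `^ r :> R. Proof. exact: powR_ge0. Qed.

Lemma ERM phi psi : ER B r phi -> ER B r psi -> ER B r (fun x => phi x * psi x).
Proof.
move=> H K; have Ha := ER_analytic H; have Ka := ER_analytic K.
apply: ER_bounded => [|c c0]; first exact: real_analyticM.
have d0 : 0 <= 2 `^ r * c by rewrite mulr_ge0 ?powr2_ge0.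
exists (qn (2 `^ r * c) phi * qn (2 `^ r * c) psi) => N.
by apply: le_trans (qpartM _ c0 Ha Ka) _; apply: ler_pM; rewrite ?qpart_ge0 ?qpart_le_qn.
Qed.

Lemma qnM c phi psi : 0 <= c -> ER B r phi -> ER B r psi ->
  qn c (fun x => phi x * psi x) <= qn (2 `^ r * c) phi * qn (2 `^ r * c) psi.
Proof.
move=> c0 H K; have Ha := ER_analytic H; have Ka := ER_analytic K.
have d0 : 0 <= 2 `^ r * c by rewrite mulr_ge0 ?powr2_ge0.
apply: qn_le => // [|N]; first exact: ERM.
by apply: le_trans (qpartM _ c0 Ha Ka) _; apply: ler_pM; rewrite ?qpart_ge0 ?qpart_le_qn.
Qed.

Lemma ER_lie_word w phi : ER B r phi -> ER B r (lie_word B w phi).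
Proof.
move=> H; apply: ER_bounded => [|c c0]; first exact/real_analytic_lie_word/ER_analytic.
exists ((size w)`!%:R * qn (2 * Num.max c 1) phi) => K.
apply: le_trans (qpart_lie_word _ _ _ c0) _; rewrite ler_wpM2l//.
by apply: qpart_le_qn => //; rewrite mulr_ge0// le_max ler01 orbT.
Qed.

Lemma qn_lie_word c w phi : 0 <= c -> ER B r phi ->
  qn c (lie_word B w phi) <= (size w)`!%:R * qn (2 * Num.max c 1) phi.
Proof.
move=> c0 H; apply: qn_le => // [|K]; first exact: ER_lie_word.
apply: le_trans (qpart_lie_word _ _ _ c0) _; rewrite ler_wpM2l//.
by apply: qpart_le_qn => //; rewrite mulr_ge0// le_max ler01 orbT.
Qed.
End AnalyticNorms.

(** * The projective tensor product topology *)

Section ProjectiveNorm.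
Context {R : realType} {n : nat}.
Local Notation normcM := (@ComplexField.Normc.normcM R).
Local Notation normc0 := (@ComplexField.Normc.normc0 R).

Lemma normc_prod (I : Type) (s : seq I) (F : I -> R[i]) :
  normc (\prod_(i <- s) F i) = \prod_(i <- s) normc (F i).
Proof.
elim: s => [|i s IH]; first by rewrite !big_nil (normc_natr 1).
by rewrite !big_cons normcM IH.
Qed.

Lemma sum_tuple_prod k (x : 'I_k -> 'I_n -> R) :
  \sum_(w : k.-tuple 'I_n) \prod_(l < k) x l (tnth w l) = \prod_(l < k) \sum_i x l i.
Proof.
rewrite bigA_distr_bigA /= (reindex (@tuple_of_finfun 'I_n k)) /=; last first.
  exists (@finfun_of_tuple 'I_n k) => w _; first exact: tuple_of_finfunK.
  exact: finfun_of_tupleK.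
by apply: eq_bigr => f _; apply: eq_bigr => l _; rewrite tnth_mktuple.
Qed.

(** The triangle inequality bounds every decomposition from below, and the expansion in products of
    basis vectors attains the bound. *)
Lemma proj_tensor_normE k (t : tensor R n k) : proj_tensor_norm t = \sum_w normc (t w).
Proof.
rewrite /proj_tensor_norm; set S := (X in inf X).
have lb : lbound S (\sum_w normc (t w)).
  move=> _ [N [a [x [tE ->]]]].
  apply: (@le_trans _ _ (\sum_w \sum_j normc (a j) * \prod_(l < k) normc (x j l (tnth w l)))).
    apply: ler_sum => w _; rewrite tE; apply: le_trans (normc_sum _ _) _.
    by apply: ler_sum => j _; rewrite normcM normc_prod.
  rewrite exchange_big/=; apply: ler_sum => j _; rewrite -mulr_sumr.
  by rewrite (sum_tuple_prod (fun l i => normc (x j l i))).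
have inS : S (\sum_w normc (t w)).
  pose v j : k.-tuple 'I_n := @enum_val _ xpredT j.
  exists #|{: k.-tuple 'I_n}|, (fun j => t (v j)), (fun j l i => (i == tnth (v j) l)%:R).
  split=> [w|].
    rewrite -(@big_enum_val _ _ _ _ xpredT (fun u => t u * \prod_(l < k) (tnth w l == tnth u l)%:R)).
    rewrite (bigD1 w)//= big1 ?mulr1 ?big1 ?addr0//.
      move=> u uw; suff [l /negPf lP] : exists l, tnth w l != tnth u l.
        by rewrite (bigD1 l)//= lP mul0r mulr0.
      apply/existsP; apply: contraNT uw; rewrite negb_exists => /forallP H.
      by apply/eqP/eq_from_tnth => l; apply/esym/eqP; have := H l; rewrite negbK.
    by move=> l _; rewrite eqxx.
  rewrite (@big_enum_val _ _ _ _ xpredT (fun u => normc (t u))).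
  apply: eq_bigr => j _; rewrite big1 ?mulr1// => l _.
  by rewrite /l1norm (bigD1 (tnth (v j) l))//= eqxx (normc_natr 1) big1 ?addr0// => i /negPf ->; exact: (normc_natr 0).
apply/eqP; rewrite eq_le; apply/andP; split.
  by apply: ge_inf => //; exists (\sum_w normc (t w)).
by apply: lb_le_inf => //; exists (\sum_w normc (t w)).
Qed.

Lemma normc_sum_single (T : eqType) (s : seq T) (p : pred T) (a : T -> R[i]) (m0 : T) : uniq s ->
  (forall m, m != m0 -> a m = 0) ->
  normc (\sum_(m <- s | p m) a m) = \sum_(m <- s | p m) normc (a m).
Proof.
move=> us a0; rewrite big_mkcond [RHS]big_mkcond/=.
have [ms|ms] := boolP (m0 \in s); last first.
  have z m : m \in s -> a m = 0.
    by move=> mi; apply: a0; apply: contraNneq ms => <-.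
  rewrite !big_seq !big1 ?normc0// => m /z ->; case: (p m); rewrite ?normc0//.
rewrite !(bigD1_seq m0)//= !big1 ?addr0//; first by case: (p m0); rewrite ?normc0.
  by move=> m /a0 ->; rewrite normc0; case: (p m).
by move=> m /a0 ->; case: (p m).
Qed.

Lemma sum_sym_tensor k (v : Sym R n) :
  \sum_w normc (sym_tensor k v w) =
  \sum_(m <- msupp v | size (mword m) == k) normc (cf m v).
Proof.
pose c m (w : k.-tuple 'I_n) : nat := (\sum_(s : 'S_(size (mword m))) (permw s == w :> seq 'I_n))%N.
transitivity (\sum_(w : k.-tuple 'I_n) \sum_(m <- msupp v | size (mword m) == k)
    normc (cf m v) / k`!%:R * (c m w)%:R).
  apply: eq_bigr => w _; rewrite /sym_tensor ffunE.
  (* Only the monomial with the content of [w] has a component at [w], so the modulus passes through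
     the sum without loss. *)
  rewrite (@normc_sum_single _ _ _ _ (content w)) ?fset_uniq//.
    apply: eq_bigr => m _; rewrite !normcM cfE ComplexField.Normc.normcV !normc_natr.
    by rewrite -natr_sum normc_natr.
  move=> m mw; rewrite big1 ?mulr0// => s _; case: eqP => // sw.
  case/eqP: mw; rewrite -(mwordK m) -sw.
  by apply/esym/perm_contentP/(perm_permt (in_tuple (mword m)) s).
rewrite exchange_big/=; apply: eq_bigr => m /eqP mk.
rewrite -mulr_sumr -natr_sum /c exchange_big/=.
have -> : (\sum_(s : 'S_(size (mword m))) \sum_(w : k.-tuple 'I_n) (permw s == w :> seq 'I_n) = k`!)%N.
  rewrite -[in RHS]mk -[in RHS]card_Sn -sum1_card; apply: eq_bigr => s _.
  have sk : size (permw s) == k by rewrite size_map size_enum_ord mk.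
  rewrite (bigD1 (Tuple sk))//= eqxx big1// => w ws.
  by apply/eqP; rewrite eqb0; apply: contra ws => /eqP e; apply/eqP/val_inj.
by rewrite mulfVK// pnatr_eq0 -lt0n fact_gt0.
Qed.

Lemma pnormE (rho c : R) (v : Sym R n) :
  pnorm rho c v = wnorm (@ComplexField.Normc.normc R) (gweight rho c 0) v.
Proof.
rewrite /pnorm.
transitivity (\sum_(k < @mmeasure _ _ mdeg v) \sum_(m <- msupp v | size (mword m) == k)
   normc (cf m v) * gweight rho c 0 k).
  apply: eq_bigr => k _; rewrite proj_tensor_normE sum_sym_tensor mulrC mulr_suml.
  by apply: eq_bigr => m _; rewrite /gweight addn0.
under eq_bigr do rewrite big_mkcond/=.
rewrite exchange_big/= /wnorm big_seq [RHS]big_seq; apply: eq_bigr => m mv.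
have mk : (mdeg m < @mmeasure _ _ mdeg v)%N by exact: mmeasure_mnm_lt.
rewrite (bigD1 (Ordinal mk))//= size_mword eqxx big1 ?addr0// => k km.
by case: eqP => // e; case/eqP: km; apply: val_inj; rewrite /= e.
Qed.
End ProjectiveNorm.

Lemma cf_sum_mk_seq (K : choiceType) (V : zmodType) (s : seq K) (F : K -> V) k : uniq s ->
  cf k (\sum_(m <- s) mk m (F m)) = if k \in s then F k else 0.
Proof.
move=> us; rewrite cf_sum; case: ifPn => ks.
  rewrite (bigD1_seq k)//= cf_mkk big1 ?addr0// => m mk.
  by rewrite cf_mk (negPf mk).
rewrite big_seq big1// => m ms; rewrite cf_mk; case: eqP => // mk.
by rewrite -mk ms in ks.
Qed.

HB.lock Definition scaleF (R : realType) (n : nat) (G : lieGroupType R n)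
    (a : R[i]) (P : FSym G) : FSym G := fscale a P.

HB.lock Definition tensF (R : realType) (n : nat) (G : lieGroupType R n)
    (phi : G -> R[i]) (v : Sym R n) : FSym G := tprod phi v.

Lemma fscaleE (R : realType) (n : nat) (G : lieGroupType R n) :
  @fscale R n G = @scaleF R n G.
Proof. by rewrite unlock. Qed.

Lemma tprodE (R : realType) (n : nat) (G : lieGroupType R n) :
  @tprod R n G = @tensF R n G.
Proof. by rewrite unlock. Qed.

Section FunctionCoefficients.
Context {R : realType} {n : nat} {G : lieGroupType R n}.
Implicit Types (P Q : FSym G) (phi psi : G -> R[i]) (v : Sym R n) (m : cmonom 'I_n).
Local Notation normc := (@ComplexField.Normc.normc R).

Lemma cf_tensF phi v m : cf m (tensF phi v) = fun g => phi g * cf m v.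
Proof.
rewrite -tprodE /tprod; under eq_bigr do rewrite mkE cfE.
rewrite (cf_sum_mk_seq (fun m g => phi g * cf m v)) ?fset_uniq//; case: ifP => // /negbT/cf_outdom ->.
by apply/funext => g; rewrite mulr0.
Qed.

Lemma cf_scaleF (a : R[i]) P m : cf m (scaleF a P) = fun g => a * cf m P g.
Proof.
rewrite -fscaleE /fscale; under eq_bigr do rewrite mkE cfE.
rewrite (cf_sum_mk_seq (fun m g => a * cf m P g)) ?fset_uniq//; case: ifP => // /negbT/cf_outdom ->.
by apply/funext => g; rewrite mulr0.
Qed.

Lemma tensF_mono phi m : tensF phi (mono m) = mk m phi :> FSym G.
Proof.
apply: cf_ext => k; rewrite cf_tensF cf_mono cf_mk.
by apply/funext => g; case: eqP => _; rewrite ?mulr1// mulr0.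
Qed.

Lemma scaleFD (a : R[i]) P Q : scaleF a (P + Q) = scaleF a P + scaleF a Q.
Proof.
apply: cf_ext => m; rewrite cfD !cf_scaleF cfD.
by apply/funext => g; rewrite !fctE mulrDr.
Qed.

Lemma scaleFDl (a b : R[i]) P : scaleF (a + b) P = scaleF a P + scaleF b P.
Proof.
apply: cf_ext => m; rewrite cfD !cf_scaleF.
by apply/funext => g; rewrite !fctE mulrDl.
Qed.

Lemma scaleFA (a b : R[i]) P : scaleF a (scaleF b P) = scaleF (a * b) P.
Proof. by apply: cf_ext => m; rewrite !cf_scaleF; apply/funext => g; rewrite mulrA. Qed.

Lemma scaleF1 P : scaleF 1 P = P.
Proof. by apply: cf_ext => m; rewrite cf_scaleF; apply/funext => g; rewrite mul1r. Qed.

Lemma scaleF0 (a : R[i]) : scaleF a (0 : FSym G) = 0.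
Proof. by apply: cf_ext => m; rewrite cf_scaleF cf0; apply/funext => g; rewrite mulr0. Qed.

Lemma scaleF0l P : scaleF 0 P = 0.
Proof. by apply: cf_ext => m; rewrite cf_scaleF cf0; apply/funext => g; rewrite mul0r. Qed.

Lemma scaleF_sum (a : R[i]) (I : Type) (s : seq I) (p : pred I) (F : I -> FSym G) :
  scaleF a (\sum_(i <- s | p i) F i) = \sum_(i <- s | p i) scaleF a (F i).
Proof.
apply: (big_morph (scaleF a)); [exact: scaleFD | exact: scaleF0].
Qed.

Lemma tensF_sum phi (I : Type) (s : seq I) (v : I -> Sym R n) :
  tensF phi (\sum_(i <- s) v i) = \sum_(i <- s) tensF phi (v i).
Proof.
apply: (big_morph (tensF phi)) => [u w|]; apply: cf_ext => m.
  by rewrite cfD !cf_tensF cfD; apply/funext => g; rewrite !fctE mulrDr.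
by rewrite cf_tensF !cf0; apply/funext => g; rewrite mulr0.
Qed.

Lemma tensFDl phi psi v : tensF (phi + psi) v = tensF phi v + tensF psi v.
Proof.
apply: cf_ext => m; rewrite cfD !cf_tensF.
by apply/funext => g; rewrite !fctE mulrDl.
Qed.

Lemma tensFZl (a : R[i]) phi v : tensF (fun g => a * phi g) v = scaleF a (tensF phi v).
Proof.
by apply: cf_ext => m; rewrite cf_scaleF !cf_tensF; apply/funext => g; rewrite mulrA.
Qed.

Lemma tensFZr (a : R[i]) phi v : tensF phi (a *: v) = scaleF a (tensF phi v).
Proof.
by apply: cf_ext => m; rewrite cf_scaleF !cf_tensF cfZ; apply/funext => g; rewrite mulrCA.
Qed.

Definition lift (W : zmodType) (T : cmonom 'I_n -> (G -> R[i]) -> W) P : W :=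
  \sum_(m <- msupp P) T m (cf m P).

Lemma liftD (W : zmodType) (T : cmonom 'I_n -> (G -> R[i]) -> W) P Q :
  (forall m, T m 0 = 0) ->
  (forall m, T m (cf m P + cf m Q) = T m (cf m P) + T m (cf m Q)) ->
  lift T (P + Q) = lift T P + lift T Q.
Proof. by move=> T0 TD; apply: (big_msuppD (F := T)). Qed.

Lemma lift_mk (W : zmodType) (T : cmonom 'I_n -> (G -> R[i]) -> W) m phi :
  (forall m, T m 0 = 0) -> lift T (mk m phi) = T m phi.
Proof. by move=> T0; exact: (big_msuppU m phi T0). Qed.

Lemma lift_scaleF (T : cmonom 'I_n -> (G -> R[i]) -> FSym G) (a : R[i]) P :
  (forall m, T m 0 = 0) ->
  (forall m, T m (fun g => a * cf m P g) = scaleF a (T m (cf m P))) ->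
  lift T (scaleF a P) = scaleF a (lift T P).
Proof.
move=> T0 TZ; rewrite {2}/lift scaleF_sum /lift.
rewrite (big_msuppw (F := T) (fset_uniq (msupp P)) _ T0).
  by apply: eq_bigr => m _; rewrite cf_scaleF TZ.
move=> m; rewrite -!cf_neq0; apply: contraNN => /eqP mP; rewrite cf_scaleF mP.
by apply/eqP/funext => g; rewrite mulr0.
Qed.

Context (B : 'M[R]_n) (r : R) (r_ge0 : 0 <= r).

Definition pol P : Prop := forall m, ER B r (cf m P).

Lemma pol0 : pol 0. Proof. by move=> m; rewrite cf0; apply: ER0. Qed.

Lemma polD P Q : pol P -> pol Q -> pol (P + Q).
Proof. by move=> H K m; rewrite cfD; apply: ERD. Qed.

Lemma polZ (a : R[i]) P : pol P -> pol (scaleF a P).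
Proof. by move=> H m; rewrite cf_scaleF; apply: ERZ. Qed.

Lemma pol_sum (I : Type) (s : seq I) (p : pred I) (F : I -> FSym G) :
  (forall i, pol (F i)) -> pol (\sum_(i <- s | p i) F i).
Proof.
move=> H; elim: s => [|i s IH]; first by rewrite big_nil; apply: pol0.
by rewrite big_cons; case: (p i) => //; apply: polD.
Qed.

Lemma pol_tensF phi v : ER B r phi -> pol (tensF phi v).
Proof.
move=> H m; rewrite cf_tensF; have := ERZ (cf m v) H.
by congr ER; apply/funext => g; rewrite mulrC.
Qed.

Lemma pol_mk m phi : ER B r phi -> pol (mk m phi).
Proof. by rewrite -tensF_mono; apply: pol_tensF. Qed.

Lemma pol_tensors P :
  P = \sum_(j < size (msupp P : seq _))
    tensF (cf (tnth (in_tuple (msupp P : seq _)) j) P) (mono (tnth (in_tuple (msupp P : seq _)) j)).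
Proof.
under eq_bigr do rewrite tensF_mono.
rewrite -(big_tnth _ _ (msupp P : seq _) xpredT (fun m => mk m (cf m P))).
exact: malg_mkE.
Qed.

Lemma inPolP P : inPol B r P <-> pol P.
Proof.
rewrite /inPol tprodE; split=> [[N [phi [v [H ->]]]]|H]; first by apply: pol_sum => j; apply: pol_tensF.
exists (size (msupp P : seq _)), (fun j => cf (tnth (in_tuple (msupp P : seq _)) j) P),
  (fun j => mono (tnth (in_tuple (msupp P : seq _)) j)).
by split; [move=> j; exact: H | exact: pol_tensors].
Qed.

Lemma lift_pol (T : cmonom 'I_n -> (G -> R[i]) -> FSym G) P :
  (forall m phi, ER B r phi -> pol (T m phi)) -> pol P -> pol (lift T P).
Proof. by move=> HT H; apply: pol_sum => m; apply: HT. Qed.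

Context (rho : R).
Local Notation W := (gweight rho).

Definition Nrm (c c' : R) P : R := \sum_(m <- msupp P) qn B r c (cf m P) * W c' 0 (mdeg m).

Section Bounds.
Context (c c' : R) (c_ge0 : 0 <= c) (c'_ge0 : 0 <= c').

Let W0 k : 0 <= W c' 0 k. Proof. by rewrite gweight_ge0. Qed.

Let F m phi := qn B r c phi * W c' 0 (mdeg m).

Let F0 m : F m 0 = 0. Proof. by rewrite /F qn0// mul0r. Qed.

Lemma Nrm_ge0 P : 0 <= Nrm c c' P.
Proof. by apply: sumr_ge0 => m _; rewrite mulr_ge0// qn_ge0. Qed.

Lemma Nrm0 : Nrm c c' 0 = 0.
Proof. by rewrite /Nrm msupp0 big_seq_fset0. Qed.

Lemma NrmD P Q : pol P -> pol Q -> Nrm c c' (P + Q) <= Nrm c c' P + Nrm c c' Q.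
Proof.
move=> H K; rewrite /Nrm.
rewrite (big_msuppw (F := F) (msupp2_uniq P Q) (@msupp2D _ _ P Q) F0).
rewrite (big_msuppw (F := F) (msupp2_uniq P Q) (@msupp2l _ _ P Q) F0).
rewrite (big_msuppw (F := F) (msupp2_uniq P Q) (@msupp2r _ _ P Q) F0).
rewrite -big_split/=; apply: ler_sum => m _.
by rewrite cfD -mulrDl ler_wpM2r// qnD.
Qed.

Lemma Nrm_sum (I : Type) (s : seq I) (T : I -> FSym G) : (forall i, pol (T i)) ->
  Nrm c c' (\sum_(i <- s) T i) <= \sum_(i <- s) Nrm c c' (T i).
Proof.
move=> H; elim: s => [|i s IH]; first by rewrite !big_nil Nrm0.
rewrite !big_cons; apply: le_trans (NrmD _ _) _ => //; last by rewrite lerD2l.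
exact: pol_sum.
Qed.

Lemma NrmZ (a : R[i]) P : pol P -> Nrm c c' (scaleF a P) <= normc a * Nrm c c' P.
Proof.
move=> H; rewrite /Nrm (big_msuppw (F := F) (fset_uniq (msupp P)) _ F0); last first.
  move=> m; rewrite -!cf_neq0; apply: contraNN => /eqP mP; rewrite cf_scaleF mP.
  by apply/eqP/funext => g; rewrite mulr0.
rewrite mulr_sumr; apply: ler_sum => m _.
by rewrite cf_scaleF mulrA ler_wpM2r// qnZ.
Qed.

Lemma Nrm_mk m phi : Nrm c c' (mk m phi) = qn B r c phi * W c' 0 (mdeg m).
Proof. exact: (big_msuppU m phi F0). Qed.

Lemma Nrm_tensF phi v : ER B r phi ->
  Nrm c c' (tensF phi v) <= qn B r c phi * wnorm normc (W c' 0) v.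
Proof.
move=> H; rewrite /Nrm (big_msuppw (F := F) (fset_uniq (msupp v)) _ F0); last first.
  move=> m; rewrite -!cf_neq0; apply: contraNN => /eqP mP; rewrite cf_tensF mP.
  by apply/eqP/funext => g; rewrite mulr0.
rewrite mulr_sumr; apply: ler_sum => m _.
rewrite cf_tensF mulrA ler_wpM2r// mulrC.
have -> : (fun g => phi g * cf m v) = fun g => cf m v * phi g by apply/funext => g; rewrite mulrC.
exact: qnZ.
Qed.

(** Subadditivity of [Nrm] and [Nrm_tensF] bound any decomposition from below; the decomposition
    into coefficients and monomials attains the infimum. *)
Lemma pol_normE P : pol P -> pol_norm B r rho c c' P = (Nrm c c' P)%:E.
Proof.
move=> H; rewrite /pol_norm tprodE; apply/eqP; rewrite eq_le; apply/andP; split; last first.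
  apply: le_ereal_inf_tmp => _ [N [phi [v [E PE ->]]]].
  under eq_bigr do rewrite qnormE// pnormE -EFinM.
  rewrite sumEFin lee_fin PE; apply: le_trans (Nrm_sum _ _) _.
    by move=> j; apply: pol_tensF.
  by apply: ler_sum => j _; apply: Nrm_tensF.
apply: ereal_inf_lbound; exists (size (msupp P : seq _)),
  (fun j => cf (tnth (in_tuple (msupp P : seq _)) j) P),
  (fun j => mono (tnth (in_tuple (msupp P : seq _)) j)).
split; [by move=> j; exact: H | exact: pol_tensors |].
under eq_bigr do rewrite qnormE// pnormE -EFinM (wnorm_mono normc_natr).
rewrite sumEFin; congr EFin.
exact: (big_tnth _ _ (msupp P : seq _) xpredT (fun m => qn B r c (cf m P) * W c' 0 (mdeg m))).
Qed.
End Bounds.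

Lemma Nrm_mono c c' d d' P : 0 <= c -> c <= d -> 0 <= c' -> c' <= d' -> pol P ->
  Nrm c c' P <= Nrm d d' P.
Proof.
move=> c0 cd c'0 c'd' H; apply: ler_sum => m _.
apply: ler_pM; rewrite ?qn_ge0 ?gweight_ge0 ?qn_mono//.
rewrite /gweight ler_wpM2l ?factp_ge0// lerXn2r ?nnegrE//.
exact: le_trans c'd'.
Qed.
End FunctionCoefficients.

(** * The Weyl star product on polynomials *)

Section PolLinear.
Context {R : realType} {n : nat} {G : lieGroupType R n}.
Context (B : 'M[R]_n) (r : R).
Implicit Types (P Q : FSym G) (phi psi : G -> R[i]) (m : cmonom 'I_n).
Local Notation normc := (@ComplexField.Normc.normc R).
Local Notation pol := (pol B r).
Local Notation ER := (ER B r).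

(** Linearity is claimed on [pol] only, because Lie derivatives take junk values on functions that
    are not analytic. *)
Definition pol_linear (T : FSym G -> FSym G) : Prop :=
  [/\ forall P, pol P -> pol (T P),
      forall P Q, pol P -> pol Q -> T (P + Q) = T P + T Q
    & forall (a : R[i]) P, pol P -> T (scaleF a P) = scaleF a (T P)].

Lemma pol_linear0 T : pol_linear T -> T 0 = 0.
Proof. by case=> _ _ TZ; have := TZ 0 0 (pol0 B r); rewrite scaleF0 scaleF0l. Qed.

Lemma pol_linear_sum T (I : Type) (s : seq I) (F : I -> FSym G) : pol_linear T ->
  (forall i, pol (F i)) -> T (\sum_(i <- s) F i) = \sum_(i <- s) T (F i).
Proof.
move=> TL H; elim: s => [|i s IH]; first by rewrite !big_nil pol_linear0.
have [_ TD _] := TL; rewrite !big_cons TD ?IH//; exact: pol_sum.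
Qed.

Lemma pol_linear_id : pol_linear id. Proof. by []. Qed.

Lemma pol_linear_comp T S : pol_linear T -> pol_linear S -> pol_linear (T \o S).
Proof.
move=> [Tp TD TZ] [Sp SD SZ]; split=> [P H|P Q H K|a P H] /=.
- exact/Tp/Sp.
- by rewrite SD// TD//; apply: Sp.
- by rewrite SZ// TZ//; apply: Sp.
Qed.

Lemma pol_linear_iter T k : pol_linear T -> pol_linear (iter k T).
Proof.
move=> TL; elim: k => [|k IH]; first exact: pol_linear_id.
exact: (pol_linear_comp TL IH).
Qed.

Lemma pol_linear_scale (a : R[i]) T : pol_linear T -> pol_linear (fun P => scaleF a (T P)).
Proof.
move=> [Tp TD TZ]; split=> [P H|P Q H K|b P H].
- exact/polZ/Tp.
- by rewrite TD// scaleFD.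
- by rewrite TZ// !scaleFA mulrC.
Qed.

Lemma pol_linear_add T S : pol_linear T -> pol_linear S -> pol_linear (fun P => T P + S P).
Proof.
move=> [Tp TD TZ] [Sp SD SZ]; split=> [P H|P Q H K|b P H].
- by apply: polD; [apply: Tp|apply: Sp].
- by rewrite TD// SD// addrACA.
- by rewrite TZ// SZ// scaleFD.
Qed.

Lemma pol_linear_zero : pol_linear (fun=> 0).
Proof. by split=> [P _|P Q _ _|b P _]; [exact: pol0|rewrite addr0|rewrite scaleF0]. Qed.

Lemma pol_linear_bigsum (I : Type) (s : seq I) (T : I -> FSym G -> FSym G) :
  (forall i, pol_linear (T i)) -> pol_linear (fun P => \sum_(i <- s) T i P).
Proof.
move=> H; elim: s => [|i s IH].
  have -> : (fun P => \sum_(i <- [::]) T i P) = fun=> 0 by apply/funext => P; rewrite big_nil.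
  exact: pol_linear_zero.
have -> : (fun P => \sum_(i <- i :: s) T i P) = fun P => T i P + \sum_(i <- s) T i P.
  by apply/funext => P; rewrite big_cons.
exact: pol_linear_add.
Qed.

Lemma pol_linear_lift (T : cmonom 'I_n -> (G -> R[i]) -> FSym G) :
  (forall m phi, ER phi -> pol (T m phi)) ->
  (forall m phi psi, ER phi -> ER psi -> T m (phi + psi) = T m phi + T m psi) ->
  (forall m (a : R[i]) phi, ER phi -> T m (fun g => a * phi g) = scaleF a (T m phi)) ->
  pol_linear (lift T).
Proof.
move=> Tp TD TZ.
have T0 m : T m 0 = 0.
  have := TZ m 0 0 (ER0 B r); rewrite scaleF0l => <-; congr T.
  by apply/funext => g; rewrite mul0r.
split=> [P H|P Q H K|a P H].
- exact: lift_pol.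
- by rewrite liftD// => m; rewrite TD.
- by rewrite lift_scaleF// => m; rewrite TZ.
Qed.

Lemma pol_mkE P : P = \sum_(m <- msupp P) mk m (cf m P).
Proof. exact: malg_mkE. Qed.

Lemma mkZF (a : R[i]) m phi : mk m (fun g => a * phi g) = scaleF a (mk m phi) :> FSym G.
Proof. by rewrite -!tensF_mono tensFZl. Qed.
End PolLinear.

(** * The operator Delta and its exponential *)

Section DeltaOperator.
Context {R : realType} {n : nat} {G : lieGroupType R n}.
Context (B : 'M[R]_n).
Implicit Types (P Q : FSym G) (phi psi : G -> R[i]) (m : cmonom 'I_n).

Definition omit m l : cmonom 'I_n := content (take l (mword m) ++ drop l.+1 (mword m)).

Definition del m phi : FSym G :=
  \sum_(l < size (mword m))
    mk (omit m l) (lieC (row (tnth (in_tuple (mword m)) l) B) phi).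

Lemma mdeg_omit m l : (l < size (mword m))%N -> mdeg (omit m l) = (mdeg m).-1.
Proof.
move=> lm; rewrite mdeg_content size_cat size_take size_drop lm -size_mword.
by move: lm; case: (size _) => // k lm; rewrite subSS subnKC.
Qed.
End DeltaOperator.

HB.lock Definition DelF (R : realType) (n : nat) (G : lieGroupType R n) (B : 'M[R]_n)
    (P : FSym G) : FSym G := lift (del B) P.

(** [exp_Delta] is truncated at a degree that depends on [P], which hides its linearity; with a free
    order [M] it is visible, and every degree bound of [P] gives the same value. *)
HB.lock Definition expF (R : realType) (n : nat) (G : lieGroupType R n) (B : 'M[R]_n)
    (M : nat) (a : R[i]) (P : FSym G) : FSym G :=
  \sum_(k < M) scaleF (a ^+ k / k`!%:R) (iter k (DelF B) P).

Section DeltaEstimates.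
Context {R : realType} {n : nat} {G : lieGroupType R n}.
Context (B : 'M[R]_n) (r : R) (r_ge0 : 0 <= r).
Implicit Types (P Q : FSym G) (phi psi : G -> R[i]) (m : cmonom 'I_n).
Local Notation normc := (@ComplexField.Normc.normc R).
Local Notation pol := (pol B r).
Local Notation ER := (ER B r).
Local Notation DelF := (@DelF R n G B).
Local Notation expF := (@expF R n G B).

Lemma DeltaE P : Delta B P = DelF P.
Proof.
rewrite unlock /Delta /lift; apply: eq_bigr => m _; rewrite /del.
by apply: eq_bigr => l _; rewrite tprodE sym_wordE tensF_mono cfE.
Qed.

Lemma ER_lieC i phi : ER phi -> ER (lieC (row i B) phi).
Proof. exact: (ER_lie_word r_ge0 [:: i]). Qed.

Lemma pol_linear_DelF : pol_linear B r DelF.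
Proof.
have -> : DelF = lift (del B) by rewrite unlock.
apply: pol_linear_lift => [m phi H|m phi psi H K|m a phi H].
- by apply: pol_sum => l; apply: pol_mk; apply: ER_lieC.
- rewrite -big_split/=; apply: eq_bigr => l _.
  by rewrite lieCD; [exact: mk_D | exact: ER_analytic H | exact: ER_analytic K].
- rewrite scaleF_sum; apply: eq_bigr => l _.
  by rewrite lieCZ; [exact: mkZF | exact: ER_analytic H].
Qed.

Lemma pol_iter_DelF k P : pol P -> pol (iter k DelF P).
Proof. by move=> H; have [+ _ _] := pol_linear_iter k pol_linear_DelF; apply. Qed.

Lemma DelF_mk m phi : DelF (mk m phi) = del B m phi.
Proof.
rewrite unlock lift_mk// => k; rewrite /del big1// => l _.
by rewrite (lieC_cst _ 0) mk_0.
Qed.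

Lemma degbound_DelF N P : degbound N P -> degbound N.-1 (DelF P).
Proof.
rewrite unlock => H; rewrite /lift big_seq; elim/big_ind: _ => [k _|x y Hx Hy|m mP].
- by rewrite cf0.
- exact: degboundD.
have mN : (mdeg m < N)%N.
  by rewrite ltnNge; apply/negP => /H/eqP; rewrite -[_ == _]negbK cf_neq0 mP.
apply: degbound_sum => l k kN; rewrite cf_mk; case: eqP => // ok.
have lm := ltn_ord l; have := size_mword m; move: kN; rewrite -ok mdeg_omit// => kN sm.
by exfalso; move: lm kN sm mN; clear; lia.
Qed.

Lemma iter_DelF_eq0 N k P : degbound N P -> (N <= k)%N -> iter k DelF P = 0.
Proof.
elim: k N P => [|k IH] N P H Nk; first by apply: degbound_eq0; apply: degboundW Nk H.
rewrite iterSr; apply: (IH _ _ (degbound_DelF H)).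
by move: Nk; clear; lia.
Qed.

Lemma exp_DeltaE M (a : R[i]) P : degbound M P -> exp_Delta B a P = expF M a P.
Proof.
move=> H; rewrite unlock /exp_Delta fscaleE.
have DE : Delta B = DelF by apply/funext => Q; exact: DeltaE.
rewrite DE; pose t k := scaleF (a ^+ k / k`!%:R) (iter k DelF P).
have z N k : degbound N P -> (N <= k)%N -> t k = 0.
  by move=> HN Nk; rewrite /t (iter_DelF_eq0 HN Nk) scaleF0.
set D := @mmeasure _ _ mdeg P; have HD : degbound D P by exact: degbound_msize.
transitivity (\sum_(k < D + M) t k).
  by rewrite (@sum_trunc _ (D + M) D t) ?leq_addr// => k; apply: z.
by rewrite (@sum_trunc _ (D + M) M t) ?leq_addl// => k; apply: z.
Qed.

Lemma pol_linear_expF M a : pol_linear B r (expF M a).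
Proof.
have -> : expF M a = fun P => \sum_(k < M) scaleF (a ^+ k / k`!%:R) (iter k DelF P) by rewrite unlock.
by apply: pol_linear_bigsum => k; apply: pol_linear_scale; apply: pol_linear_iter; apply: pol_linear_DelF.
Qed.

Context (rho : R) (rho_ge1 : 1 <= rho).
Local Notation Nrm := (Nrm B r rho).
Local Notation factp := (factp rho).

Section Bounds.
Context (c c' : R) (c_ge0 : 0 <= c) (c'_ge0 : 0 <= c').
(** The constant of [qn_lie_word]. *)
Let C := 2 * Num.max c 1.

(* The factor (|u| + k)! of the k additional derivatives is compensated by the
   1 / k! of the exponential series, and the falling factorial by the weight. *)
Lemma Nrm_iter_DelF_mk k m u phi : ER phi ->
  Nrm c c' (iter k DelF (mk m (lie_word B u phi))) <=
  (mdeg m ^_ k)%:R * (factp (mdeg m - k) * c' ^+ (mdeg m - k)) *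
  ((size u + k)`!%:R * qn B r C phi).
Proof.
move=> H; elim: k m u => [|k IH] m u.
  rewrite /= Nrm_mk// /gweight ffactn0 mul1r subn0 !addn0 mulrC.
  by rewrite ler_wpM2l ?qn_lie_word// mulr_ge0 ?factp_ge0 ?exprn_ge0.
rewrite iterSr DelF_mk /del (pol_linear_sum _ (pol_linear_iter k pol_linear_DelF)); last first.
  by move=> l; apply: pol_mk; apply: ER_lieC; apply: ER_lie_word.
apply: le_trans (Nrm_sum _ _ _ _ _) _ => //.
  by move=> l; apply: pol_iter_DelF; apply: pol_mk; apply: ER_lieC; apply: ER_lie_word.
apply: (@le_trans _ _ (\sum_(l < size (mword m))
   ((mdeg m).-1 ^_ k)%:R * (factp ((mdeg m).-1 - k) * c' ^+ ((mdeg m).-1 - k)) *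
  ((size u + k.+1)`!%:R * qn B r C phi))).
  apply: ler_sum => l _; have := IH (omit m l) (tnth (in_tuple (mword m)) l :: u).
  by rewrite /= mdeg_omit// addSnnS.
rewrite sumr_const card_ord size_mword -[leLHS]mulr_natl ffactnS natrM !mulrA.
by case: (mdeg m) => [|d]; rewrite ?mul0r//= subSS.
Qed.

(** The falling factorial is at least 1, so its power [rho >= 1], contained in the weight of [d],
    dominates it. *)
Lemma ffact_factp d k : (k <= d)%N -> (d ^_ k)%:R * factp (d - k) <= factp d.
Proof.
move=> kd; rewrite /factp -(ffact_fact kd) natrM powRM ?ler0n//.
by rewrite ler_wpM2r ?powR_ge0// le1r_powR// ler1n ffact_gt0.
Qed.

Lemma Nrm_iter_DelF k P : pol P ->
  Nrm c c' (iter k DelF P) <= \sum_(m <- msupp P)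
  (mdeg m ^_ k)%:R * (factp (mdeg m - k) * c' ^+ (mdeg m - k)) *
  (k`!%:R * qn B r C (cf m P)).
Proof.
move=> H; rewrite {1}(pol_mkE P) (pol_linear_sum _ (pol_linear_iter k pol_linear_DelF)); last first.
  by move=> l; apply: pol_mk.
apply: le_trans (Nrm_sum _ _ _ _ _) _ => //.
  by move=> m; apply: pol_iter_DelF; apply: pol_mk.
by apply: ler_sum => m _; apply: (@Nrm_iter_DelF_mk k m [::]).
Qed.

(** The factorials from the derivatives cancel those of the series, and [ffact_factp] absorbs the
    falling factorials. What remains in degree d is dominated by the binomial expansion of
    [(c' + normc a) ^+ d], whatever [M] is. *)
Lemma Nrm_expF M (a : R[i]) P : pol P ->
  Nrm c c' (expF M a P) <= Nrm C (c' + normc a) P.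
Proof.
move=> H; rewrite unlock; apply: le_trans (Nrm_sum _ _ _ _ _) _ => //.
  by move=> k; apply: polZ; apply: pol_iter_DelF.
apply: (@le_trans _ _ (\sum_(k < M) normc a ^+ k / k`!%:R * \sum_(m <- msupp P)
  (mdeg m ^_ k)%:R * (factp (mdeg m - k) * c' ^+ (mdeg m - k)) *
  (k`!%:R * qn B r C (cf m P)))).
  apply: ler_sum => k _; apply: le_trans (NrmZ _ _ _ _ _) _ => //; first exact: pol_iter_DelF.
  rewrite ComplexField.Normc.normcM ComplexField.Normc.normcV normcX normc_natr.
  by rewrite ler_wpM2l ?Nrm_iter_DelF// divr_ge0 ?exprn_ge0 ?normc_ge0.
under eq_bigr do rewrite mulr_sumr.
rewrite exchange_big/=; apply: ler_sum => m _.
have q0 : 0 <= qn B r C (cf m P) by rewrite qn_ge0// mulr_ge0// le_max ler01 orbT.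
rewrite mulrC /gweight addn0.
set d := mdeg m; pose t k := (d ^_ k)%:R * factp (d - k) * (normc a ^+ k * c' ^+ (d - k)).
have t0 k : 0 <= t k by rewrite !mulr_ge0 ?factp_ge0 ?exprn_ge0 ?normc_ge0.
apply: (@le_trans _ _ ((\sum_(k < M) t k) * qn B r C (cf m P))).
  rewrite mulr_suml; apply: ler_sum => k _; rewrite /t le_eqVlt; apply/orP; left; apply/eqP.
  have k0 : (k`!%:R : R) != 0 by rewrite pnatr_eq0 -lt0n fact_gt0.
  by move: (d ^_ k) (factp _) (_ ^+ _) (_ ^+ _) (qn _ _ _ _) (_`!%:R) k0 => x y z u v w w0; field.
rewrite ler_wpM2r//.
apply: (@le_trans _ _ (\sum_(k < M + d.+1) t k)).
  by rewrite big_split_ord/= lerDl sumr_ge0.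
rewrite (@sum_trunc _ (M + d.+1) d.+1 t) ?leq_addl//; last first.
  by move=> k dk; rewrite /t ffact_small// !mul0r.
rewrite exprDn mulr_sumr; apply: ler_sum => k _.
have kd : (k <= d)%N by rewrite -ltnS.
apply: (@le_trans _ _ (factp d * (normc a ^+ k * c' ^+ (d - k)))).
  by rewrite ler_wpM2r ?ffact_factp// mulr_ge0 ?exprn_ge0 ?normc_ge0.
rewrite ler_wpM2l ?factp_ge0// [X in X *+ _]mulrC -mulr_natr ler_peMr ?ler1n ?bin_gt0//.
by rewrite mulr_ge0 ?exprn_ge0 ?normc_ge0.
Qed.
End Bounds.
End DeltaEstimates.

(** * The standard-ordered product *)

Section StandardOrdered.
Context {R : realType} {n : nat} {G : lieGroupType R n}.
Context (B : 'M[R]_n).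
Implicit Types (P Q : FSym G) (phi psi : G -> R[i]) (m : cmonom 'I_n).

(** The truncation order is the strict degree bound of [mono m]. *)
Definition gut (z : R[i]) (u : seq 'I_n) m : Sym R n :=
  gutt_prod (fun i j k => real_complex R (struct_const G B i j k))
    (fun j => real_complex R (bern R j)) (mdeg m).+1 z u (mono m).

Definition std1 (z : R[i]) m phi m' psi : FSym G :=
  \sum_(p < (size (mword m)).+1) \sum_(s : 'S_(size (mword m)))
    scaleF (z ^+ p / (p`!%:R * (size (mword m) - p)`!%:R))
      (tensF (fun g => phi g * lie_word B (take p (permw s)) psi g)
             (gut z (drop p (permw s)) m')).
End StandardOrdered.

HB.lock Definition stdF (R : realType) (n : nat) (G : lieGroupType R n) (B : 'M[R]_n)
    (z : R[i]) (P Q : FSym G) : FSym G :=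
  lift (fun m phi => lift (std1 B z m phi) Q) P.

Section StandardOrderedEstimates.
Context {R : realType} {n : nat} {G : lieGroupType R n}.
Context (B : 'M[R]_n) (B_unit : B \in unitmx) (r : R) (r_ge0 : 0 <= r).
Implicit Types (P Q : FSym G) (phi psi : G -> R[i]) (m : cmonom 'I_n).
Local Notation normc := (@ComplexField.Normc.normc R).
Local Notation normcM := (@ComplexField.Normc.normcM R).
Local Notation normcV := (@ComplexField.Normc.normcV R).
Local Notation pol := (pol B r).
Local Notation ER := (ER B r).
Local Notation stdF := (@stdF R n G B).
Local Notation gut := (@gut R n G B).
Local Notation std1 := (@std1 R n G B).

Lemma std_starE (hbar : R[i]) P Q : std_star B hbar P Q = stdF (hbar / 'i%C) P Q.
Proof.
rewrite unlock /std_star; apply: eq_bigr => m _; apply: eq_bigr => m' _.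
apply: eq_bigr => p _; apply: eq_bigr => s _.
rewrite fscaleE tprodE !cfE; congr (scaleF _ (tensF _ _)).
rewrite [sym_word R (mword m')]sym_wordE mwordK.
by apply: gutt_star_word => //; apply: degbound_mono.
Qed.

Lemma std1Dl z m phi phi' m' psi :
  std1 z m (phi + phi') m' psi = std1 z m phi m' psi + std1 z m phi' m' psi.
Proof.
rewrite -big_split/=; apply: eq_bigr => p _; rewrite -big_split/=; apply: eq_bigr => s _.
rewrite -scaleFD -tensFDl; congr (scaleF _ (tensF _ _)).
by apply/funext => g; rewrite !fctE mulrDl.
Qed.

Lemma std1Zl z m (a : R[i]) phi m' psi :
  std1 z m (fun g => a * phi g) m' psi = scaleF a (std1 z m phi m' psi).
Proof.
rewrite scaleF_sum; apply: eq_bigr => p _; rewrite scaleF_sum; apply: eq_bigr => s _.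
rewrite [RHS]scaleFA [a * _]mulrC -[RHS]scaleFA -[in RHS]tensFZl; congr (scaleF _ (tensF _ _)).
by apply/funext => g; rewrite mulrA.
Qed.

Lemma std1Dr z m phi m' psi psi' : ER psi -> ER psi' ->
  std1 z m phi m' (psi + psi') = std1 z m phi m' psi + std1 z m phi m' psi'.
Proof.
move=> /ER_analytic H /ER_analytic H'.
rewrite -big_split/=; apply: eq_bigr => p _; rewrite -big_split/=; apply: eq_bigr => s _.
rewrite -scaleFD -tensFDl; congr (scaleF _ (tensF _ _)).
by apply/funext => g; rewrite lie_wordD// !fctE mulrDr.
Qed.

Lemma std1Zr z m (a : R[i]) phi m' psi : ER psi ->
  std1 z m phi m' (fun g => a * psi g) = scaleF a (std1 z m phi m' psi).
Proof.
move=> /ER_analytic H.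
rewrite scaleF_sum; apply: eq_bigr => p _; rewrite scaleF_sum; apply: eq_bigr => s _.
rewrite [RHS]scaleFA [a * _]mulrC -[RHS]scaleFA -[in RHS]tensFZl; congr (scaleF _ (tensF _ _)).
by apply/funext => g; rewrite lie_wordZ// mulrCA.
Qed.

Lemma pol_std1 z m phi m' psi : ER phi -> ER psi -> pol (std1 z m phi m' psi).
Proof.
move=> H K; apply: pol_sum => p; apply: pol_sum => s; apply: polZ; apply: pol_tensF.
by apply: ERM => //; apply: ER_lie_word.
Qed.

Lemma std1r_linear z m phi : ER phi -> pol_linear B r (lift (std1 z m phi)).
Proof.
move=> H; apply: pol_linear_lift => [m' psi K|m' psi psi' K K'|m' a psi K].
- exact: pol_std1.
- exact: std1Dr.
- exact: std1Zr.
Qed.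

Lemma stdF_linearr z P : pol P -> pol_linear B r (stdF z P).
Proof.
move=> H; have -> : stdF z P = fun Q => \sum_(m <- msupp P) lift (std1 z m (cf m P)) Q.
  by apply/funext => Q; rewrite unlock.
by apply: pol_linear_bigsum => m; apply: std1r_linear.
Qed.

Lemma stdF_linearl z Q : pol Q -> pol_linear B r (stdF z ^~ Q).
Proof.
move=> K; have -> : stdF z ^~ Q = lift (fun m phi => lift (std1 z m phi) Q).
  by apply/funext => P; rewrite unlock.
apply: pol_linear_lift => [m phi H|m phi phi' H H'|m a phi H].
- by have [+ _ _] := std1r_linear z m H; apply.
- by rewrite /lift -big_split/=; apply: eq_bigr => m' _; rewrite std1Dl.
- by rewrite /lift scaleF_sum; apply: eq_bigr => m' _; rewrite std1Zl.
Qed.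

Lemma pol_stdF z P Q : pol P -> pol Q -> pol (stdF z P Q).
Proof. by move=> H K; have [+ _ _] := stdF_linearl z K; apply. Qed.

Context (rho : R) (rho_ge1 : 1 <= rho).
Local Notation Nrm := (Nrm B r rho).
Local Notation factp := (factp rho).

Definition struct_bound : R := \sum_a \sum_b \sum_c `|struct_const G B a b c|.

Lemma normc_real (x : R) : normc (real_complex R x) = `|x|.
Proof. by rewrite /= expr0n addr0 sqrtr_sqr. Qed.

Lemma struct_bound_ge0 : 0 <= struct_bound.
Proof. by do 3! (apply: sumr_ge0 => ? _). Qed.

Lemma struct_boundP a b : \sum_c normc (real_complex R (struct_const G B a b c)) <= struct_bound.
Proof.
under eq_bigr do rewrite normc_real.
have gen (F : 'I_n -> 'I_n -> 'I_n -> R) : (forall a b c, 0 <= F a b c) ->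
    \sum_c F a b c <= \sum_a \sum_b \sum_c F a b c.
  move=> F0; rewrite [leRHS](bigD1 a)//= [X in _ <= X + _](bigD1 b)//= -addrA lerDl addr_ge0//.
    by do 2! (apply: sumr_ge0 => ? _).
  by do 3! (apply: sumr_ge0 => ? _).
by apply: (gen (fun a b c => `|struct_const G B a b c|)) => ? ? ?; apply: normr_ge0.
Qed.

Section Bounds.
Context (c c' z0 : R) (c_ge0 : 0 <= c) (c'_ge0 : 0 <= c') (z0_ge0 : 0 <= z0).

(** [std_c] combines the Leibniz constant of [qnM] with that of [qn_lie_word]. [std_gutt] dominates
    [c'] and meets the smallness condition of [wnorm_gutt_left], the summand 1 keeping it
    positive. *)
Definition std_c : R := 2 * Num.max (2 `^ r * c) 1.
Definition std_gutt : R := c' + 2 * (z0 * struct_bound) + 1.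
Definition std_c' : R := z0 + 2 * std_gutt * 2 `^ rho.

Lemma std_gutt_gt0 : 0 < std_gutt.
Proof. by rewrite /std_gutt ltr_wpDl// addr_ge0// !mulr_ge0// struct_bound_ge0. Qed.

Lemma std_c_ge0 : 0 <= std_c. Proof. by rewrite mulr_ge0// le_max ler01 orbT. Qed.

Lemma std_c'_ge0 : 0 <= std_c'.
Proof. by rewrite addr_ge0// !mulr_ge0 ?powR_ge0// ltW// std_gutt_gt0. Qed.

Lemma wnorm_gut z u m : normc z <= z0 ->
  wnorm normc (gweight rho c' 0) (gut z u m) <=
  (2 * std_gutt * 2 `^ rho) ^+ (size u + mdeg m) * (factp (size u) * factp (mdeg m)).
Proof.
move=> zz; have g0 := std_gutt_gt0.
apply: (@le_trans _ _ (wnorm normc (gweight rho std_gutt 0) (gut z u m))).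
  apply: wnormW => [x|k]; first exact: normc_ge0.
  rewrite /gweight ler_wpM2l ?factp_ge0// lerXn2r ?nnegrE//; first exact: ltW.
  by rewrite /std_gutt -addrA lerDl addr_ge0// !mulr_ge0// struct_bound_ge0.
have b1 j : normc (real_complex R (bern R j)) <= 1 by rewrite normc_real bern_le1.
have H := wnorm_gutt_prod (@normc_ge0 R) (@le_normcD R) normcM normcV (@normc_natr R)
  struct_boundP struct_bound_ge0 b1 rho_ge1.
apply: H => //; apply: (@le_trans _ _ (2 * (z0 * struct_bound))).
  by rewrite ler_wpM2l// ler_wpM2r// struct_bound_ge0.
by rewrite /std_gutt addrAC lerDr addr_ge0.
Qed.

(* The binomial theorem in (z0 + M)^k absorbs the sum over p, because
   p! (k - p)!^rho <= k!^rho for rho >= 1. *)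
Lemma Nrm_std1 z m phi m' psi : normc z <= z0 -> ER phi -> ER psi ->
  Nrm c c' (std1 z m phi m' psi) <=
  (qn B r std_c phi * gweight rho std_c' 0 (mdeg m)) *
  (qn B r std_c psi * gweight rho std_c' 0 (mdeg m')).
Proof.
move=> zz H K; set k := size (mword m); set l := mdeg m'; set M := 2 * std_gutt * 2 `^ rho.
have M0 : 0 <= M by rewrite !mulr_ge0 ?powR_ge0// ltW// std_gutt_gt0.
set qf := qn B r std_c phi; set qp := qn B r std_c psi.
have qf0 : 0 <= qf by rewrite qn_ge0// std_c_ge0.
have qp0 : 0 <= qp by rewrite qn_ge0// std_c_ge0.
have d0 : 0 <= 2 `^ r * c by rewrite mulr_ge0// powR_ge0.
(* The bound for one permutation: the factorial of [p] comes from the derivatives of [psi], the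
   power of [M] from a Gutt product of a word of length [k - p] with a monomial of degree [l]. *)
pose T p := z0 ^+ p / (p`!%:R * (k - p)`!%:R) * ((qf * (p`!%:R * qp)) *
  (M ^+ ((k - p) + l) * (factp (k - p) * factp l))).
have TP p (s : 'S_k) : (p <= k)%N -> Nrm c c'
    (scaleF (z ^+ p / (p`!%:R * (k - p)`!%:R))
      (tensF (fun g => phi g * lie_word B (take p (permw s)) psi g)
             (gut z (drop p (permw s)) m'))) <= T p.
  move=> pk; have sk : size (permw s) = k by rewrite size_map size_enum_ord.
  have Hu : ER (lie_word B (take p (permw s)) psi) by apply: ER_lie_word.
  have Hfu := ERM r_ge0 H Hu.
  apply: le_trans (NrmZ _ _ _ _ _) _ => //; first exact: pol_tensF.
  rewrite /T normcM normcV normcM normcX !normc_natr.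
  apply: ler_pM; rewrite ?divr_ge0 ?mulr_ge0 ?exprn_ge0 ?normc_ge0 ?Nrm_ge0//.
    by rewrite ler_wpM2r ?invr_ge0 ?mulr_ge0// lerXn2r ?nnegrE ?normc_ge0.
  apply: le_trans (Nrm_tensF _ _ _ _ Hfu) _ => //.
  apply: ler_pM; rewrite ?qn_ge0// ?wnorm_ge0//; try by move=> *; rewrite ?normc_ge0 ?gweight_ge0.
    apply: le_trans (qnM r_ge0 c_ge0 H Hu) _; apply: ler_pM; rewrite ?qn_ge0//.
      apply: qn_mono => //; rewrite /std_c -[leLHS]mul1r ler_pM// ?ler1n//.
      by rewrite le_max lexx.
    apply: le_trans (qn_lie_word r_ge0 _ d0 K) _.
    by rewrite size_takel ?sk.
  apply: le_trans (wnorm_gut _ _ zz) _.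
  by rewrite size_drop sk.
apply: le_trans (Nrm_sum _ _ _ _ _) _ => //.
  by move=> p; apply: pol_sum => s; apply: polZ; apply: pol_tensF; apply: ERM => //; apply: ER_lie_word.
apply: (@le_trans _ _ (\sum_(p < k.+1) k`!%:R * T p)).
  apply: ler_sum => p _; apply: le_trans (Nrm_sum _ _ _ _ _) _ => //.
    by move=> s; apply: polZ; apply: pol_tensF; apply: ERM => //; apply: ER_lie_word.
  apply: (@le_trans _ _ (\sum_(s : 'S_k) T p)).
    by apply: ler_sum => s _; apply: TP; rewrite -ltnS.
  by rewrite sumr_const card_Sn [leRHS]mulr_natl.
have km : mdeg m = k by rewrite -size_mword.
rewrite /gweight !addn0 km.
apply: (@le_trans _ _ (\sum_(p < k.+1) (M ^+ (k - p) * z0 ^+ p *+ 'C(k, p)) *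
   (factp k * (M ^+ l * (factp l * (qf * qp)))))).
  apply: ler_sum => p _; have pk : (p <= k)%N by rewrite -ltnS.
  apply: (@le_trans _ _ ((M ^+ (k - p) * z0 ^+ p *+ 'C(k, p)) *
     ((p`!%:R * factp (k - p)) * (M ^+ l * (factp l * (qf * qp)))))).
    have p0 : (p`!%:R : R) != 0 by rewrite pnatr_eq0 -lt0n fact_gt0.
    have kp0 : ((k - p)`!%:R : R) != 0 by rewrite pnatr_eq0 -lt0n fact_gt0.
    rewrite /T exprD -[_ *+ 'C(k, p)]mulr_natr -(bin_fact pk) !natrM.
    move: (factp _) (factp _) (_ ^+ _) (_ ^+ _) (_ ^+ _) p0 kp0.
    move: ('C(k, p)%:R) (p`!%:R) ((k - p)`!%:R) => x1 x2 x3 x4 x5 x6 x7 x8 H1 H2.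
    by rewrite le_eqVlt; apply/orP; left; apply/eqP; field; rewrite H1 H2.
  rewrite ler_wpM2l ?mulrn_wge0 ?mulr_ge0 ?exprn_ge0// ler_wpM2r//.
    by rewrite !mulr_ge0 ?exprn_ge0 ?factp_ge0.
  apply: le_trans (ffact_factp rho_ge1 pk); rewrite ler_wpM2r ?factp_ge0// ler_nat.
  by rewrite -bin_ffact leq_pmull// bin_gt0.
rewrite -mulr_suml -exprDn [M + z0]addrC -/std_c'.
have L0 := std_c'_ge0.
have -> : qf * (factp k * std_c' ^+ k) * (qp * (factp l * std_c' ^+ l)) =
  std_c' ^+ k * (factp k * (std_c' ^+ l * (factp l * (qf * qp)))).
  by move: (factp _) (factp _) (_ ^+ _) (_ ^+ _) => *; ring.
rewrite ler_wpM2l ?exprn_ge0// ler_wpM2l ?factp_ge0// ler_wpM2r ?mulr_ge0 ?factp_ge0//.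
by rewrite lerXn2r ?nnegrE// /std_c' lerDr.
Qed.

Lemma Nrm_stdF z P Q : normc z <= z0 -> pol P -> pol Q ->
  Nrm c c' (stdF z P Q) <= Nrm std_c std_c' P * Nrm std_c std_c' Q.
Proof.
move=> zz H K; rewrite unlock /lift.
have pS m m' : pol (std1 z m (cf m P) m' (cf m' Q)) by apply: pol_std1.
apply: le_trans (Nrm_sum _ _ _ _ _) _ => //; first by move=> m; apply: pol_sum.
rewrite mulr_suml; apply: ler_sum => m _.
apply: le_trans (Nrm_sum _ _ _ _ _) _ => //.
by rewrite mulr_sumr; apply: ler_sum => m' _; apply: Nrm_std1.
Qed.
End Bounds.
End StandardOrderedEstimates.

(** * Cauchy estimates *)

Section PolynomialFunctions.
Context {C : comNzRingType}.

(** The module axioms for a scaling given as a bare function together with a subspace [D], so that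
    they cover [scaleF] on [pol] as well as genuine modules. *)
Record scaling (V : zmodType) (sc : C -> V -> V) (D : V -> Prop) : Prop := Scaling {
  scaling0 : D 0;
  scalingD : forall u v, D u -> D v -> D (u + v);
  scalingZ : forall a v, D v -> D (sc a v);
  scaling_add : forall a u v, sc a (u + v) = sc a u + sc a v;
  scaling_addl : forall a b v, sc (a + b) v = sc a v + sc b v;
  scaling_mul : forall a b v, sc a (sc b v) = sc (a * b) v;
  scaling_one : forall v, sc 1 v = v
}.

Definition polyfun (V : zmodType) (sc : C -> V -> V) (D : V -> Prop) (f : C -> V) : Prop :=
  exists s : seq (nat * V), (forall x, x \in s -> D x.2) /\
    forall h, f h = \sum_(x <- s) sc (h ^+ x.1) x.2.

Definition linear_on (V V' : zmodType) (sc : C -> V -> V) (sc' : C -> V' -> V')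
    (D : V -> Prop) (D' : V' -> Prop) (T : V -> V') : Prop :=
  [/\ forall v, D v -> D' (T v), forall u v, D u -> D v -> T (u + v) = T u + T v
    & forall a v, D v -> T (sc a v) = sc' a (T v)].

Section OneModule.
Context {V : zmodType} {sc : C -> V -> V} {D : V -> Prop} (scP : scaling sc D).
Local Notation polyfun := (polyfun sc D).

Lemma scaling_zero a : sc a 0 = 0.
Proof.
by apply: (addrI (sc a 0)); rewrite -(scaling_add scP) !addr0.
Qed.

Lemma scaling_zerol v : sc 0 v = 0.
Proof.
by apply: (addrI (sc 0 v)); rewrite -(scaling_addl scP) !addr0.
Qed.

Lemma scaling_opp a v : sc (- a) v = - sc a v.
Proof.
by apply: (addrI (sc a v)); rewrite -(scaling_addl scP) !subrr scaling_zerol.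
Qed.

Lemma scaling_sum a (I : Type) (s : seq I) (p : pred I) (F : I -> V) :
  sc a (\sum_(i <- s | p i) F i) = \sum_(i <- s | p i) sc a (F i).
Proof. exact: (big_morph (sc a) (scaling_add scP a) (scaling_zero a)). Qed.

Lemma scaling_suml (I : Type) (s : seq I) (p : pred I) (F : I -> C) v :
  sc (\sum_(i <- s | p i) F i) v = \sum_(i <- s | p i) sc (F i) v.
Proof.
exact: (big_morph (sc^~ v) (fun a b => scaling_addl scP a b v) (scaling_zerol v)).
Qed.

Lemma scaling_bigsum (I : eqType) (s : seq I) (F : I -> V) :
  (forall i, i \in s -> D (F i)) -> D (\sum_(i <- s) F i).
Proof.
move=> H; rewrite big_seq; elim/big_ind: _ => //; first exact: scaling0 scP.
exact: scalingD scP.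
Qed.

Lemma polyfun_cst v : D v -> polyfun (fun=> v).
Proof.
move=> Dv; exists [:: (0%N, v)]; split=> [x|h]; first by rewrite mem_seq1 => /eqP ->.
by rewrite big_seq1 (scaling_one scP).
Qed.

Lemma polyfun0 : polyfun (fun=> 0).
Proof. exact: polyfun_cst (scaling0 scP). Qed.

Lemma polyfunD f g : polyfun f -> polyfun g -> polyfun (fun h => f h + g h).
Proof.
move=> [s [Ds fE]] [t [Dt gE]]; exists (s ++ t); split=> [x|h].
  by rewrite mem_cat => /orP[/Ds|/Dt].
by rewrite big_cat fE gE.
Qed.

Lemma polyfun_sum (I : Type) (s : seq I) (F : I -> C -> V) :
  (forall i, polyfun (F i)) -> polyfun (fun h => \sum_(i <- s) F i h).
Proof.
move=> H; elim: s => [|i s IH].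
  by under eq_fun do rewrite big_nil; exact: polyfun0.
by under eq_fun do rewrite big_cons; exact: polyfunD.
Qed.

Lemma polyfun_scale c k f : polyfun f -> polyfun (fun h => sc (c * h ^+ k) (f h)).
Proof.
move=> [s [Ds fE]]; exists [seq ((k + x.1)%N, sc c x.2) | x <- s]; split=> [x|h].
  by move=> /mapP[y /Ds Dy ->] /=; apply: scalingZ scP _ _ Dy.
rewrite big_map fE scaling_sum; apply: eq_bigr => x _ /=.
by rewrite !(scaling_mul scP) exprD; congr (sc _ _); rewrite mulrC mulrA mulrC mulrA mulrAC -!mulrA mulrCA.
Qed.

Lemma polyfun_subst c f : polyfun f -> polyfun (fun h => f (h * c)).
Proof.
move=> [s [Ds fE]]; exists [seq (x.1, sc (c ^+ x.1) x.2) | x <- s]; split=> [x|h].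
  by move=> /mapP[y /Ds Dy ->] /=; apply: scalingZ scP _ _ Dy.
by rewrite big_map fE; apply: eq_bigr => x _ /=; rewrite (scaling_mul scP) exprMn.
Qed.

Lemma polyfun_shift c f : polyfun f -> polyfun (fun h => f (c + h)).
Proof.
move=> [s [Ds fE]].
have -> : (fun h => f (c + h)) = fun h => \sum_(x <- s) sc ((c + h) ^+ x.1) x.2.
  by apply/funext => h; rewrite fE.
elim: s Ds {fE} => [|x s IH] Ds.
  by under eq_fun do rewrite big_nil; exact: polyfun0.
under eq_fun do rewrite big_cons; apply: polyfunD; last first.
  by apply: IH => y ys; apply: Ds; rewrite in_cons ys orbT.
have Dx : D x.2 by apply: Ds; rewrite in_cons eqxx.
under eq_fun do rewrite exprDn scaling_suml.
apply: polyfun_sum => i; under eq_fun do rewrite -mulr_natl mulrA.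
exact/polyfun_scale/polyfun_cst.
Qed.

Lemma polyfun_coef f : polyfun f -> exists d (a : nat -> V),
  (forall i, D (a i)) /\ forall h, f h = \sum_(i < d) sc (h ^+ i) (a i).
Proof.
move=> [s [Ds fE]]; exists (\max_(x <- s) x.1).+1, (fun i => \sum_(x <- s | x.1 == i) x.2).
split=> [i|h].
  rewrite -big_filter; apply: scaling_bigsum => x.
  by rewrite mem_filter => /andP[_ /Ds].
rewrite fE.
transitivity (\sum_(i < (\max_(x <- s) x.1).+1) \sum_(x <- s | x.1 == i) sc (h ^+ x.1) x.2); last first.
  by apply: eq_bigr => i _; rewrite scaling_sum; apply: eq_bigr => x /eqP ->.
under [RHS]eq_bigr do rewrite big_mkcond/=.
rewrite exchange_big/= big_seq [RHS]big_seq; apply: eq_bigr => x xs.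
have mk : (x.1 < (\max_(x <- s) x.1).+1)%N by rewrite ltnS; apply: (leq_bigmax_seq (F := fun y : nat * V => y.1)).
rewrite (bigD1 (Ordinal mk))//= eqxx big1 ?addr0// => k km.
by case: eqP => // e; case/eqP: km; apply: val_inj; rewrite /= e.
Qed.
End OneModule.

(** Expanding [f h] in powers of [h] and pulling the scalars out of [F h] leaves finitely many
    polynomials. Operators that depend on hbar, applied to arguments that do so too, are handled in
    this way. *)
Lemma polyfun_diag (V V' : zmodType) (sc : C -> V -> V) (sc' : C -> V' -> V')
    (D : V -> Prop) (D' : V' -> Prop) (F : C -> V -> V') (f : C -> V) :
  scaling sc D -> scaling sc' D' ->
  (forall h, linear_on sc sc' D D' (F h)) ->
  (forall v, D v -> polyfun sc' D' (F ^~ v)) ->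
  polyfun sc D f -> polyfun sc' D' (fun h => F h (f h)).
Proof.
move=> scP scP' FL FP [s [Ds fE]].
have -> : (fun h => F h (f h)) = fun h => F h (\sum_(x <- s) sc (h ^+ x.1) x.2).
  by apply/funext => h; rewrite fE.
elim: s Ds {fE} => [|x s IH] Ds.
  have -> : (fun h => F h (\sum_(x <- [::]) sc (h ^+ x.1) x.2)) = fun=> 0.
    apply/funext => h; rewrite big_nil; have [_ _ FZ] := FL h.
    by rewrite -(scaling_zerol scP 0) FZ ?(scaling_zerol scP')//; apply: scaling0 scP.
  exact: polyfun0 scP'.
have Dx : D x.2 by apply: Ds; rewrite in_cons eqxx.
have Ds' y : y \in s -> D y.2 by move=> ys; apply: Ds; rewrite in_cons ys orbT.
have -> : (fun h => F h (\sum_(x <- x :: s) sc (h ^+ x.1) x.2)) =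
  fun h => sc' (1 * h ^+ x.1) (F h x.2) + F h (\sum_(x <- s) sc (h ^+ x.1) x.2).
  apply/funext => h; have [_ FD FZ] := FL h; rewrite big_cons FD ?FZ ?mul1r//.
    exact: (scalingZ scP).
  by apply: (scaling_bigsum scP) => y /Ds' Dy; apply: scalingZ scP _ _ Dy.
apply: (polyfunD (f := fun h => sc' (1 * h ^+ x.1) (F h x.2))
  (g := fun h => F h (\sum_(x <- s) sc (h ^+ x.1) x.2))); last exact: IH.
by apply: (polyfun_scale scP'); apply: FP.
Qed.
End PolynomialFunctions.

Section CauchyEstimate.
Context {R : realType}.
Implicit Types (h : R[i]).
Local Notation normc := (@ComplexField.Normc.normc R).
Local Notation normcM := (@ComplexField.Normc.normcM R).
Local Notation normcV := (@ComplexField.Normc.normcV R).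

(** Iterated square roots of -1 suffice; powers of 2 exceed every degree, which is all that the
    averaging over roots of unity asks for. *)
Lemma prim_root_pow2 k : exists w : R[i], (2 ^ k).-primitive_root w.
Proof.
case: k => [|k].
  have [m wm] := @prim_order_exists R[i] 1 1 isT (expr1 1).
  by rewrite dvdn1 => /eqP m1; exists 1; move: wm; rewrite m1.
have [w wk] : exists w : R[i], w ^+ (2 ^ k) = -1.
  elim: k => [|k [w wk]]; first by exists (-1); rewrite expr1.
  by exists (sqrtc w); rewrite expnS exprM sqr_sqrtc.
exists w; have w1 : w ^+ (2 ^ k.+1) = 1 by rewrite expnSr exprM wk sqrrN expr1n.
have [|m wm] := prim_order_exists _ w1; first by rewrite expn_gt0.
move/(dvdn_pfactor _ _ (isT : prime 2)) => [j jk mE]; rewrite mE in wm.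
move: jk; rewrite leq_eqVlt => /predU1P[<-//|]; rewrite ltnS => jk.
have : w ^+ (2 ^ k) == 1 by rewrite -(prim_order_dvd wm) dvdn_exp2l.
by rewrite wk eqNr oner_eq0.
Qed.

Lemma sum_prim_root (d : nat) (w : R[i]) (i j : 'I_d) : d.-primitive_root w ->
  \sum_(k < d) (w ^+ k) ^- i * (w ^+ k) ^+ j = (i == j)%:R * d%:R.
Proof.
move=> wd; have d0 := prim_order_gt0 wd.
have w0 : w != 0 by rewrite (prim_root_eq0 wd) -lt0n.
pose q := w ^- i * w ^+ j.
have -> : \sum_(k < d) (w ^+ k) ^- i * (w ^+ k) ^+ j = \sum_(k < d) q ^+ k.
  apply: eq_bigr => k _; rewrite /q exprMn -!exprVn -!exprM; congr (_ ^+ _ * _ ^+ _).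
    by rewrite mulnC.
  by rewrite mulnC.
have [ij|ij] := eqVneq i j.
  rewrite /q ij mulVf ?expf_neq0// mul1r; under eq_bigr do rewrite expr1n.
  by rewrite sumr_const card_ord.
have q1 : q != 1.
  apply: contra ij => /eqP q1; have : w ^+ i = w ^+ j by rewrite -[LHS]mulr1 -q1 mulrA divff ?mul1r// expf_neq0.
  move/eqP; rewrite (eq_prim_root_expr wd) !modn_small//.
have : (q - 1) * \sum_(k < d) q ^+ k = 0.
  rewrite -subrX1 /q exprMn -exprVn -!exprM [(i * d)%N]mulnC [(j * d)%N]mulnC !exprM.
  by rewrite exprVn (prim_expr_order wd) invr1 !expr1n mulr1 subrr.
by move/eqP; rewrite mulf_eq0 subr_eq0 (negPf q1)/= => /eqP ->; rewrite mul0r.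
Qed.

Lemma normc_prim_root (d : nat) (w : R[i]) : d.-primitive_root w -> normc w = 1.
Proof.
move=> wd; have d0 := prim_order_gt0 wd.
have : normc w ^+ d = 1 by rewrite -normcX (prim_expr_order wd) (normc_natr 1).
by move/eqP; rewrite pexprn_eq1 ?normc_ge0// => /orP[/eqP e|/eqP//]; rewrite e in d0.
Qed.

Lemma normc_subX h h' k : normc h <= 1 -> normc h' <= 1 ->
  normc (h ^+ k - h' ^+ k) <= k%:R * normc (h - h').
Proof.
move=> H H'; elim: k => [|k IH]; first by rewrite subrr (normc_natr 0) mul0r.
have -> : h ^+ k.+1 - h' ^+ k.+1 = h * (h ^+ k - h' ^+ k) + (h - h') * h' ^+ k.
  by rewrite !exprS; ring.
apply: le_trans (le_normcD _ _) _; rewrite !normcM normcX -natr1 mulrDl mul1r; apply: lerD.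
  by apply: le_trans IH; rewrite ler_piMl ?normc_ge0.
by rewrite ler_piMr ?normc_ge0// exprn_ile1 ?normc_ge0.
Qed.

Lemma sum_half_linear d : \sum_(i < d) i%:R * (2^-1 : R) ^+ i <= 2.
Proof.
suff -> : \sum_(i < d) i%:R * (2^-1 : R) ^+ i = 2 - 2 * (d%:R + 1) * 2^-1 ^+ d.
  by rewrite gerBl !mulr_ge0// ?exprn_ge0// addr_ge0.
elim: d => [|d IH]; first by rewrite big_ord0 expr0; lra.
by rewrite big_ord_recr /= IH exprS -[d.+1%:R]natr1; move: (_ ^+ d) (d%:R) => x y; field.
Qed.

Context {V : zmodType} {sc : R[i] -> V -> V} {D : V -> Prop} (scP : scaling sc D).
Context (N : V -> R).
Hypothesis N0 : N 0 = 0.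
Hypothesis N_ge0 : forall v, 0 <= N v.
Hypothesis ND : forall u v, D u -> D v -> N (u + v) <= N u + N v.
Hypothesis NZ : forall a v, D v -> N (sc a v) <= normc a * N v.

Lemma seminorm_sum (I : Type) (s : seq I) (F : I -> V) :
  (forall i, D (F i)) -> N (\sum_(i <- s) F i) <= \sum_(i <- s) N (F i).
Proof.
move=> H; elim: s => [|i s IH]; first by rewrite !big_nil N0.
rewrite !big_cons; apply: le_trans (ND _ _) _ => //; last by rewrite lerD2l.
elim: s {IH} => [|j s IH]; first by rewrite big_nil; apply: scaling0 scP.
by rewrite big_cons; apply: scalingD scP _ _ _ IH.
Qed.

(* The mean of h^(-i) f(h) over the points 2 w^l, w a primitive root of unity
   of order larger than the degree, is the coefficient a_i. *)
Lemma cauchy_coef d (a : nat -> V) (S : R) (i : 'I_d) : (forall i, D (a i)) ->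
  (forall h, normc h <= 2 -> N (\sum_(j < d) sc (h ^+ j) (a j)) <= S) ->
  N (a i) <= S * 2^-1 ^+ i.
Proof.
move=> Da HS.
pose k := d; have dk : (d <= 2 ^ k)%N by apply: ltnW; apply: ltn_expl.
have [w wp] := prim_root_pow2 k; set e := (2 ^ k)%N in dk wp.
have e0 : (0 < e)%N by rewrite expn_gt0.
have eC : (e%:R : R[i]) != 0 by rewrite pnatr_eq0 -lt0n.
pose t (l : nat) : R[i] := 2 * w ^+ l.
have t2 l : normc (t l) = 2 by rewrite normcM normcX (normc_prim_root wp) expr1n mulr1 (normc_natr 2).
pose f h := \sum_(j < d) sc (h ^+ j) (a j).
have Df h : D (f h).
  by apply: (scaling_bigsum scP) => j _; apply: scalingZ scP _ _ (Da _).
have aE : a i = \sum_(l < e) sc (e%:R^-1 * t l ^- i) (f (t l)).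
  transitivity (\sum_(j < d) sc (e%:R^-1 * \sum_(l < e) t l ^- i * t l ^+ j) (a j)).
    have E j : (j < d)%N -> e%:R^-1 * (\sum_(l < e) t l ^- i * t l ^+ j) = (val i == j)%:R.
      move=> jd; have ie := leq_trans (ltn_ord i) dk; have je := leq_trans jd dk.
      have := sum_prim_root (Ordinal ie) (Ordinal je) wp.
      rewrite -[Ordinal _ == Ordinal _]/(val i == j) => EE.
      have -> : \sum_(l < e) t l ^- i * t l ^+ j = 2 ^- i * 2 ^+ j * ((val i == j)%:R * e%:R).
        rewrite -EE mulr_sumr; apply: eq_bigr => l _ /=; rewrite /t !exprMn invfM.
        by rewrite mulrACA.
      have [<-|_] := eqVneq; last by rewrite mul0r !mulr0.
      by rewrite mul1r mulVf ?mul1r ?mulVf// expf_neq0// pnatr_eq0.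
    rewrite (bigD1 i)//= E// eqxx (scaling_one scP) big1 ?addr0// => j ji.
    by rewrite E// eq_sym (inj_eq val_inj) (negPf ji) (scaling_zerol scP).
  under [RHS]eq_bigr do rewrite (scaling_sum scP).
  rewrite exchange_big/=; apply: eq_bigr => j _.
  rewrite mulr_sumr (scaling_suml scP); apply: eq_bigr => l _.
  by rewrite (scaling_mul scP) mulrA.
rewrite aE; apply: le_trans (seminorm_sum _ _) _ => [l|]; first exact: scalingZ scP _ _ (Df _).
apply: (@le_trans _ _ (\sum_(l < e) e%:R^-1 * (S * 2^-1 ^+ i))); last first.
  by rewrite sumr_const card_ord -[leLHS]mulr_natl mulrA divff ?mul1r// pnatr_eq0 -lt0n.
apply: ler_sum => l _; apply: le_trans (NZ _ (Df _)) _.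
rewrite normcM !normcV normcX t2 normc_natr -mulrA ler_wpM2l ?invr_ge0//.
by rewrite mulrC -exprVn ler_wpM2r ?exprn_ge0// HS// t2.
Qed.

(** For [i > 0] the difference quotient of [h ^+ i] is Lipschitz on the unit disc with a constant at
    most [i], while the bound on the disc of radius 2 gives coefficients of size [S * 2^-1 ^+ i].
    The factor 2 bounds the sum of i / 2^i. *)
Lemma cauchy_difference (f : R[i] -> V) (S : R) h h' : polyfun sc D f ->
  (forall t, normc t <= 2 -> N (f t) <= S) ->
  h != 0 -> h' != 0 -> normc h <= 1 -> normc h' <= 1 ->
  N (sc h^-1 (f h - f 0) - sc h'^-1 (f h' - f 0)) <= 2 * S * normc (h - h').
Proof.
move=> /(polyfun_coef scP)[d [a [Da fE]]] HS h0 h'0 h1 h'1.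
have S0 : 0 <= S by apply: le_trans (HS 0 _); rewrite ?(normc_natr 0).
pose q (i : nat) : R[i] := h^-1 * (h ^+ i - 0 ^+ i) - h'^-1 * (h' ^+ i - 0 ^+ i).
have qN i : normc (q i) <= i%:R * normc (h - h').
  case: i => [|i]; first by rewrite /q !expr0 !subrr !mulr0 subrr (normc_natr 0) mul0r.
  rewrite /q !expr0n !subr0 !exprS !mulKf//; apply: le_trans (normc_subX i h1 h'1) _.
  by rewrite ler_wpM2r ?normc_ge0// ler_nat.
have -> : sc h^-1 (f h - f 0) - sc h'^-1 (f h' - f 0) = \sum_(i < d) sc (q i) (a i).
  have E t : sc t^-1 (f t - f 0) = \sum_(i < d) sc (t^-1 * (t ^+ i - 0 ^+ i)) (a i).
    rewrite !fE -sumrB (scaling_sum scP); apply: eq_bigr => i _.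
    by rewrite -(scaling_opp scP) -(scaling_addl scP) (scaling_mul scP).
  rewrite !E -sumrB; apply: eq_bigr => i _.
  by rewrite -(scaling_opp scP) -(scaling_addl scP).
apply: le_trans (seminorm_sum _ _) _ => [i|]; first exact: scalingZ scP _ _ (Da _).
apply: (@le_trans _ _ (\sum_(i < d) (i%:R * 2^-1 ^+ i) * (S * normc (h - h')))).
  apply: ler_sum => i _; apply: le_trans (NZ _ (Da _)) _.
  apply: (@le_trans _ _ (i%:R * normc (h - h') * (S * 2^-1 ^+ i))).
    apply: ler_pM; rewrite ?normc_ge0// cauchy_coef// => t t2.
    by have := HS t t2; rewrite fE.
  by rewrite le_eqVlt; apply/orP; left; apply/eqP; move: (_ ^+ i) (normc (_ - _)) => x y; ring.
by rewrite -mulr_suml -mulrA ler_wpM2r ?sum_half_linear// mulr_ge0 ?normc_ge0.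
Qed.
End CauchyEstimate.

Lemma cvg_prod (T U V : Type) (F : set_system T) (G : set_system U) (H : set_system V)
    (f : T -> U) (g : T -> V) : Filter F ->
  f @ F `=>` G -> g @ F `=>` H -> (fun t => (f t, g t)) @ F `=>` filter_prod G H.
Proof.
move=> FF fG gH A [[B C] /= [GB HC] BCA].
have FB : F (f @^-1` B) := fG _ GB.
have FC : F (g @^-1` C) := gH _ HC.
have FBC := @filterI _ F FF _ _ FB FC.
by apply: (@filterS _ F FF _ _ _ FBC) => t [Bt Ct]; exact: (BCA (f t, g t)).
Qed.

(** * Extension to the completion *)

Section BilinearExtension.
Context {R : realType} {E : tvsType R[i]} {X : zmodType}.
Context (sc : R[i] -> X -> X) (D : X -> Prop) (scP : scaling sc D).
Context (iota : X -> E) (N : R -> X -> R).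
Local Notation normc := (@ComplexField.Normc.normc R).
Hypothesis E_hausdorff : hausdorff_space E.
Hypothesis E_complete : tvs_complete E.
Hypothesis iota_linear : forall a P Q, D P -> D Q ->
  iota (sc a P + Q) = a *: iota P + iota Q.
Hypothesis iota_dense : closure (iota @` [set P | D P]) = setT.
Hypothesis iota_continuous : forall U : set E, nbhs 0 U ->
  exists t e : R, [/\ 0 <= t, 0 < e & forall P, D P -> N t P < e -> U (iota P)].
Hypothesis iota_open : forall t e : R, 0 <= t -> 0 < e ->
  exists2 U : set E, nbhs 0 U & forall P, D P -> U (iota P) -> N t P < e.
Hypothesis N_ge0 : forall t P, 0 <= t -> 0 <= N t P.
Hypothesis N_add : forall t P Q, 0 <= t -> D P -> D Q -> N t (P + Q) <= N t P + N t Q.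

(* The trace on D of the neighbourhoods of x: D-elements converge to x along
   this filter. *)
Definition approx (x : E) : set_system X :=
  [set A | exists2 U, nbhs x U & forall P, D P -> U (iota P) -> A P].

Lemma approx_filter x : Filter (approx x).
Proof.
split.
- by exists setT => //; exact: filterT.
- move=> A A' [U Ux UA] [U' Ux' UA']; exists (U `&` U'); first exact: filterI.
  by move=> P DP [UP UP']; split; [exact: UA|exact: UA'].
- by move=> A A' AA' [U Ux UA]; exists U => // P DP UP; apply: AA'; exact: UA.
Qed.
#[local] Existing Instance approx_filter.

Lemma approx_proper x : ProperFilter (approx x).
Proof.
split; last exact: approx_filter.
move=> [U Ux UA]; have : closure (iota @` [set P | D P]) x by rewrite iota_dense.
by move=> /(_ U Ux) [_ [[P DP <-] UP]]; exact: (UA P).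
Qed.
#[local] Existing Instance approx_proper.

Lemma approx_D x : approx x [set P | D P].
Proof. by exists setT => //; exact: filterT. Qed.

Lemma approx_nbhs x U : nbhs x U -> approx x [set P | U (iota P)].
Proof. by exists U. Qed.

Lemma iotaB P Q : D P -> D Q -> iota (P - Q) = iota P - iota Q.
Proof.
move=> DP DQ; rewrite addrC -[Q in LHS](scaling_one scP) -(scaling_opp scP).
by rewrite iota_linear// scaleN1r addrC.
Qed.

Lemma D_sub P Q : D P -> D Q -> D (P - Q).
Proof.
move=> DP DQ; apply: (scalingD scP) => //; rewrite -[Q](scaling_one scP) -(scaling_opp scP).
exact: (scalingZ scP).
Qed.

(** Subtraction is continuous at [(x, x)] and the embedding is open onto its image, so approximants
    of [x] are Cauchy for every seminorm. *)
Lemma approx_small t e x : 0 <= t -> 0 < e ->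
  exists2 A, approx x A & forall P P', A P -> A P' -> N t (P - P') < e.
Proof.
move=> t0 e0; have [U U0 UN] := iota_open t0 e0.
have subc : (fun z : E * E => z.1 - z.2) @ (x, x) --> (0 : E).
  rewrite -[X in _ --> X](subrr x).
  apply: (@cvg_comp _ _ _ (fun z : E * E => (z.1, - z.2)) (fun z : E * E => z.1 + z.2) _ (nbhs (x, - x))).
    apply: cvg_prod => /=; first exact: cvg_fst.
    apply: (@cvg_comp _ _ _ snd (fun z : E => - z) _ (nbhs x)); first exact: cvg_snd.
    exact: opp_continuous.
  exact: (@add_continuous E (x, - x)).
have [[W W'] /= [Wx Wx'] WU] := subc U U0.
exists [set P | D P /\ (W `&` W') (iota P)].
  by apply: filterI; [exact: approx_D|apply: approx_nbhs; exact: filterI].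
move=> P P' [DP [WP _]] [DP' [_ WP']]; apply: UN; first exact: D_sub.
by rewrite iotaB//; exact: (WU (iota P, iota P')).
Qed.

(** A Cauchy filter is bounded: all elements of one of its small sets lie within distance 1 of a
    chosen element. *)
Lemma approx_bounded t x : 0 <= t -> exists2 K, 0 <= K &
  approx x [set P | D P /\ N t P <= K].
Proof.
move=> t0; have [A Ax AN] := approx_small x t0 ltr01.
have [P0 [DP0 AP0]] := filter_ex (filterI (approx_D x) Ax).
exists (1 + N t P0); first by rewrite addr_ge0// N_ge0.
apply: filterS (filterI (approx_D x) Ax) => P [DP AP]; split=> //.
rewrite -[P](subrK P0); apply: le_trans (N_add t0 (D_sub DP DP0) DP0) _.
by rewrite lerD2r ltW// AN.
Qed.

Section OneMap.
Context (m : X -> X -> X).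
Hypothesis m_D : forall P Q, D P -> D Q -> D (m P Q).
Hypothesis m_addl : forall P P' Q, D P -> D P' -> D Q -> m (P + P') Q = m P Q + m P' Q.
Hypothesis m_addr : forall P Q Q', D P -> D Q -> D Q' -> m P (Q + Q') = m P Q + m P Q'.
Hypothesis m_bounded : forall t, 0 <= t -> exists t' K, [/\ 0 <= t', 0 <= K &
  forall P Q, D P -> D Q -> N t (m P Q) <= K * (N t' P * N t' Q)].

(** A bounded bilinear map is uniformly continuous only on bounded sets, which is why both filters
    are first confined to such sets. *)
Lemma extension_ex x y : exists l : E,
  (fun PQ => iota (m PQ.1 PQ.2)) @ filter_prod (approx x) (approx y) --> l.
Proof.
apply: E_complete => U /iota_continuous[t [e [t0 e0 UN]]].
have [t' [K [t'0 K0 mN]]] := m_bounded t0.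
have [K1 K10 B1] := approx_bounded x t'0; have [K2 K20 B2] := approx_bounded y t'0.
(* Chosen so that [K * (d * K2) + K * (K1 * d) < e]; the 1 avoids a zero denominator and makes the
   inequality strict. *)
pose d := e / (K * (K1 + K2) + 1).
have L0 : 0 < K * (K1 + K2) + 1 by rewrite ltr_wpDl// mulr_ge0// addr_ge0.
have d0 : 0 < d by rewrite divr_gt0.
have [A1 A1x A1N] := approx_small x t'0 d0; have [A2 A2y A2N] := approx_small y t'0 d0.
pose S := [set PQ : X * X | [/\ D PQ.1 /\ N t' PQ.1 <= K1, A1 PQ.1, D PQ.2 /\ N t' PQ.2 <= K2 & A2 PQ.2]].
have FS : filter_prod (approx x) (approx y) S.
  exists ([set P | D P /\ N t' P <= K1] `&` A1, [set P | D P /\ N t' P <= K2] `&` A2).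
    by split; exact: filterI.
  by move=> [P Q] /= [[? ?] [? ?]].
exists ((fun PQ => iota (m PQ.1 PQ.2)) @` S, (fun PQ => iota (m PQ.1 PQ.2)) @` S).
  by split; apply: filterS FS => PQ SPQ; exists PQ.
move=> [_ _] /= [[[P Q] [/= [DP P1] AP [DQ Q2] AQ] <-] [[P' Q'] [/= [DP' P'1] AP' [DQ' Q'2] AQ'] <-]] /=.
have DmP := m_D DP DQ; have DmP' := m_D DP' DQ'; have DPP := D_sub DP DP'; have DQQ := D_sub DQ DQ'.
rewrite -iotaB//; apply: UN; first exact: D_sub.
have -> : m P Q - m P' Q' = m (P - P') Q + m P' (Q - Q').
  rewrite -{1}[P](subrK P') m_addl// -addrA; congr (_ + _).
  by rewrite -{1}[Q](subrK Q') m_addr// addrK.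
apply: le_lt_trans (N_add t0 _ _) _; try exact: m_D.
apply: (@le_lt_trans _ _ (K * (d * K2) + K * (K1 * d))).
  apply: lerD; apply: le_trans (mN _ _ _ _) _ => //; rewrite ler_wpM2l//.
    by apply: ler_pM; rewrite ?N_ge0// ltW// A1N.
  by apply: ler_pM; rewrite ?N_ge0// ltW// A2N.
have -> : K * (d * K2) + K * (K1 * d) = d * (K * (K1 + K2)) by ring.
by rewrite /d mulrAC ltr_pdivrMr// ltr_pM2l// ltrDl.
Qed.

Context (star : E -> E -> E).
Hypothesis starP : forall x y,
  (fun PQ => iota (m PQ.1 PQ.2)) @ filter_prod (approx x) (approx y) --> star x y.

Lemma star_iota P Q : D P -> D Q -> star (iota P) (iota Q) = iota (m P Q).
Proof.
move=> DP DQ; apply: E_hausdorff => U V Us Vm; exists (iota (m P Q)); split; last exact: nbhs_singleton.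
have [[A A'] /= [[W Wx WA] [W' Wx' WA']] AU] := starP Us.
by apply: (AU (P, Q)); split; [apply: WA|apply: WA'] => //; exact: nbhs_singleton.
Qed.

(** By regularity of [E] the neighbourhood of the value may be taken closed: for nearby points the
    products of approximants still lie in it, and so does their limit. *)
Lemma star_continuous : continuous (fun xy : E * E => star xy.1 xy.2).
Proof.
move=> [x y] W Ws.
have [V Vs VW] : filter_from (nbhs (star x y)) closure W by exact: uniform_regular Ws.
have [[A A'] /= [[U Ux UA] [U' Ux' UA']] AV] := starP Vs.
exists (U°, U'°) => /=; first by split; apply: nbhs_interior.
move=> [x' y'] /= [Ux'' Uy'']; apply: VW => V' Vs'.
have [[A1 A1'] /= [A1x A1y] A1V] := starP Vs'.
have [P [AP A1P]] : A `&` A1 !=set0.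
  by apply: (@filter_ex _ (approx x')); apply: filterI => //; exists U.
have [Q [AQ A1Q]] : A' `&` A1' !=set0.
  by apply: (@filter_ex _ (approx y')); apply: filterI => //; exists U'.
by exists (iota (m P Q)); split; [exact: (AV (P, Q))|exact: (A1V (P, Q))].
Qed.
End OneMap.

Lemma affine_cvg (T : Type) (F : set_system T) (a : R[i]) (f g : T -> E) (u v : E) :
  Filter F -> f @ F --> u -> g @ F --> v -> (fun t => a *: f t + g t) @ F --> a *: u + v.
Proof.
move=> FF fu gv.
apply: (@cvg_comp _ _ _ (fun t => (a *: f t, g t)) (fun z : E * E => z.1 + z.2) _ (nbhs (a *: u, v))).
  apply: cvg_prod => //=.
  apply: (@cvg_comp _ _ _ (fun t => ((a : R[i]^o), f t)) (fun z : R[i]^o * E => z.1 *: z.2) _ (nbhs ((a : R[i]^o), u))).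
    by apply: cvg_prod => //=; exact: cvg_cst.
  exact: (@scale_continuous _ E (a, u)).
exact: (@add_continuous E (a *: u, v)).
Qed.

Lemma approx_affine (a : R[i]) x x' : (fun PP => sc a PP.1 + PP.2) @
  filter_prod (approx x) (approx x') --> approx (a *: x + x').
Proof.
move=> A [U Ux UA].
have : (fun z : E * E => a *: z.1 + z.2) @ (x, x') --> a *: x + x'.
  by apply: affine_cvg; [exact: cvg_fst|exact: cvg_snd].
move=> /(_ U Ux) [[W W'] /= [Wx Wx'] WU].
exists ([set P | D P /\ W (iota P)], [set P | D P /\ W' (iota P)]).
  by split; apply: filterI; [exact: approx_D|exact: approx_nbhs|exact: approx_D|exact: approx_nbhs].
move=> [P P'] /= [[DP WP] [DP' WP']]; apply: UA.
  by apply: (scalingD scP) => //; exact: (scalingZ scP).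
by rewrite iota_linear//; exact: (WU (iota P, iota P')).
Qed.

(** Both sides are limits along the filter of triples of approximants; the two functions agree on
    [D], and limits in [E] are unique. *)
Lemma extension_linearl (m : X -> X -> X) (star : E -> E -> E) (a : R[i]) x x' y :
  (forall P Q, D P -> D Q -> D (m P Q)) ->
  (forall P P' Q, D P -> D P' -> D Q -> m (sc a P + P') Q = sc a (m P Q) + m P' Q) ->
  (forall x y, (fun PQ => iota (m PQ.1 PQ.2)) @ filter_prod (approx x) (approx y) --> star x y) ->
  star (a *: x + x') y = a *: star x y + star x' y.
Proof.
move=> mD ml starP.
pose T := filter_prod (filter_prod (approx x) (approx x')) (approx y).
have h1 : (fun t : X * X * X => iota (m (sc a t.1.1 + t.1.2) t.2)) @ T --> star (a *: x + x') y.
  apply: (@cvg_comp _ _ _ (fun t : X * X * X => (sc a t.1.1 + t.1.2, t.2))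
    (fun PQ => iota (m PQ.1 PQ.2)) _ (filter_prod (approx (a *: x + x')) (approx y))).
    apply: cvg_prod => /=; last exact: cvg_snd.
    apply: (@cvg_comp _ _ _ fst (fun PP => sc a PP.1 + PP.2) _ (filter_prod (approx x) (approx x'))).
      exact: cvg_fst.
    exact: approx_affine.
  exact: starP.
have h2 : (fun t : X * X * X => a *: iota (m t.1.1 t.2) + iota (m t.1.2 t.2)) @ T --> a *: star x y + star x' y.
  apply: affine_cvg.
    apply: (@cvg_comp _ _ _ (fun t : X * X * X => (t.1.1, t.2))
      (fun PQ => iota (m PQ.1 PQ.2)) _ (filter_prod (approx x) (approx y))); last exact: starP.
    apply: cvg_prod => /=; last exact: cvg_snd.
    by apply: (@cvg_comp _ _ _ fst fst _ (filter_prod (approx x) (approx x'))); exact: cvg_fst.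
  apply: (@cvg_comp _ _ _ (fun t : X * X * X => (t.1.2, t.2))
    (fun PQ => iota (m PQ.1 PQ.2)) _ (filter_prod (approx x') (approx y))); last exact: starP.
  apply: cvg_prod => /=; last exact: cvg_snd.
  by apply: (@cvg_comp _ _ _ fst snd _ (filter_prod (approx x) (approx x'))); [exact: cvg_fst|exact: cvg_snd].
apply: (@cvg_unique _ E_hausdorff _ _ _ _ h1 _).
apply: cvg_trans h2; apply: near_eq_cvg.
exists ([set PP | D PP.1 /\ D PP.2], [set Q | D Q]).
  split; last exact: approx_D.
  by exists ([set P | D P], [set P | D P]) => //; split; exact: approx_D.
move=> [[P P'] Q] /= [[DP DP'] DQ].
by rewrite ml// iota_linear//; exact: mD.
Qed.

Lemma extension_linearr (m : X -> X -> X) (star : E -> E -> E) (a : R[i]) x y y' :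
  (forall P Q, D P -> D Q -> D (m P Q)) ->
  (forall P Q Q', D P -> D Q -> D Q' -> m P (sc a Q + Q') = sc a (m P Q) + m P Q') ->
  (forall x y, (fun PQ => iota (m PQ.1 PQ.2)) @ filter_prod (approx x) (approx y) --> star x y) ->
  star x (a *: y + y') = a *: star x y + star x y'.
Proof.
move=> mD mr starP; pose m' P Q := m Q P; pose star' u v := star v u.
apply: (@extension_linearl m' star') => [P Q DP DQ|P P' Q DP DP' DQ|u v].
- exact: mD.
- exact: mr.
apply: (@cvg_comp _ _ _ (fun t : X * X => (t.2, t.1))
  (fun PQ => iota (m PQ.1 PQ.2)) _ (filter_prod (approx v) (approx u))); last exact: starP.
by apply: cvg_prod => /=; [exact: cvg_snd|exact: cvg_fst].
Qed.

(** For approximants the difference quotients satisfy a Cauchy condition whose constant involves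
    only seminorms. It passes to limits in closed neighbourhoods, and completeness then yields the
    derivative. *)
Lemma extension_entire (m : R[i] -> X -> X -> X) (star : R[i] -> E -> E -> E) x y :
  (forall h P Q, D P -> D Q -> D (m h P Q)) ->
  (forall h x y, (fun PQ => iota (m h PQ.1 PQ.2)) @ filter_prod (approx x) (approx y) --> star h x y) ->
  (forall h0 t, 0 <= t -> exists t' K, [/\ 0 <= t', 0 <= K & forall P Q h h', D P -> D Q ->
     h != 0 -> h' != 0 -> normc h <= 1 -> normc h' <= 1 ->
     N t (sc h^-1 (m (h0 + h) P Q - m h0 P Q) - sc h'^-1 (m (h0 + h') P Q - m h0 P Q)) <=
     K * normc (h - h') * (N t' P * N t' Q)]) ->
  entire (fun h => star h x y).
Proof.
move=> mD starP cauchy h0; apply: E_complete => W0 W00.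
have [W W0' WW] : filter_from (nbhs (0 : E)) closure W0 by exact: uniform_regular W00.
have [t [e [t0 e0 WN]]] := iota_continuous W0'.
have [t' [K [t'0 K0 mN]]] := cauchy h0 t t0.
have [K1 K10 B1] := approx_bounded x t'0; have [K2 K20 B2] := approx_bounded y t'0.
pose L := K * (K1 * K2) + 1.
have L0 : 0 < L by rewrite ltr_wpDl// !mulr_ge0.
(* Two increments below [d] differ by at most [e / L], and the minimum with 1 keeps them in the disc
   where the Cauchy condition is assumed. *)
pose d := Num.min 1 (e / L / 2).
have d0 : 0 < d by rewrite lt_min ltr01 !divr_gt0.
pose S : set R[i]^o := [set h | h != 0 /\ normc h < d].
have S0 : (0 : R[i]^o)^' S.
  have dC : 0 < real_complex R d :> R[i] by rewrite ltcR.
  have := @dnbhs0_lt _ (R[i]^o) _ dC.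
  have := nbhs_dnbhs_neq (0 : R[i]^o).
  apply: filterS2 => h hn0 hd; split=> //.
  by move: hd; rewrite normc_def ltcR; case: (h) => u v.
exists ((fun h : R[i]^o => h^-1 *: (star (h0 + h) x y - star h0 x y)) @` S,
        (fun h : R[i]^o => h^-1 *: (star (h0 + h) x y - star h0 x y)) @` S).
  by split; apply: filterS S0 => h Sh; exists h.
move=> [_ _] /= [[h [hn0 hd] <-] [h' [h'n0 h'd] <-]]; apply: WW => V Vq.
have h1 : normc h <= 1 by apply/ltW/(lt_le_trans hd); rewrite ge_min lexx.
have h'1 : normc h' <= 1 by apply/ltW/(lt_le_trans h'd); rewrite ge_min lexx.
have hh : normc (h - h') * L <= e.
  rewrite -ler_pdivlMr//; apply: le_trans (le_normcD _ _) _; rewrite normcN.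
  have H (u : R[i]) : normc u < d -> normc u <= e / L / 2.
    by move=> ud; apply/ltW/(lt_le_trans ud); rewrite ge_min lexx orbT.
  by rewrite [leRHS]splitr lerD ?H.
pose q (PQ : X * X) := h^-1 *: (iota (m (h0 + h) PQ.1 PQ.2) - iota (m h0 PQ.1 PQ.2)) -
  h'^-1 *: (iota (m (h0 + h') PQ.1 PQ.2) - iota (m h0 PQ.1 PQ.2)).
have qV : q @ filter_prod (approx x) (approx y) --> h^-1 *: (star (h0 + h) x y - star h0 x y) -
    h'^-1 *: (star (h0 + h') x y - star h0 x y).
  have B (f g : X * X -> E) u v : f @ filter_prod (approx x) (approx y) --> u ->
      g @ filter_prod (approx x) (approx y) --> v ->
      (fun z => f z - g z) @ filter_prod (approx x) (approx y) --> u - v.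
    move=> fu gv.
    have : (fun z => (-1) *: g z + f z) @ filter_prod (approx x) (approx y) --> (-1) *: v + u.
      by apply: affine_cvg.
    rewrite scaleN1r addrC.
    by under eq_fun do rewrite scaleN1r addrC.
  have Z (a : R[i]) (f : X * X -> E) u : f @ filter_prod (approx x) (approx y) --> u ->
      (fun z => a *: f z) @ filter_prod (approx x) (approx y) --> a *: u.
    move=> fu.
    have : (fun z => a *: f z + 0) @ filter_prod (approx x) (approx y) --> a *: u + 0.
      by apply: affine_cvg => //; exact: cvg_cst.
    rewrite addr0.
    by under eq_fun do rewrite addr0.
  by apply: (B); apply: (Z); apply: (B); apply: starP.
have [[A A'] /= [Ax Ay] AV] := qV V Vq.
have [P [[DP P1] AP]] := filter_ex (filterI B1 Ax).
have [Q [[DQ Q2] AQ]] := filter_ex (filterI B2 Ay).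
exists (q (P, Q)); split; last exact: (AV (P, Q)).
have Dm k := mD k P Q DP DQ.
have DB k := D_sub (Dm k) (Dm h0).
have DZ k := scalingZ scP k^-1 (DB (h0 + k)).
have iotaZ a u : D u -> iota (sc a u) = a *: iota u.
  move=> Du; have := iota_linear a Du (scaling0 scP); rewrite addr0 => ->.
  have := iotaB Du Du; rewrite !subrr => ->; by rewrite addr0.
rewrite /q /= -!iotaB// -!iotaZ// -iotaB//; apply: WN; first exact: D_sub.
apply: le_lt_trans (mN P Q h h' _ _ _ _ _ _) _ => //.
apply: (@le_lt_trans _ _ (K * normc (h - h') * (K1 * K2))).
  by rewrite ler_wpM2l ?mulr_ge0 ?normc_ge0//; apply: ler_pM; rewrite ?N_ge0.
(* The 1 in [L] makes the inequality strict only when the two increments differ; otherwise the bound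
   is 0. *)
have [hh0|hhn] := eqVneq (normc (h - h')) 0; first by rewrite hh0 mulr0 mul0r.
apply: lt_le_trans hh; rewrite mulrAC mulrC ltr_pM2l; first by rewrite /L ltrDl.
by rewrite lt_neqAle eq_sym hhn normc_ge0.
Qed.
End BilinearExtension.

(** * Polynomial dependence on the parameter *)

Section ModuleScaling.
Context {C : comNzRingType} (M : lmodType C).

Lemma lmod_scaling : scaling ( *:%R : C -> M -> M) (fun=> True).
Proof.
split=> //.
- by move=> a u v; rewrite scalerDr.
- by move=> a b v; rewrite scalerDl.
- by move=> a b v; rewrite scalerA.
- by move=> v; rewrite scale1r.
Qed.

Lemma linear_on_affine (T : M -> M) : (forall a v v', T (a *: v + v') = a *: T v + T v') ->
  linear_on ( *:%R : C -> M -> M) *:%R (fun=> True) (fun=> True) T.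
Proof.
move=> TL.
have T0 : T 0 = 0.
  by have := TL 1 0 0; rewrite !scale1r addr0 => /(congr1 (fun x => x - T 0)); rewrite subrr addrK.
split=> // [u v _ _|a v _]; first by have := TL 1 u v; rewrite !scale1r.
by have := TL a v 0; rewrite T0 !addr0.
Qed.
End ModuleScaling.

Section GuttLinear.
Context {C : numFieldType} {n : nat}.
Local Notation SymC := (malg (cmonom 'I_n) C).
Context (cst : 'I_n -> 'I_n -> 'I_n -> C) (beta : nat -> C).
Implicit Types (u : 'I_n -> SymC) (v : SymC) (a : C).

Lemma mu_linear a u u' : mu (fun c => a *: u c + u' c) = a *: mu u + mu u'.
Proof.
rewrite /mu scaler_sumr -big_split/=; apply: eq_bigr => b _.
by rewrite mulrDr malg_scaleAr.
Qed.

Lemma adD_linear a u u' :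
  adD cst (fun c => a *: u c + u' c) = fun c => a *: adD cst u c + adD cst u' c.
Proof.
apply/funext => c; rewrite /adD scaler_sumr -big_split/=; apply: eq_bigr => d _.
rewrite scaler_sumr -big_split/=; apply: eq_bigr => b _.
by rewrite derivD derivZ scalerDr !scalerA mulrC.
Qed.

Lemma iter_adD_linear k a u u' :
  iter k (adD cst) (fun c => a *: u c + u' c) =
  fun c => a *: iter k (adD cst) u c + iter k (adD cst) u' c.
Proof. by elim: k => [|k IH] //; rewrite !iterS IH adD_linear. Qed.

Lemma slot_linear a b v v' : slot b (a *: v + v') = fun c => a *: slot b v c + slot b v' c.
Proof. by apply/funext => c; rewrite /slot; case: eqP => // _; rewrite scaler0 addr0. Qed.

Lemma gutt_left_linear N z b a v v' : gutt_left cst beta N z b (a *: v + v') =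
  a *: gutt_left cst beta N z b v + gutt_left cst beta N z b v'.
Proof.
rewrite /gutt_left slot_linear scaler_sumr -big_split/=; apply: eq_bigr => j _.
by rewrite iter_adD_linear mu_linear scalerDr !scalerA mulrC.
Qed.

(** One letter at a time by [polyfun_diag]: both the left multiplication and its argument depend on
    z. *)
Lemma polyfun_gutt_word N w v :
  polyfun ( *:%R : C -> SymC -> SymC) (fun=> True) (fun z => gutt_word cst beta N z w v).
Proof.
have sP := lmod_scaling SymC.
elim: w => [|b w IH]; first exact: (polyfun_cst sP).
have L z : linear_on ( *:%R : C -> SymC -> SymC) *:%R (fun=> True) (fun=> True)
    (gutt_left cst beta (N + size w) z b).
  by apply: linear_on_affine; apply: gutt_left_linear.
apply: (polyfun_diag sP sP L _ IH) => u _; apply: (polyfun_sum sP) => j.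
by apply: (polyfun_scale sP); apply: (polyfun_cst sP).
Qed.

Lemma polyfun_gutt_prod N w v :
  polyfun ( *:%R : C -> SymC -> SymC) (fun=> True) (fun z => gutt_prod cst beta N z w v).
Proof.
have sP := lmod_scaling SymC; rewrite /gutt_prod.
have -> : (fun z => (size w)`!%:R^-1 *: \sum_(s : 'S_(size w)) gutt_word cst beta N z (permt (in_tuple w) s) v) =
  fun z => ((size w)`!%:R^-1 * z ^+ 0) *: \sum_(s : 'S_(size w)) gutt_word cst beta N z (permt (in_tuple w) s) v.
  by apply/funext => z; rewrite expr0 mulr1.
apply: (polyfun_scale sP); apply: (polyfun_sum sP) => s.
exact: polyfun_gutt_word.
Qed.
End GuttLinear.

(** * Linearity, polynomial dependence and bounds for the Weyl product *)

Section Weyl.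
Context {R : realType} {n : nat} {G : lieGroupType R n}.
Context (B : 'M[R]_n) (B_unit : B \in unitmx) (r : R) (r_ge0 : 0 <= r).
Implicit Types (P Q : FSym G) (phi psi : G -> R[i]) (m : cmonom 'I_n).
Local Notation normc := (@ComplexField.Normc.normc R).
Local Notation normcM := (@ComplexField.Normc.normcM R).
Local Notation normcV := (@ComplexField.Normc.normcV R).
Local Notation pol := (pol B r).
Local Notation ER := (ER B r).
Local Notation stdF := (@stdF R n G B).
Local Notation expF := (@expF R n G B).
Local Notation DelF := (@DelF R n G B).
Local Notation scF := (@scaleF R n G).

Lemma pol_scaling : scaling scF pol.
Proof.
split.
- exact: pol0.
- exact: polD.
- exact: polZ.
- exact: scaleFD.
- exact: scaleFDl.
- exact: scaleFA.
- exact: scaleF1.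
Qed.

Lemma polyfun_std1 m phi m' psi : ER phi -> ER psi ->
  polyfun scF pol (fun z => std1 B z m phi m' psi).
Proof.
move=> H K; apply: (polyfun_sum pol_scaling) => p; apply: (polyfun_sum pol_scaling) => s.
set chi := (fun g => phi g * _); have Hchi : ER chi by apply: ERM => //; apply: ER_lie_word.
under eq_fun do rewrite mulrC.
apply: (polyfun_scale pol_scaling).
have L (z : R[i]) : linear_on ( *:%R : R[i] -> Sym R n -> Sym R n) scF (fun=> True) pol (tensF chi).
  split=> [v _|u v _ _|a v _]; first exact: pol_tensF.
  - have := tensF_sum chi [:: u; v] id; rewrite !big_cons !big_nil !addr0; exact.
  - exact: tensFZr.
apply: (polyfun_diag (lmod_scaling (Sym R n)) pol_scaling L _ (polyfun_gutt_prod _ _ _ _ _)) => v _.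
by apply: (polyfun_cst pol_scaling); apply: pol_tensF.
Qed.

Lemma polyfun_stdF P Q : pol P -> pol Q -> polyfun scF pol (fun z => stdF z P Q).
Proof.
move=> H K.
have -> : (fun z => stdF z P Q) = fun z =>
    \sum_(m <- msupp P) \sum_(m' <- msupp Q) std1 B z m (cf m P) m' (cf m' Q).
  by rewrite unlock.
apply: (polyfun_sum pol_scaling) => m; apply: (polyfun_sum pol_scaling) => m'.
exact: polyfun_std1.
Qed.

Lemma polyfun_expF M (c : R[i]) P : pol P -> polyfun scF pol (fun h => expF M (c * h) P).
Proof.
move=> H.
have -> : (fun h => expF M (c * h) P) = fun h =>
    \sum_(k < M) scF (c ^+ k / k`!%:R * h ^+ k) (iter k DelF P).
  by rewrite unlock; apply/funext => h; apply: eq_bigr => k _; rewrite exprMn mulrAC.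
apply: (polyfun_sum pol_scaling) => k; apply: (polyfun_scale pol_scaling).
by apply: (polyfun_cst pol_scaling); apply: pol_iter_DelF.
Qed.

Lemma degbound_scaleF N (a : R[i]) P : degbound N P -> degbound N (scF a P).
Proof. by move=> H m Nm; rewrite cf_scaleF H//; apply/funext => g; rewrite mulr0. Qed.

Lemma degbound_expF N M (a : R[i]) P : degbound N P -> degbound N (expF M a P).
Proof.
move=> H; rewrite unlock; apply: degbound_sum => k; apply: degbound_scaleF.
elim: (val k) => [//|j IH]; rewrite iterS; exact: (degboundW (leq_pred _) (degbound_DelF B IH)).
Qed.

Lemma degbound_stdF N N' z P Q : degbound N P -> degbound N' Q ->
  degbound (N + N') (stdF z P Q).
Proof.
move=> H K; rewrite unlock /lift.
have dg M (X : FSym G) k : degbound M X -> k \in msupp X -> (mdeg k < M)%N.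
  move=> HX kX; rewrite ltnNge; apply/negP => /HX/eqP; rewrite -[_ == _]negbK cf_neq0 kX//.
rewrite big_seq; elim/big_ind: _ => [k _|x y|m mP]; [by rewrite cf0|exact: degboundD|].
rewrite big_seq; elim/big_ind: _ => [k _|x y|m' mQ]; [by rewrite cf0|exact: degboundD|].
have mN := dg _ _ _ H mP; have mN' := dg _ _ _ K mQ.
apply: degbound_sum => p; apply: degbound_sum => s; apply: degbound_scaleF => k Nk.
rewrite cf_tensF (_ : cf k _ = 0); first by apply/funext => g; rewrite mulr0.
have Hm : degbound (mdeg m').+1 (mono m' : malg (cmonom 'I_n) R[i]) by apply: degbound_mono.
apply: (degbound_gutt_prod _ _ _ Hm); apply: leq_trans Nk.
have : (size (drop p (permw s)) <= mdeg m)%N.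
  by rewrite size_drop size_map size_enum_ord -size_mword leq_subr.
by move: mN mN'; clear; lia.
Qed.

(** The truncation orders are fixed beforehand, independently of [h], so that linearity and
    polynomial dependence can be read off; the middle product has degree below [N + N']. *)
Definition weylF (N N' : nat) (h : R[i]) P Q : FSym G :=
  expF (N + N') ('i%C / 2%:R * h)
    (stdF (h * 'i%C^-1) (expF N (- ('i%C / 2%:R) * h) P) (expF N' (- ('i%C / 2%:R) * h) Q)).

Lemma weyl_starE N N' h P Q : degbound N P -> degbound N' Q ->
  weyl_star B h P Q = weylF N N' h P Q.
Proof.
move=> H K; rewrite /weyl_star /Nop_inv /Nop std_starE//.
rewrite (exp_DeltaE B _ H) (exp_DeltaE B _ K).
have -> : - ('i%C * h / 2%:R) = - ('i%C / 2%:R) * h by rewrite mulNr mulrAC.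
rewrite mulrAC; apply: exp_DeltaE.
by apply: degbound_stdF; apply: degbound_expF.
Qed.

Lemma pol_expF M a P : pol P -> pol (expF M a P).
Proof. by move=> H; have [+ _ _] := @pol_linear_expF R n G B r r_ge0 M a; apply. Qed.

Lemma pol_weylF N N' h P Q : pol P -> pol Q -> pol (weylF N N' h P Q).
Proof. by move=> H K; apply: pol_expF; apply: pol_stdF => //; apply: pol_expF. Qed.

Lemma degbound_ex P : exists N, degbound N P.
Proof. by eexists; apply: degbound_msize. Qed.

Lemma pol_weyl h P Q : pol P -> pol Q -> pol (weyl_star B h P Q).
Proof.
have [N HN] := degbound_ex P; have [N' HN'] := degbound_ex Q.
by rewrite (weyl_starE _ HN HN'); apply: pol_weylF.
Qed.

Lemma polyfun_weyl P Q : pol P -> pol Q -> polyfun scF pol (fun h => weyl_star B h P Q).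
Proof.
move=> H K; have [N HN] := degbound_ex P; have [N' HN'] := degbound_ex Q.
have -> : (fun h => weyl_star B h P Q) = weylF N N' ^~ P ^~ Q.
  by apply/funext => h; apply: weyl_starE.
have lin_exp M a : linear_on scF scF pol pol (expF M a) by apply: pol_linear_expF.
apply: (polyfun_diag (F := fun h X => expF (N + N') ('i%C / 2%:R * h) X) pol_scaling pol_scaling) => //.
  by move=> v Hv; apply: polyfun_expF.
apply: (polyfun_diag (F := fun h X => stdF (h * 'i%C^-1) X (expF N' (- ('i%C / 2%:R) * h) Q)) pol_scaling pol_scaling).
- by move=> h; apply: stdF_linearl => //; apply: pol_expF.
- move=> X HX; apply: (polyfun_diag (F := fun h Y => stdF (h * 'i%C^-1) X Y) pol_scaling pol_scaling).
  + by move=> h; apply: stdF_linearr.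
  + move=> Y HY; apply: (@polyfun_subst _ _ _ _ pol_scaling 'i%C^-1 (fun z => stdF z X Y)).
    exact: polyfun_stdF.
  + exact: polyfun_expF.
- exact: polyfun_expF.
Qed.

Lemma weyl_linearl h (a : R[i]) P P' Q : pol P -> pol P' -> pol Q ->
  weyl_star B h (scF a P + P') Q = scF a (weyl_star B h P Q) + weyl_star B h P' Q.
Proof.
move=> H H' K; have [N1 HN1] := degbound_ex P; have [N2 HN2] := degbound_ex P'.
have [N' HN'] := degbound_ex Q; pose N := maxn N1 N2.
have HP : degbound N P by apply: degboundW HN1; apply: leq_maxl.
have HP' : degbound N P' by apply: degboundW HN2; apply: leq_maxr.
rewrite (weyl_starE h HP HN') (weyl_starE h HP' HN').
rewrite (weyl_starE h (degboundD (degbound_scaleF a HP) HP') HN') /weylF.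
set Q' := expF N' _ Q; have HQ' : pol Q' by apply: pol_expF.
set z := h * _; set b := _ * h; set d := _ * h.
have [_ tD tZ] := pol_linear_comp (@pol_linear_expF R n G B r r_ge0 (N + N') b)
  (pol_linear_comp (stdF_linearl r_ge0 z HQ') (@pol_linear_expF R n G B r r_ge0 N d)).
have := tD _ _ (polZ a H) H'; rewrite (tZ a P H); exact.
Qed.

Lemma weyl_linearr h (a : R[i]) P Q Q' : pol P -> pol Q -> pol Q' ->
  weyl_star B h P (scF a Q + Q') = scF a (weyl_star B h P Q) + weyl_star B h P Q'.
Proof.
move=> H K K'; have [N1 HN1] := degbound_ex Q; have [N2 HN2] := degbound_ex Q'.
have [N HN] := degbound_ex P; pose N' := maxn N1 N2.
have HQ : degbound N' Q by apply: degboundW HN1; apply: leq_maxl.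
have HQ' : degbound N' Q' by apply: degboundW HN2; apply: leq_maxr.
rewrite (weyl_starE h HN HQ) (weyl_starE h HN HQ').
rewrite (weyl_starE h HN (degboundD (degbound_scaleF a HQ) HQ')) /weylF.
set P' := expF N _ P; have HP' : pol P' by apply: pol_expF.
set z := h * _; set b := _ * h; set d := _ * h.
have [_ tD tZ] := pol_linear_comp (@pol_linear_expF R n G B r r_ge0 (N + N') b)
  (pol_linear_comp (stdF_linearr r_ge0 z HP') (@pol_linear_expF R n G B r r_ge0 N' d)).
have := tD _ _ (polZ a K) K'; rewrite (tZ a Q K); exact.
Qed.

Context (rho : R) (rho_ge1 : 1 <= rho).
Local Notation N t := (Nrm B r rho t t).

Lemma normc_i : normc 'i%C = 1.
Proof. by rewrite /= expr0n expr1n add0r sqrtr1. Qed.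

Lemma weyl_bounded z0 t : 0 <= z0 -> 0 <= t -> exists2 t', 0 <= t' &
  forall h P Q, normc h <= z0 -> pol P -> pol Q ->
    N t (weyl_star B h P Q) <= N t' P * N t' Q.
Proof.
move=> z00 t0.
(* Constants are fixed from the outside in: [c1] for the inverse of N, [c2] for the standard-ordered
   product, [c3] for N on both arguments. The parameters of all these operators have modulus at most
   [z0]. *)
pose c1 := 2 * Num.max t 1; pose c1' := t + z0.
have c10 : 0 <= c1 by rewrite mulr_ge0// le_max ler01 orbT.
have c1'0 : 0 <= c1' by rewrite addr_ge0.
pose c2 := std_c r c1; pose c2' := @std_c' R n G B rho c1' z0.
have c20 : 0 <= c2 by apply: std_c_ge0.
have c2'0 : 0 <= c2' by apply: std_c'_ge0.
pose c3 := 2 * Num.max c2 1; pose c3' := c2' + z0.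
have c30 : 0 <= c3 by rewrite mulr_ge0// le_max ler01 orbT.
have c3'0 : 0 <= c3' by rewrite addr_ge0.
exists (Num.max c3 c3'); first by rewrite le_max c30.
move=> h P Q hz H K; have [M HM] := degbound_ex P; have [M' HM'] := degbound_ex Q.
rewrite (weyl_starE h HM HM') /weylF.
have half : normc ('i%C / 2%:R * h) <= z0.
  rewrite !normcM normcV normc_i mul1r normc_natr; apply: le_trans hz.
  by rewrite ler_piMl ?normc_ge0// invf_le1// ler1n.
have nhalf : normc (- ('i%C / 2%:R) * h) <= z0 by rewrite mulNr normcN.
have zz : normc (h * 'i%C^-1) <= z0 by rewrite normcM normcV normc_i invr1 mulr1.
have E X a L : pol X -> normc a <= z0 -> Nrm B r rho c2 c2' (expF L a X) <= N (Num.max c3 c3') X.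
  move=> HX az; apply: le_trans (Nrm_expF r_ge0 rho_ge1 c20 c2'0 _ _ HX) _.
  have ca0 : 0 <= c2' + normc a by apply: addr_ge0 c2'0 _; apply: normc_ge0.
  have ca : c2' + normc a <= c3' by rewrite lerD2l.
  apply: Nrm_mono => //; first by rewrite le_max lexx.
  by apply: le_trans ca _; rewrite le_max lexx orbT.
have HP := pol_expF M (- ('i%C / 2%:R) * h) H; have HQ := pol_expF M' (- ('i%C / 2%:R) * h) K.
have HS := pol_stdF r_ge0 (h * 'i%C^-1) HP HQ.
apply: le_trans (Nrm_expF r_ge0 rho_ge1 t0 t0 _ _ HS) _.
apply: (@le_trans _ _ (Nrm B r rho c1 c1' (stdF (h * 'i%C^-1) (expF M (- ('i%C / 2%:R) * h) P)
    (expF M' (- ('i%C / 2%:R) * h) Q)))).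
  by apply: Nrm_mono => //; rewrite ?addr_ge0 ?normc_ge0// lerD2l.
apply: le_trans (Nrm_stdF r_ge0 rho_ge1 c10 c1'0 z00 zz HP HQ) _.
by apply: ler_pM; rewrite ?Nrm_ge0 ?E.
Qed.
End Weyl.

Lemma cauchy_weyl (R : realType) (n : nat) (G : lieGroupType R n) (B : 'M[R]_n)
    (B_unit : B \in unitmx) (r rho : R) (r_ge0 : 0 <= r) (rho_ge1 : 1 <= rho)
    (h0 : R[i]) (t : R) : 0 <= t -> exists t' K : R, [/\ 0 <= t', 0 <= K &
  forall (P Q : FSym G) (h h' : R[i]), pol B r P -> pol B r Q ->
    h != 0 -> h' != 0 -> normc h <= 1 -> normc h' <= 1 ->
    Nrm B r rho t t (scaleF h^-1 (weyl_star B (h0 + h) P Q - weyl_star B h0 P Q) -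
      scaleF h'^-1 (weyl_star B (h0 + h') P Q - weyl_star B h0 P Q)) <=
    K * normc (h - h') * (Nrm B r rho t' t' P * Nrm B r rho t' t' Q)].
Proof.
move=> t0.
(* The Cauchy estimate needs a bound on the disc of radius 2 around [h0]. *)
have z00 : 0 <= normc h0 + 2 by rewrite addr_ge0 ?normc_ge0.
have [t' t'0 W] := weyl_bounded (G := G) B_unit r_ge0 rho_ge1 z00 t0.
exists t', 2; split=> // P Q h h' HP HQ hn0 h'n0 h1 h'1.
pose f (s : R[i]) := weyl_star B (h0 + s) P Q.
have fP : polyfun (@scaleF R n G) (pol B r) f.
  exact: (polyfun_shift (pol_scaling _ _) h0 (polyfun_weyl B_unit r_ge0 HP HQ)).
have fS s : normc s <= 2 -> Nrm B r rho t t (f s) <= Nrm B r rho t' t' P * Nrm B r rho t' t' Q.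
  move=> s2; apply: W => //; apply: le_trans (le_normcD _ _) _.
  by rewrite lerD2l.
have f0 : f 0 = weyl_star B h0 P Q by rewrite /f addr0.
have N0 := Nrm0 B r rho t t : Nrm B r rho t t (0 : FSym G) = 0.
have Nge0 v : 0 <= Nrm B r rho t t (v : FSym G) by apply: Nrm_ge0.
have ND u v : pol B r u -> pol B r v ->
    Nrm B r rho t t (u + v : FSym G) <= Nrm B r rho t t u + Nrm B r rho t t v by apply: NrmD.
have NZ (a : R[i]) (v : FSym G) : pol B r v ->
    Nrm B r rho t t (scaleF a v) <= normc a * Nrm B r rho t t v by apply: NrmZ.
have := cauchy_difference (pol_scaling B r) N0 Nge0 ND NZ fP fS hn0 h'n0 h1 h'1.
by rewrite f0 mulrAC.
Qed.

Theorem corollary6p8 (R : realType) (n : nat) (G : lieGroupType R n)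
    (G_connected : connected [set: G])
    (B : 'M[R]_n) (B_basis : B \in unitmx)
    (r r' : R) (r_ge0 : 0 <= r) (r'_ge1 : 1 <= r')
    (E : tvsType R[i]) (iota : FSym G -> E)
    (E_completion : is_completion B r r' iota) :
  exists star : R[i] -> E -> E -> E,
    [/\ forall (hbar a : R[i]) (x x' y y' : E),
          star hbar (a *: x + x') y = a *: star hbar x y + star hbar x' y /\
          star hbar x (a *: y + y') = a *: star hbar x y + star hbar x y',
        forall hbar : R[i],
          continuous (fun xy : E * E => star hbar xy.1 xy.2),
        forall (hbar : R[i]) (P Q : FSym G),
          inPol B r P -> inPol B r Q ->
          inPol B r (weyl_star B hbar P Q) /\
          star hbar (iota P) (iota Q) = iota (weyl_star B hbar P Q)
      & forall P Q : E, entire (fun hbar => star hbar P Q)].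
Proof.
pose D := pol B r : FSym G -> Prop; pose N t := Nrm B r r' t t : FSym G -> R.
have scP : scaling (@scaleF R n G) D := pol_scaling B r.
case: E_completion => E_haus E_compl i_lin i_dense i_cont i_open.
have iota_linear a P Q : D P -> D Q -> iota (scaleF a P + Q) = a *: iota P + iota Q.
  by move=> /inPolP HP /inPolP HQ; rewrite -fscaleE i_lin.
have iota_dense : closure (iota @` [set P | D P]) = setT.
  by rewrite -i_dense; congr (closure (_ @` _)); apply/seteqP; split=> P /inPolP.
have iota_cont (U : set E) : nbhs 0 U ->
    exists t e : R, [/\ 0 <= t, 0 < e & forall P, D P -> N t P < e -> U (iota P)].
  (* The two parameters are merged into their maximum, since the seminorms increase in both. *)
  move=> /i_cont[c [c' [e [c0 c'0 e0 H]]]]; exists (Num.max c c'), e; split=> //.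
    by rewrite le_max c0.
  move=> P DP NP; apply: H; first exact/inPolP.
  rewrite pol_normE// lte_fin; apply: le_lt_trans NP.
  by apply: Nrm_mono => //; rewrite le_max lexx ?orbT.
have iota_open t e : 0 <= t -> 0 < e ->
    exists2 U : set E, nbhs 0 U & forall P, D P -> U (iota P) -> N t P < e.
  move=> t0 e0; have [U U0 H] := i_open t t e t0 t0 e0; exists U => // P DP UP.
  by rewrite -lte_fin -pol_normE//; apply: H => //; apply/inPolP.
have N_ge0 t P : 0 <= t -> 0 <= N t P by move=> t0; apply: Nrm_ge0.
have N_add t P Q : 0 <= t -> D P -> D Q -> N t (P + Q) <= N t P + N t Q.
  by move=> t0 DP DQ; apply: NrmD.
have mD h P Q : D P -> D Q -> D (weyl_star B h P Q) by apply: pol_weyl.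
have mlin h a P P' Q : D P -> D P' -> D Q -> weyl_star B h (scaleF a P + P') Q =
    scaleF a (weyl_star B h P Q) + weyl_star B h P' Q by apply: weyl_linearl.
have mrin h a P Q Q' : D P -> D Q -> D Q' -> weyl_star B h P (scaleF a Q + Q') =
    scaleF a (weyl_star B h P Q) + weyl_star B h P Q' by apply: weyl_linearr.
have mbd h t : 0 <= t -> exists t' K, [/\ 0 <= t', 0 <= K &
    forall P Q, D P -> D Q -> N t (weyl_star B h P Q) <= K * (N t' P * N t' Q)].
  move=> t0; have [t' t'0 W] := weyl_bounded (G := G) B_basis r_ge0 r'_ge1 (normc_ge0 h) t0.
  by exists t', 1; split=> // P Q DP DQ; rewrite mul1r; apply: W.
have ext (hxy : R[i] * E * E) : exists l : E,
    (fun PQ => iota (weyl_star B hxy.1.1 PQ.1 PQ.2)) @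
      filter_prod (approx D iota hxy.1.2) (approx D iota hxy.2) --> l.
  apply: (@extension_ex R E (FSym G) (@scaleF R n G) D scP iota N) => //.
  - exact: mD.
  - by move=> P P' Q DP DP' DQ; have := mlin hxy.1.1 1 P P' Q DP DP' DQ; rewrite !scaleF1.
  - by move=> P Q Q' DP DQ DQ'; have := mrin hxy.1.1 1 P Q Q' DP DQ DQ'; rewrite !scaleF1.
  - exact: mbd.
(* Limits are chosen for all triples at once; [E] is Hausdorff and the filters are proper, so the
   values are determined. *)
have /choice[s sP] := ext.
pose star h x y := s (h, x, y).
have starP h x y : (fun PQ => iota (weyl_star B h PQ.1 PQ.2)) @
    filter_prod (approx D iota x) (approx D iota y) --> star h x y := sP (h, x, y).
exists star; split.
- move=> h a x x' y y'; split.
    exact: (extension_linearl scP E_haus iota_linear iota_dense x x' y (mD h) (mlin h a) (starP h)).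
  exact: (extension_linearr scP E_haus iota_linear iota_dense x y y' (mD h) (mrin h a) (starP h)).
- by move=> h; apply: (@star_continuous R E (FSym G) D iota _ (weyl_star B h)).
- move=> h P Q /inPolP DP /inPolP DQ; split; first exact/inPolP/mD.
  exact: (star_iota E_haus (starP h)).
- move=> x y.
  apply: (extension_entire scP E_compl iota_linear iota_dense iota_cont iota_open N_ge0 N_add x y mD starP).
  by move=> h0 t; apply: cauchy_weyl.
Qed.
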